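(* Let $m\ge 1$ and let $(N_j,B_j,L_j)$, $1\le j\le m$, be finitely many Hadamard triples, with $N_j\ge 2$ integers and $B_j,L_j\subset\mathbb{Z}$ finite. Assume $$\rho:=\min_{1\le j\le m}\frac{N_j}{\#B_j}>1.$$ Let $\omega=(\omega_k)_{k\ge1}\in\{1,\dots,m\}^{\mathbb{N}}$ and let $(n_k)_{k\ge 1}$ be a sequence of positive integers. Put $q_k=N_{\omega_k}^{n_k}$, $D_k=B_{\omega_k}$, $M_k=q_1q_2\cdots q_k$, let $$\mu=\delta_{M_1^{-1}D_1}*\delta_{M_2^{-1}D_2}*\cdots*\delta_{M_k^{-1}D_k}*\cdots,$$ and let $$\kappa_\omega=\limsup_{R\to\infty}\frac{\sum_{r=1}^R\log \#D_r}{\sum_{r=1}^R\log q_r}.$$ Let $$\mathcal{T}_*=\bigcap_{j=1}^m\{t\in\mathbb{Z}\setminus\{0\}:(N_j,B_j,tL_j)\text{ is a Hadamard triple}\}.$$ Then for every $s\in[0,\kappa_\omega]$ there are continuum many countable sets $\Lambda\subset\mathbb{Z}$ such that $t\Lambda$ is a spectrum of $\mu$ for every $t\in\mathcal{T}_*$ and $\dim_{Be}\Lambda=s$. Consequently, $\mathcal{T}_*$ is a spectral eigenvalue set for $\mu$, and, for every $s\in[0,\kappa_\omega]$, the set $$V_s(\mu,\mathcal{T}_* ):=\{\Lambda\subset\mathbb{Z}: t\Lambda\text{ is a spectrum of }\mu\text{ for every }t\in\mathcal{T}_*,\ \dim_{Be}\Lambda=s\}$$ satisfies $\#V_s(\mu,\mathcal{T}_*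 )=2^{\aleph_0}$.
   Context: For an integer $N\ge2$ and finite sets $\mathcal{D},L\subset\mathbb{Z}$ with $\#\mathcal{D}=\#L$, $(N,\mathcal{D},L)$ is a Hadamard triple if the matrix $\frac{1}{\sqrt{\#\mathcal{D}}}\left(e^{-2\pi i d\ell/N}\right)_{d\in\mathcal{D},\ell\in L}$ is unitary. For a finite set $\mathcal{D}\subset\mathbb{R}$, $\delta_{\mathcal{D}}=\frac{1}{\#\mathcal{D}}\sum_{d\in\mathcal{D}}\delta_d$, where $\delta_d$ is the Dirac mass at $d$. Scalar multiples of sets ($M_k^{-1}D_k$, $tL_j$, $t\Lambda$) are taken elementwise. The infinite convolution $\mu$ is the weak limit of the finite convolutions $\delta_{M_1^{-1}D_1}*\cdots*\delta_{M_n^{-1}D_n}$. A countable set $\Lambda\subset\mathbb{R}$ is a spectrum of a Borel probability measure $\mu$ on $\mathbb{R}$ if $\{e^{2\pi i\lambda x}:\lambda\in\Lambda\}$ is an orthonormal basis of $L^2(\mu)$. A set $\mathcal{A}\subset\mathbb{R}\setminus\{0\}$ is a spectral eigenvalue set for $\mu$ if $\mu$ admits a spectrum $\Lambda$ such that $a\Lambda$ is a spectrum of $\mu$ for every $a\in\mathcal{A}$. The Beurling dimension of a countable set $\Lambda\subset\mathbb{R}$ is $$\dim_{Be}(\Lambda)=\limsup_{h\to\infty}\sup_{x\in\mathbb{R}}\frac{\log\#(\Lambda\cap(x-\frac h2,x+\frac h2))}{\log h}.$$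
   Formalization: The cardinality claim is stated assuming infinitely many D_k have at least two elements; otherwise μ is finitely supported and only countably many Λ⊂Z qualify (e.g. m=1, N=2, B=L={0}, μ=δ_0), so the claim as written fails. *)

(* Defs.v *)
From HB Require Import structures.
From mathcomp Require Import all_boot all_order all_algebra finmap.
From mathcomp Require Import spectral.
From mathcomp Require Import all_classical all_reals all_analysis.
From mathcomp Require Import complex.

Set Implicit Arguments.
Unset Strict Implicit.
Unset Printing Implicit Defensive.

Import Order.TTheory GRing.Theory Num.Theory.
Import numFieldNormedType.Exports.

Local Open Scope classical_set_scope.
Local Open Scope ring_scope.

(* e ^ (i x) *)
Definition expi (R : realType) (x : R) : R[i] := Complex (cos x) (sin x).

(* The matrix is indexed by the enumerations of B and L.  [unitarymx] reads
   A *m A^t* = 1, which is unitarity since #B = #L makes the matrix square. *)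
Definition hadamard_mx (R : realType) (N : nat) (B L : {fset int}) :
    'M[R[i]]_(#|` B|, #|` L|) :=
  \matrix_(i, j)
    ((Num.sqrt (#|` B|%:R : R))^-1%:C%C *
     expi (- (2 * pi * ((enum_fset B)`_i * (enum_fset L)`_j)%:~R / N%:R))).

Definition hadamard_triple (R : realType) (N : nat) (B L : {fset int}) : Prop :=
  [/\ (2 <= N)%N, #|` B| = #|` L| & hadamard_mx R N B L \is unitarymx].

Definition common_scalings (R : realType) (m : nat) (N : 'I_m -> nat)
    (B L : 'I_m -> {fset int}) : set int :=
  [set t | t != 0 /\
    forall j, hadamard_triple R (N j) (B j) [fset t * l | l in L j]%fset].

Section Measures.
Context (R : realType).

(* [mnormalize] divides by the total mass, which is #D here (see
   [udiracE]); the Dirac mass at 0 is only its default value for D empty. *)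
Definition udirac (D : {fset R}) : probability R R :=
  mnormalize (msum (fun k => dirac ((enum_fset D)`_k : R)) #|` D|)
    (dirac (0 : R)).

Lemma udiracE (D : {fset R}) (A : set R) : D != fset0 ->
  (udirac D A = (#|` D|%:R^-1)%:E * \sum_(d <- enum_fset D) \d_d A)%E.
Proof.
move=> D0; rewrite /udirac/= /mnormalize/= /msum.
have -> : (\sum_(k < #|` D|) dirac ((enum_fset D)`_k : R) [set: R] =
           #|` D|%:R%:E :> \bar R)%E.
  under eq_bigr do rewrite diracT.
  by rewrite sumEFin big_const_ord iter_addr_0.
have D0' : #|` D|%:R != 0 :> R by rewrite pnatr_eq0 cardfs_eq0.
rewrite eqe (negbTE D0') /= muleC; congr (_ * _)%E.
by rewrite [RHS](big_nth 0) big_mkord.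
Qed.

Definition addp (z : R * R) : R := z.1 + z.2.

Lemma measurable_addp : measurable_fun setT addp.
Proof. exact: measurable_realfun.measurable_funD measurable_fst measurable_snd. Qed.

HB.instance Definition _ := isMeasurableFun.Build _ _ _ _ addp measurable_addp.

Definition convolution (P Q : probability R R) : probability R R :=
  distribution (P \x Q)%E addp.

Fixpoint convolutions (P : nat -> probability R R) (k : nat) :
    probability R R :=
  if k is k'.+1 then convolution (convolutions P k') (P k) else P 0%N.

Definition weak_cvg (P : nat -> probability R R) (Q : probability R R) : Prop :=
  forall f : R -> R, continuous f -> bounded_fun f ->
    \int[P n]_x f x @[n --> \oo] --> \int[Q]_x f x.

Definition infinite_convolution (P : nat -> probability R R)
  (mu : probability R R) : Prop := weak_cvg (convolutions P) mu.

Definition cintegral (mu : probability R R) (f : R -> R[i]) : R[i] :=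
  Complex (\int[mu]_x complex.Re (f x)) (\int[mu]_x complex.Im (f x)).

Definition expo (l x : R) : R[i] := expi (2 * pi * l * x).

Definition cL2norm (mu : probability R R) (f : R -> R[i]) : \bar R :=
  Lnorm mu 2%:E (EFin \o (fun x => Normc.normc (f x))).

Definition in_cL2 (mu : probability R R) (f : R -> R[i]) : Prop :=
  [/\ measurable_fun setT (@complex.Re R \o f),
      measurable_fun setT (@complex.Im R \o f) &
      (cL2norm mu f < +oo)%E].

(* Orthonormal basis of the complex L^2(mu): an orthonormal family whose
   linear span is dense. *)
Definition spectrum (mu : probability R R) (Lam : set R) : Prop :=
  [/\ countable Lam,
      forall a b, Lam a -> Lam b ->
        cintegral mu (fun x => expo a x * conjc (expo b x)) = (a == b)%:R &
      forall f, in_cL2 mu f -> forall eps : R, 0 < eps ->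
        exists (s : seq R) (c : R -> R[i]), [set` s] `<=` Lam /\
          (cL2norm mu (fun x => f x - \sum_(l <- s) c l * expo l x)%R
             < eps%:E)%E].

Definition scale_set (a : R) (Lam : set R) : set R :=
  [set a * x | x in Lam].

Definition intset (Lam : set int) : set R := [set l%:~R | l in Lam].

Definition spectral_eigenvalue_set (mu : probability R R) (A : set R) : Prop :=
  ~ A 0 /\ exists Lam, spectrum mu Lam /\
    forall a, A a -> spectrum mu (scale_set a Lam).

(* [lne 0 = -oo] and [counting] is +oo on infinite sets. *)
Definition beurling_dim (Lam : set R) : \bar R :=
  limf_esup (fun h : R =>
    ereal_sup [set (lne (counting (Lam `&` `](x - h / 2)%R, (x + h / 2)%R[))
                      * ((ln h)^-1)%:E)%E | x in [set: R]])
  +oo.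

Definition integer_spectra (mu : probability R R) (T : set int) (s : R) :
    set (set int) :=
  [set Lam | (forall t, T t -> spectrum mu (scale_set t%:~R (intset Lam)))
          /\ beurling_dim (intset Lam) = s%:E].

(* Sequences are indexed from 0: index k here is index k+1 in the usual
   1-based notation. *)
Definition scaling_product (q : nat -> nat) (k : nat) : nat :=
  \prod_(i < k.+1) q i.

Definition scaled_digits (q : nat -> nat) (D : nat -> {fset int}) (k : nat) :
    {fset R} :=
  [fset d%:~R / (scaling_product q k)%:R | d in D k]%fset.

Definition kappa (q : nat -> nat) (D : nat -> {fset int}) : \bar R :=
  limn_esup (fun n =>
    ((\sum_(r < n.+1) ln (#|` D r|%:R : R)) /
     (\sum_(r < n.+1) ln ((q r)%:R : R)))%:E).

(* Since x / 0 = 0, [1 < min_ratio N B] forces every B j to be nonempty. *)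
Definition min_ratio (m : nat) (N : 'I_m.+1 -> nat)
    (B : 'I_m.+1 -> {fset int}) : R :=
  let ratio j := (N j)%:R / #|` B j|%:R in
  \big[Num.min/ratio ord0]_j ratio j.

End Measures.

(* Main.v *)
Require Import Defs.
From HB Require Import structures.
From mathcomp Require Import all_boot all_order all_algebra finmap.
From mathcomp Require Import spectral.
From mathcomp Require Import all_classical all_reals all_analysis.
From mathcomp Require Import measurable_realfun.
From mathcomp Require Import complex.
From mathcomp Require Import ring lra zify.

Set Implicit Arguments.
Unset Strict Implicit.
Unset Printing Implicit Defensive.

Import Order.TTheory GRing.Theory Num.Theory.
Import numFieldNormedType.Exports.

Local Open Scope classical_set_scope.
Local Open Scope ring_scope.

(** Write [mu_e] for the convolution of the first [e] factors of [mu], [M_e] for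
the product of the first [e] scales, and [phi xi] for the squared modulus of
the Fourier transform of [mu] at [xi].  The set [t Lam] is a spectrum of [mu]
as soon as its exponentials are orthogonal and
[\sum_(l in Lam) phi (t * (x + l)) = 1] for every real [x]: the latter is the
equality case of Bessel's inequality for every exponential, and the
exponentials span a dense subspace of L^2 ([spectrum_criterion]).

Finite level.  Call a finite set of integers [L] tight at level [e] if the
same identity holds with [mu_e] instead of [mu], for all admissible [t] at
once.  The Hadamard condition provides, at each level, residues [W] that turn
a tight set at level [e] into one at level [e + 1], namely
[L + M_e * W] ([tight_children]), and tightness depends on the residues modulo
[M_e] only ([tight_residues]).  So every element may be moved freely by
multiples of [M_e].

Passing to the limit.  The union of an increasing sequence of tight sets gives
orthogonal exponentials, but mass may be lost.  None is lost if, at infinitely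
many levels [e], the transform of the remaining factors is bounded below by a
constant at [t * y / M_e] for all elements [y] ([tower_parseval], a dominated
convergence argument).  Such [y] are called good.

Equi-positivity.  Each residue class modulo [M_e] has a good representative in
a fixed number of periods, and also one beyond any prescribed bound, with
constants that do not depend on [e] ([equipositive], [equipositive_far]).
Since the ratio [N_j / #B_j] is at least [rho > 1], each node of the tree of
residues has two children at which the next mask is at least a constant
[theta] ([two_children]).  Hence after [r] levels there are [2 ^ r] candidates
for which the first [r] masks are not small.  The product of the other masks
is a cosine mean with bounded frequencies and value 1 at 0: it cannot be tiny
at [r] separated points of the unit interval, because Rolle's theorem would
make its [r]-th derivative exceed a bound [c ^ r] with [c ^ r / r!] small
([cosmean_few_small_values]).  If one of the first scales is huge, the masks
from there on are close to 1 and the argument stops there, so only finitely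
many scales have to be separated and the constants stay uniform.

All [t] simultaneously.  A representative that is good for one [t] need not be
good for another.  But goodness is only needed at infinitely many levels, so
stage [j] of the construction serves a single [t_j], in an order that visits
every [t] infinitely often ([visit]).  At stage [j] the elements placed earlier
stay where they are: they are small compared with the new scale, hence
automatically good ([good_old]).

Dimension.  The stage that leads to level [e'] puts the residues that are
multiples of [M_i] near 0, in a window of length comparable to [M_e'], and
spreads all others so that each is more than twice the previous one.  The
first group behaves like a regular set between the scales [M_i] and [M_e'] and
the second contributes logarithmically to windows.  With [e'] chosen on a
subsequence that realises [kappa] and [i] the first level at which [i] digits
account for [M_e' ^ (kappa - s)] points, the first group has about [M_e' ^ s]
points ([step_exists]) and no window of length [h] holds more than about
[h ^ s] of them ([wcount_cluster]).  Therefore the Beurling dimension is [s]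
([beurling_dim_limit]).

Cardinality.  Each stage may be run with the threshold for the new elements
left alone or raised above the elements that it would otherwise have added.
This is one free binary choice per stage, and different sequences of choices
give different sets ([runs_exist]).  The upper bound is the number of sets of
integers. *)

(** * Means of exponentials *)

Section TrigMeans.
Variable R : realType.
Implicit Types (s : seq R) (x y : R) (z : R[i]).

Lemma complex_ReM z z' : complex.Re (z * z') =
  complex.Re z * complex.Re z' - complex.Im z * complex.Im z'.
Proof. by case: z z' => [a b] [c d]. Qed.

Lemma complex_ImM z z' : complex.Im (z * z') =
  complex.Re z * complex.Im z' + complex.Im z * complex.Re z'.
Proof. by case: z z' => [a b] [c d]. Qed.

Lemma complex_ReD z z' : complex.Re (z + z') = complex.Re z + complex.Re z'.
Proof. by case: z z' => [a b] [c d]. Qed.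

Lemma complex_ImD z z' : complex.Im (z + z') = complex.Im z + complex.Im z'.
Proof. by case: z z' => [a b] [c d]. Qed.

Lemma complex_Re_sum I (r : seq I) (F : I -> R[i]) :
  complex.Re (\sum_(i <- r) F i) = \sum_(i <- r) complex.Re (F i).
Proof. exact: (big_morph _ complex_ReD). Qed.

Lemma complex_Im_sum I (r : seq I) (F : I -> R[i]) :
  complex.Im (\sum_(i <- r) F i) = \sum_(i <- r) complex.Im (F i).
Proof. exact: (big_morph _ complex_ImD). Qed.

Lemma eq_complexP z z' : complex.Re z = complex.Re z' ->
  complex.Im z = complex.Im z' -> z = z'.
Proof. by case: z z' => [a b] [c d] /= -> ->. Qed.

Definition sqmod z : R := complex.Re z ^+ 2 + complex.Im z ^+ 2.

Lemma sqmod_ge0 z : 0 <= sqmod z.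
Proof. by rewrite addr_ge0 ?sqr_ge0. Qed.

Lemma sqmodM z z' : sqmod (z * z') = sqmod z * sqmod z'.
Proof. by rewrite /sqmod complex_ReM complex_ImM; ring. Qed.

Lemma sqmod1 : sqmod 1 = 1.
Proof. by rewrite /sqmod /= expr1n expr0n addr0. Qed.

Lemma expi0 : expi (0 : R) = 1.
Proof. by rewrite /expi cos0 sin0. Qed.

Lemma expiD x y : expi (x + y) = expi x * expi y.
Proof.
by apply: eq_complexP; rewrite ?complex_ReM ?complex_ImM /= ?cosD ?sinD // addrC.
Qed.

Lemma conj_expi x : conjc (expi x) = expi (- x).
Proof. by rewrite /expi /= cosN sinN. Qed.

Lemma expi_period x (n : int) : expi (x + 2 * pi * n%:~R) = expi x.
Proof.
have main : forall (k : nat) y, expi (y + 2 * pi * k%:R) = expi y.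
  elim=> [|k IH] y; first by rewrite mulr0 addr0.
  have e1 : expi (2 * pi : R) = 1 by rewrite mulr_natl /expi cos2pi sin2pi.
  by rewrite -[k.+1%:R]natr1 mulrDr mulr1 addrA expiD e1 mulr1 IH.
case: n => n; first exact: main.
rewrite NegzE -[LHS](main n.+1); congr expi.
by rewrite mulrNz mulrN addrNK.
Qed.

Definition expmean s x : R[i] :=
  ((size s)%:R^-1)%:C%C * \sum_(a <- s) expi (a * x).

Definition cosmean s x : R := (size s)%:R^-1 * \sum_(a <- s) cos (a * x).

Definition sumset s s' : seq R := [seq a + b | a <- s, b <- s'].

Definition diffset s : seq R := [seq a - b | a <- s, b <- s].

Lemma expmean_scale c s x : expmean [seq c * a | a <- s] x = expmean s (c * x).
Proof.
rewrite /expmean size_map big_map; congr (_ * _); apply: eq_bigr => a _.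
by congr expi; ring.
Qed.

Lemma expmeanM s s' x : expmean s x * expmean s' x = expmean (sumset s s') x.
Proof.
rewrite /expmean mulrACA -rmorphM -invfM -natrM size_allpairs; congr (_ * _).
rewrite big_allpairs_dep /= mulr_suml; apply: eq_bigr => a _.
by rewrite mulr_sumr; apply: eq_bigr => b _; rewrite mulrDl expiD.
Qed.

(** The squared modulus of an exponential mean is again a mean of cosines, over
the differences of frequencies.  Everything below is done with real means, to
which Rolle's theorem applies. *)
Lemma sqmod_expmean s x : sqmod (expmean s x) = cosmean (diffset s) x.
Proof.
rewrite /expmean sqmodM /cosmean size_allpairs natrM invfM.
rewrite {1}/sqmod /= expr0n addr0 expr2; congr (_ * _).
rewrite /sqmod complex_Re_sum complex_Im_sum !expr2 !mulr_suml -big_split /= big_allpairs_dep.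
apply: eq_bigr => a _; rewrite !mulr_sumr -big_split; apply: eq_bigr => b _ /=.
by rewrite mulrBl cosB.
Qed.

Lemma cosmean0 s : s != [::] -> cosmean s 0 = 1.
Proof.
move=> s0; rewrite /cosmean.
under eq_bigr do rewrite mulr0 cos0.
by rewrite big_const_seq count_predT iter_addr_0 mulVf // pnatr_eq0 size_eq0.
Qed.

Lemma ler_norm_mean s (F : R -> R) c : 0 <= c -> {in s, forall a, `|F a| <= c} ->
  `|(size s)%:R^-1 * \sum_(a <- s) F a| <= c.
Proof.
move=> c0 Fc; have [->|s0] := eqVneq s [::]; first by rewrite big_nil mulr0 normr0.
have sz : 0 < (size s)%:R :> R by rewrite ltr0n lt0n size_eq0.
rewrite normrM ger0_norm ?invr_ge0 ?ler0n // ler_pdivrMl //.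
apply: (le_trans (ler_norm_sum _ _ _)).
rewrite -[X in X%:R * c](count_predT s) -sum1_count natr_sum mulr_suml !big_seq.
by apply: ler_sum => a /Fc; rewrite mul1r.
Qed.

Lemma normr_cosmean_le1 s x : `|cosmean s x| <= 1.
Proof.
apply: (ler_norm_mean (F := fun a => cos (a * x))) => // a _.
by rewrite ler_norml cos_geN1 cos_le1.
Qed.

Lemma sqmod_expmean_le1 s x : sqmod (expmean s x) <= 1.
Proof.
by rewrite sqmod_expmean; apply: le_trans (normr_cosmean_le1 _ x); exact: ler_norm.
Qed.

Lemma cos_lipschitz x y : `|cos x - cos y| <= `|x - y|.
Proof.
wlog xy : x y / x < y.
  move=> H; have [/H //|/H|->] := ltgtP x y; last by rewrite !subrr.
  by rewrite distrC (distrC y).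
have [c _] : exists2 c, c \in `]x, y[%R & cos y - cos x = - sin c * (y - x).
  apply: MVT => //.
  by apply: continuous_subspaceT => c; exact: continuous_cos.
rewrite (distrC (cos x)) (distrC x) => ->; rewrite normrM normrN.
by rewrite ler_piMl // ler_norml sin_geN1 sin_le1.
Qed.

Lemma cosmean_lipschitz s A x y : 0 <= A -> {in s, forall a, `|a| <= A} ->
  `|cosmean s x - cosmean s y| <= A * `|x - y|.
Proof.
move=> A0 sA; rewrite /cosmean -mulrBr -sumrB.
apply: (ler_norm_mean (F := fun a => cos (a * x) - cos (a * y))) => [|a /sA aA].
  by rewrite mulr_ge0.
apply: (le_trans (cos_lipschitz _ _)); rewrite -mulrBr normrM.
by rewrite ler_wpM2r.
Qed.

Lemma diffset_bound s A : {in s, forall a, `|a| <= A} ->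
  {in diffset s, forall a, `|a| <= A + A}.
Proof.
move=> sA _ /allpairsP[[a b] /= [/sA aA /sA bA ->]].
by rewrite (le_trans (ler_normB _ _)) // lerD.
Qed.

Lemma sumset_bound s s' A A' : {in s, forall a, `|a| <= A} ->
  {in s', forall a, `|a| <= A'} -> {in sumset s s', forall a, `|a| <= A + A'}.
Proof.
move=> sA sA' _ /allpairsP[[a b] /= [/sA aA /sA' bA ->]].
by rewrite (le_trans (ler_normD _ _)) // lerD.
Qed.

Lemma diffset_neq0 s : s != [::] -> diffset s != [::].
Proof. by rewrite -!size_eq0 size_allpairs muln_eq0 orbb. Qed.

Lemma sumset_neq0 s s' : s != [::] -> s' != [::] -> sumset s s' != [::].
Proof. by rewrite -!size_eq0 size_allpairs muln_eq0 => /negbTE-> /negbTE->. Qed.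

End TrigMeans.

(** * Divided differences and small values of cosine means *)

Section DividedDifference.
Variable R : realType.
Implicit Types (z : seq R) (g : nat -> R -> R).

(** One zero of the derivative in each gap between consecutive zeros. *)
Lemma rolle_path g a z : (forall x : R, is_derive x 1 (g 0%N) (g 1%N x)) ->
  path <%R a z -> g 0%N a = 0 -> {in z, forall x, g 0%N x = 0} ->
  exists z', [/\ size z' = size z, path <%R a z',
    {in z', forall x, x < last a z} & {in z', forall x, g 1%N x = 0}].
Proof.
move=> dg; elim: z a => [|b z IH] a /=; first by exists [::].
move=> /andP[ab bz] ga gz.
have gb : g 0%N b = 0 by apply: gz; rewrite mem_head.
have [|z' [sz' bz' z'l gz']] := IH b bz gb.
  by move=> x xz; apply: gz; rewrite inE xz orbT.
have [c cab dc] : exists2 c, c \in `]a, b[%R & is_derive c 1 (g 0%N) 0.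
  apply: Rolle => //; last by rewrite ga gb.
  - apply: continuous_subspaceT => x; apply: differentiable_continuous.
    by apply/derivable1_diffP; apply: ex_derive.
have gc : g 1%N c = 0.
  by have := dg c; move: dc => [_ <-] [_ <-].
move: cab; rewrite in_itv /= => /andP[ac cb].
exists (c :: z'); split => /=; first by rewrite sz'.
- rewrite ac /=; case: z' bz' {sz' z'l gz'} => //= d z' /andP[bd ->].
  by rewrite (lt_trans cb bd).
- move=> x; rewrite inE => /predU1P[->|/z'l//].
  have : b <= last b z.
    case: (z) bz => [|d z''] //= /andP[bd /(order_path_min lt_trans)/allP dz].
    have := mem_last d z''; rewrite inE => /predU1P[->|/dz]; first exact: ltW.
    by move=> H; apply: ltW; apply: lt_trans bd H.
  exact: lt_le_trans.
- by move=> x; rewrite inE => /predU1P[->|/gz'].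
Qed.

Lemma rolle_iter n g z : size z = n.+1 -> sorted <%R z ->
  {in z, forall x, 0 <= x <= 1} ->
  (forall i (x : R), is_derive x 1 (g i) (g i.+1 x)) ->
  {in z, forall x, g 0%N x = 0} -> exists2 c, 0 <= c <= 1 & g n c = 0.
Proof.
elim: n g z => [|n IH] g [//|a z] /= [sz] az z01 dg gz.
  by exists a; [apply: z01|apply: gz]; rewrite mem_head.
have ga : g 0%N a = 0 by apply: gz; rewrite mem_head.
have gz0 : {in z, forall x, g 0%N x = 0}.
  by move=> x xz; apply: gz; rewrite inE xz orbT.
have [z' [sz' az' z'l gz']] := rolle_path (dg 0%N) az ga gz0.
apply: (IH (fun i => g i.+1) z') => //.
- by rewrite sz'.
- exact: path_sorted az'.
- move=> x xz'.
  have /andP[a0 _] : 0 <= a <= 1 by apply: z01; rewrite mem_head.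
  have /andP[_ l1] : 0 <= last a z <= 1 by apply: z01; rewrite mem_last.
  have /allP/(_ x xz') ax := order_path_min lt_trans az'.
  by rewrite (le_trans a0 (ltW ax)) (le_trans (ltW (z'l x xz')) l1).
Qed.

Definition node_poly z x : {poly R} := \prod_(y <- z | y != x) ('X - y%:P).

Definition lagrange_poly z (f : R -> R) : {poly R} :=
  \sum_(x <- z) (f x / (node_poly z x).[x]) *: node_poly z x.

Lemma node_poly_eq0 z x y : y \in z -> y != x -> (node_poly z x).[y] = 0.
Proof.
move=> yz yx; rewrite /node_poly horner_prod.
by apply/eqP; rewrite prodf_seq_eq0; apply/hasP; exists y; rewrite //= yx !hornerE subrr.
Qed.

Lemma node_poly_neq0 z x : (node_poly z x).[x] != 0.
Proof.
rewrite /node_poly horner_prod prodf_seq_neq0; apply/allP => y _.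
by apply/implyP => yx; rewrite hornerXsubC subr_eq0 eq_sym.
Qed.

Lemma node_poly_monic z x : node_poly z x \is monic.
Proof. by apply: monic_prod => y _; rewrite monicXsubC. Qed.

Lemma size_node_poly z x : uniq z -> x \in z -> size (node_poly z x) = size z.
Proof.
move=> uz xz; rewrite /node_poly -big_filter size_prod_XsubC size_filter.
have := count_predC (pred1 x) z; rewrite (count_uniq_mem _ uz) xz add1n => <-.
by congr _.+1; apply: eq_count.
Qed.

Lemma lagrange_polyE z f x : uniq z -> x \in z -> (lagrange_poly z f).[x] = f x.
Proof.
move=> uz xz; rewrite /lagrange_poly horner_sum (bigD1_seq x) //= big1_seq.
  by rewrite addr0 hornerZ divfK // node_poly_neq0.
by move=> y /andP[yx yz]; rewrite hornerZ (node_poly_eq0 xz) ?mulr0 // eq_sym.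
Qed.

Lemma lagrange_poly_derivn n z f c : uniq z -> size z = n.+1 ->
  ((lagrange_poly z f)^`(n)).[c] =
  n`!%:R * \sum_(x <- z) f x / (node_poly z x).[x].
Proof.
move=> uz sz; rewrite /lagrange_poly linear_sum horner_sum mulr_sumr big_seq [RHS]big_seq.
apply: eq_bigr => x xz; rewrite linearZ /= hornerZ mulrC; congr (_ * _).
have sp : size (node_poly z x) = n.+1 by rewrite size_node_poly.
have -> : (node_poly z x)^`(n) = (n`!%:R)%:P.
  apply/polyP => i; rewrite coef_derivn coefC; case: i => [|i] /=.
    rewrite addn0 ffactnn; have := monicP (node_poly_monic z x).
    by rewrite /lead_coef sp /= => ->.
  by rewrite nth_default ?mul0rn // sp addnS ltnS leq_addr.
by rewrite hornerC.
Qed.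

(** The mean value form of divided differences: subtract the interpolation
polynomial and apply Rolle's theorem n times. *)
Lemma divided_difference_mean n g z : size z = n.+1 -> sorted <%R z ->
  {in z, forall x, 0 <= x <= 1} ->
  (forall i (x : R), is_derive x 1 (g i) (g i.+1 x)) ->
  exists2 c, 0 <= c <= 1 &
    g n c = n`!%:R * \sum_(x <- z) g 0%N x / (node_poly z x).[x].
Proof.
move=> sz so z01 dg.
have uz : uniq z by apply: sorted_uniq so; [exact: lt_trans|exact: ltxx].
pose P := lagrange_poly z (g 0%N).
have dh i (x : R) : is_derive x 1 (fun x => g i x - (P^`(i)).[x])
    (g i.+1 x - (P^`(i.+1)).[x]).
  by rewrite derivnS; apply: is_deriveB.
have hz : {in z, forall x, g 0%N x - (P^`(0)).[x] = 0}.
  by move=> x xz; rewrite derivn0 lagrange_polyE // subrr.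
have [c c01 gc] := rolle_iter sz so z01 dh hz.
by exists c => //; rewrite -(lagrange_poly_derivn (g 0%N) c uz sz); apply/eqP; rewrite -subr_eq0 gc.
Qed.

(** The i-th derivative of [cosmean s]: each derivation multiplies by the frequency
and shifts the phase by a quarter period. *)
Definition cosmean_deriv (s : seq R) i x : R :=
  (size s)%:R^-1 * \sum_(a <- s) a ^+ i * cos (a * x + i%:R * (pi / 2)).

Lemma is_derive_cosmean_deriv s i (x : R) :
  is_derive x 1 (cosmean_deriv s i) (cosmean_deriv s i.+1 x).
Proof.
rewrite /cosmean_deriv.
have H (a : R) : is_derive x 1 (fun x => a ^+ i * cos (a * x + i%:R * (pi / 2)))
   (a ^+ i.+1 * cos (a * x + i.+1%:R * (pi / 2))).
  have D : is_derive x 1 (fun x => a * x + i%:R * (pi / 2)) a.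
    apply: is_derive_eq; rewrite addr0 /GRing.scale /=; ring.
  have -> : cos (a * x + i.+1%:R * (pi / 2)) = - sin (a * x + i%:R * (pi / 2)).
    by rewrite mulrSr mulrDl mul1r addrA cosD cos_pihalf sin_pihalf mulr0 mulr1 sub0r.
  have := is_derive1_comp (f := cos) (g := fun x => a * x + i%:R * (pi / 2)) (x := x).
  move=> /(_ _ _ (is_derive_cos _) D) D2.
  apply: is_derive_eq; rewrite /GRing.scale /= exprSr. ring.
have D2 : is_derive x 1 (fun x0 : R => \sum_(a <- s) a ^+ i * cos (a * x0 + i%:R * (pi / 2)))
  (\sum_(a <- s) a ^+ i.+1 * cos (a * x + i.+1%:R * (pi / 2))).
  elim: s => [|a s IH].
    under eq_fun do rewrite big_nil.
    by rewrite big_nil; exact: is_derive_cst.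
  under eq_fun do rewrite big_cons.
  by rewrite big_cons; apply: is_deriveD.
by apply: is_derive_eq.
Qed.

Lemma cosmean_deriv_bound s A i x : 0 <= A -> {in s, forall a, `|a| <= A} ->
  `|cosmean_deriv s i x| <= A ^+ i.
Proof.
move=> A0 sA.
apply: (ler_norm_mean (F := fun a => a ^+ i * cos (a * x + _))) => [|a /sA aA].
  by rewrite exprn_ge0.
rewrite normrM normrX -[leRHS]mulr1 ler_pM // ?exprn_ge0 //.
  by rewrite lerXn2r // nnegrE.
by rewrite ler_norml cos_geN1 cos_le1.
Qed.

(** The divided difference of [cosmean s] at 0 and the points of [z] is at most
[A ^+ n / n`!] by the mean value form.  Expanded over the nodes, its term at 0 is
at least 1, because the mean is 1 there and the nodes lie in the unit interval,
and each other term is at most [e / d ^+ n].  For large [n] and small [e] the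
conclusion is absurd: few values can be small. *)
Lemma cosmean_few_small_values s A n z (e d : R) : s != [::] -> 0 <= A ->
  {in s, forall a, `|a| <= A} -> 0 < d -> d <= 1 -> 0 <= e ->
  size z = n -> path <%R 0 z -> {in z, forall x, x <= 1} ->
  {in 0 :: z &, forall x y, x != y -> d <= `|x - y|} ->
  {in z, forall x, `|cosmean s x| <= e} ->
  1 <= A ^+ n / n`!%:R + n%:R * (e / d ^+ n).
Proof.
move=> s0 A0 sA d0 d1 e0 sz pz z1 dz ez.
have zpos x : x \in z -> 0 < x.
  by move=> xz; have /allP/(_ x xz) := order_path_min lt_trans pz.
have uz : uniq (0 :: z).
  by apply: (sorted_uniq lt_trans ltxx); exact: pz.
have z01 : {in 0 :: z, forall x : R, 0 <= x <= 1}.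
  move=> x; rewrite inE => /predU1P[->|xz]; first by rewrite lexx ler01.
  by rewrite ltW ?zpos // z1.
have sz' : size (0 :: z) = n.+1 by rewrite /= sz.
have [c _] := divided_difference_mean sz' pz z01 (is_derive_cosmean_deriv s).
have E x : cosmean_deriv s 0 x = cosmean s x.
  rewrite /cosmean_deriv /cosmean; congr (_ * _); apply: eq_bigr => a _.
  by rewrite expr0 mul1r mul0r addr0.
have F : n`!%:R != 0 :> R by rewrite pnatr_eq0 -lt0n fact_gt0.
move=> /(congr1 ( *%R n`!%:R^-1)); rewrite mulKf // big_cons E cosmean0 // mul1r => H.
have node0 : `|(node_poly (0 :: z) 0).[0]| <= 1.
  rewrite /node_poly horner_prod normr_prod big_seq_cond.
  apply: prodr_ile1 => y /andP[yz _]; rewrite hornerXsubC normr_ge0 /= sub0r normrN.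
  by have /andP[y0 y1] := z01 y yz; rewrite ger0_norm.
have nodex x : x \in z -> d ^+ n <= `|(node_poly (0 :: z) x).[x]|.
  move=> xz; rewrite /node_poly horner_prod normr_prod -big_filter.
  have -> : d ^+ n = \prod_(y <- [seq y <- 0 :: z | y != x]) d.
    rewrite big_const_seq count_predT iter_mulr_1 -(rem_filter x uz).
    by rewrite size_rem ?sz' // inE xz orbT.
  rewrite big_seq [leRHS]big_seq; apply: ler_prod => y.
  rewrite mem_filter => /andP[yx yz]; rewrite hornerXsubC (ltW d0) /=.
  by apply: dz => //; rewrite ?inE ?xz ?orbT // eq_sym.
have node0_gt0 : 0 < `|(node_poly (0 :: z) 0).[0]|.
  by rewrite normr_gt0 node_poly_neq0.
have : 1 <= `|(node_poly (0 :: z) 0).[0]^-1|.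
  by rewrite normfV invf_ge1.
move/le_trans; apply.
rewrite -[X in `|X|](addrK (\sum_(j <- z) cosmean_deriv s 0 j / (node_poly (0 :: z) j).[j])).
rewrite -H; apply: (le_trans (ler_normB _ _)); apply: lerD.
  rewrite normrM normfV normr_nat mulrC ler_wpM2r ?invr_ge0 ?ler0n //.
  exact: cosmean_deriv_bound.
apply: (le_trans (ler_norm_sum _ _ _)).
have -> : n%:R * (e / d ^+ n) = \sum_(j <- z) e / d ^+ n.
  by rewrite big_const_seq count_predT sz iter_addr_0 mulr_natl.
rewrite big_seq [leRHS]big_seq; apply: ler_sum => x xz.
rewrite E normrM normfV ler_pM ?invr_ge0 ?ez //.
by rewrite lef_pV2 ?nodex // posrE ?exprn_gt0 // normr_gt0 node_poly_neq0.
Qed.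

End DividedDifference.

(** * Products of masks *)

Section MoranSystem.
Variable R : realType.

Definition digit_mask (dg : nat -> seq int) i (x : R) : R[i] :=
  expmean [seq 2 * pi * d%:~R | d <- dg i] x.

(** The data of an infinite convolution, reduced to what the construction uses:
[dg i] are the digits and [q i] the scale of the i-th factor, [W i] a set of
dual residues, and [T] the multipliers for which [ms_tight] holds.  That
identity says that the exponentials with frequencies [t * W i / q i] form an
orthonormal basis for the uniform measure on [dg i].  The bounds [beta] and
[b0] are uniform in [i], which is how the finiteness of the family of Hadamard
triples enters; the scales [q i] may be unbounded. *)
Record moran_system (q : nat -> nat) (dg W : nat -> seq int) (T : set int)
    (rho beta : R) (b0 : nat) : Prop := MoranSystem {
  ms_q2 : forall i, (2 <= q i)%N;
  ms_rho : 1 < rho;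
  ms_qdg : forall i, rho * (size (dg i))%:R <= (q i)%:R;
  ms_dg0 : forall i, dg i != [::];
  ms_dgb : forall i, (size (dg i) <= b0)%N;
  ms_dgB : forall i, {in dg i, forall d, `|d%:~R| <= beta};
  ms_W0 : forall i, 0 \in W i;
  ms_sizeW : forall i, size (W i) = size (dg i);
  ms_tight : forall i t x, T t ->
    \sum_(w <- W i) sqmod (digit_mask dg i (t%:~R * (x + w%:~R) / (q i)%:R)) = 1 }.

Context (q : nat -> nat) (dg W : nat -> seq int) (T : set int) (rho beta : R)
  (b0 : nat) (HS : moran_system q dg W T rho beta b0).

Local Notation mask := (digit_mask dg).
Let q2 := ms_q2 HS.

Lemma q_gt0 i : 0 < (q i)%:R :> R.
Proof. by rewrite ltr0n (leq_trans _ (q2 i)). Qed.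

Lemma q_neq0 i : (q i)%:R != 0 :> R.
Proof. by rewrite gt_eqF ?q_gt0. Qed.

(** The transform of the convolution of the factors [k], ..., [k + j - 1], rescaled
so that factor [k] has scale [q k]. *)
Fixpoint tail k j (x : R) : R[i] :=
  if j is j'.+1 then mask k (x / (q k)%:R) * tail k.+1 j' (x / (q k)%:R) else 1.

(** The density of spectral mass: its sum over a dual set is to be 1. *)
Definition tpow k j x : R := sqmod (tail k j x).

Fixpoint scale k j : nat := if j is j'.+1 then (q k * scale k.+1 j')%N else 1%N.

Lemma scaleD k i j : scale k (i + j) = (scale k i * scale (k + i) j)%N.
Proof.
elim: i k => [|i IH] k /=; first by rewrite mul1n addn0.
by rewrite IH mulnA addSnnS.
Qed.

Lemma scale_ge k j : (2 ^ j <= scale k j)%N.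
Proof. by elim: j k => [|j IH] k //=; rewrite expnS leq_mul. Qed.

Lemma scale_gt0 k j : (0 < scale k j)%N.
Proof. by apply: leq_trans (scale_ge k j); rewrite expn_gt0. Qed.

Lemma scaleR_gt0 k j : 0 < (scale k j)%:R :> R.
Proof. by rewrite ltr0n scale_gt0. Qed.

Lemma mask_period i (x : R) (z : int) : mask i (x + z%:~R) = mask i x.
Proof.
rewrite /digit_mask /expmean size_map !big_map; congr (_ * _).
apply: eq_bigr => d _.
by rewrite mulrDr -[2 * pi * _ * z%:~R]mulrA -intrM expi_period.
Qed.

Lemma tailD k i j x :
  tail k (i + j) x = tail k i x * tail (k + i) j (x / (scale k i)%:R).
Proof.
elim: i k x => [|i IH] k x /=; first by rewrite mul1r addn0 divr1.
by rewrite IH mulrA addSnnS natrM invfM mulrA.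
Qed.

Lemma tpowD k i j x :
  tpow k (i + j) x = tpow k i x * tpow (k + i) j (x / (scale k i)%:R).
Proof. by rewrite /tpow tailD sqmodM. Qed.

Lemma tail_period k j x (z : int) :
  tail k j (x + (scale k j)%:R * z%:~R) = tail k j x.
Proof.
elim: j k x => [|j IH] k x //=.
have -> : (x + (q k * scale k.+1 j)%:R * z%:~R) / (q k)%:R =
    x / (q k)%:R + (scale k.+1 j)%:R * z%:~R.
  by rewrite mulrDl natrM; congr (_ + _); field; exact: q_neq0.
rewrite IH; congr (_ * _).
by rewrite -[(scale k.+1 j)%:R]/((scale k.+1 j)%:~R) -intrM mask_period.
Qed.

Lemma tpow_period k j x (z : int) :
  tpow k j (x + (scale k j)%:R * z%:~R) = tpow k j x.
Proof. by rewrite /tpow tail_period. Qed.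

Lemma tpow_ge0 k j x : 0 <= tpow k j x.
Proof. exact: sqmod_ge0. Qed.

(** The transform [tail k j] expanded into one exponential mean: the frequencies
are, up to the factor 2 pi, the points of the rescaled finite convolution. *)
Fixpoint freqs k j : seq R :=
  if j is j'.+1 then
    [seq (q k)%:R^-1 * a | a <- sumset [seq 2 * pi * d%:~R | d <- dg k] (freqs k.+1 j')]
  else [:: 0].

Lemma tailE k j x : tail k j x = expmean (freqs k j) x.
Proof.
elim: j k x => [|j IH] k x /=.
  by rewrite /expmean big_seq1 mul0r expi0 invr1 mulr1.
by rewrite expmean_scale -expmeanM -IH /digit_mask ![_^-1 * x]mulrC.
Qed.

Let c : R := 2 * pi * beta.

Lemma beta_ge0 : 0 <= beta.
Proof.
have := ms_dg0 HS 0; have := ms_dgB HS (i := 0%N).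
by case: (dg 0%N) => // d s /(_ d (mem_head _ _)) H _; exact: le_trans H.
Qed.

Let c0 : 0 <= c.
Proof. by rewrite !mulr_ge0 ?pi_ge0 ?beta_ge0. Qed.

(** A geometric series with ratio at most 1/2, as the scales are at least 2. *)
Lemma freqs_le k j : {in freqs k j, forall a, `|a| <= (c + c) / (q k)%:R}.
Proof.
elim: j k => [|j IH] k a /=.
  by rewrite inE => /eqP ->; rewrite normr0 divr_ge0 ?addr_ge0 // ltW ?q_gt0.
case/mapP => a' a's ->; rewrite normrM normfV normr_nat mulrC.
rewrite ler_pM2r ?invr_gt0 ?q_gt0 //; move: a' a's; apply: sumset_bound.
  move=> _ /mapP[d dk ->]; rewrite normrM ger0_norm ?mulr_ge0 ?pi_ge0 //.
  by rewrite ler_wpM2l ?mulr_ge0 ?pi_ge0 // (ms_dgB HS dk).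
move=> a' /IH H; apply: (le_trans H); rewrite ler_pdivrMr ?q_gt0 //.
by rewrite -mulr2n -[c *+ 2]mulr_natr ler_wpM2l // ler_nat.
Qed.

Lemma freqs_neq0 k j : freqs k j != [::].
Proof.
elim: j k => [|j IH] k //=; rewrite -size_eq0 size_map size_eq0 sumset_neq0 //.
by rewrite -size_eq0 size_map size_eq0 (ms_dg0 HS).
Qed.

Lemma tpow_cosmean k j x : tpow k j x = cosmean (diffset (freqs k j)) x.
Proof. by rewrite /tpow tailE sqmod_expmean. Qed.

Lemma diff_freqs_le k j : {in diffset (freqs k j), forall a, `|a| <= 4 * c / (q k)%:R}.
Proof.
have -> : 4 * c / (q k)%:R = (c + c) / (q k)%:R + (c + c) / (q k)%:R by field; exact: q_neq0.
by apply: diffset_bound; exact: freqs_le.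
Qed.

Lemma diff_freqs_le2 k j : {in diffset (freqs k j), forall a, `|a| <= 2 * c}.
Proof.
move=> a /diff_freqs_le H; apply: (le_trans H); rewrite ler_pdivrMr ?q_gt0 //.
have -> : 4 * c = 2 * c * 2%:R by ring.
by rewrite (ler_wpM2l (mulr_ge0 (ler0n _ 2) c0)) // ler_nat.
Qed.

Lemma tpow0 k j : tpow k j 0 = 1.
Proof. by rewrite tpow_cosmean cosmean0 // diffset_neq0 ?freqs_neq0. Qed.

Lemma tpow_le1 k j x : tpow k j x <= 1.
Proof. by rewrite /tpow tailE sqmod_expmean_le1. Qed.

Lemma tpow_anti k i j x : tpow k (i + j) x <= tpow k i x.
Proof. by rewrite tpowD ler_piMr ?tpow_ge0 ?tpow_le1. Qed.

Lemma tpow_anti_le k i j x : (i <= j)%N -> tpow k j x <= tpow k i x.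
Proof. by move=> ij; rewrite -(subnKC ij) tpow_anti. Qed.

(** The constant does not depend on [k] and [j], as the frequencies are bounded
uniformly. *)
Lemma tpow_lipschitz k j x y : `|tpow k j x - tpow k j y| <= 4 * pi * beta * `|x - y|.
Proof.
rewrite !tpow_cosmean (_ : 4 * pi * beta = 2 * c); last by rewrite /c; ring.
by apply: cosmean_lipschitz; [exact: mulr_ge0 (ler0n _ 2) c0|exact: diff_freqs_le2].
Qed.

(** The bound improves with [q k]: a large first scale makes all the frequencies
small. *)
Lemma tpow_near0 k j x : 1 - 8 * pi * beta / (q k)%:R * `|x| <= tpow k j x.
Proof.
rewrite lerBlDl -lerBlDr -[X in X - _](tpow0 k j).
apply: (le_trans (ler_norm _)); rewrite !tpow_cosmean.
rewrite -[in `|x|](subr0 x) (distrC x).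
rewrite (_ : 8 * pi * beta = 4 * c); last by rewrite /c; ring.
apply: cosmean_lipschitz; last exact: diff_freqs_le.
by rewrite divr_ge0 ?(mulr_ge0 (ler0n _ 4) c0) // ltW ?q_gt0.
Qed.


Lemma periodic_sum_shift (h : int -> R) n (w : int) :
  (forall z : int, h (z + n%:Z) = h z) ->
  \sum_(0 <= l < n) h (l%:Z + w) = \sum_(0 <= l < n) h l%:Z.
Proof.
move=> hn.
have step (v : int) : \sum_(0 <= l < n) h (l%:Z + (v + 1)) = \sum_(0 <= l < n) h (l%:Z + v).
  pose F l := h (l%:Z + v).
  have Fn : F n = F 0%N by rewrite /F add0r addrC hn.
  have : F 0%N + \sum_(0 <= l < n) F l.+1 = \sum_(0 <= l < n) F l + F n.
    by rewrite -big_nat_recl // -big_nat_recr.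
  rewrite Fn addrC => /addIr <-; apply: eq_bigr => l _.
  by rewrite /F intS (addrC v) addrA (addrC l%:Z 1).
elim/int_ind: w => [|k IH|k IH]; first by apply: eq_bigr => l _; rewrite addr0.
  by rewrite intS addrC step.
rewrite -IH -[LHS]step; apply: eq_bigr => l _; congr h; lia.
Qed.

(** Average [ms_tight] over all translates of [W i] modulo [q i]: each residue is
hit [size (dg i)] times. *)
Lemma residue_mass i t x : T t ->
  \sum_(0 <= l < q i) sqmod (mask i (t%:~R * (x + l%:R) / (q i)%:R)) =
  (q i)%:R / (size (dg i))%:R.
Proof.
move=> Tt; pose h (z : int) := sqmod (mask i (t%:~R * (x + z%:~R) / (q i)%:R)).
have hq (z : int) : h (z + (q i)%:Z) = h z.
  rewrite /h -(mask_period i (t%:~R * (x + z%:~R) / (q i)%:R) t).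
  by congr (sqmod (mask i _)); rewrite intrD; field; exact: q_neq0.
have E : \sum_(w <- W i) \sum_(0 <= l < q i) h (l%:Z + w) = (q i)%:R.
  rewrite exchange_big /= -[RHS]mul1r -(subn0 (q i)) mulr_natr -sumr_const_nat subn0.
  apply: eq_bigr => l _; rewrite -(ms_tight HS i (x + l%:R) Tt).
  by apply: eq_bigr => w _; rewrite /h intrD addrA.
move: E; under eq_bigr do rewrite periodic_sum_shift //.
rewrite big_const_seq count_predT iter_addr_0 (ms_sizeW HS) => E.
have sz0 : (size (dg i))%:R != 0 :> R by rewrite pnatr_eq0 size_eq0 (ms_dg0 HS).
by apply: (mulIf sz0); rewrite divfK // mulr_natr; exact: E.
Qed.

(** Residues of weight less than [theta] carry together at most half of the amount
by which the total mass exceeds 1; see [two_children]. *)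
Definition theta : R := (1 - rho^-1) / (2 * b0%:R).

Let rho_gt0 : 0 < rho. Proof. by apply: lt_trans (ms_rho HS). Qed.

Lemma b0_gt0 : (0 < b0)%N.
Proof. by apply: leq_trans (ms_dgb HS 0); rewrite lt0n size_eq0 (ms_dg0 HS). Qed.

Lemma theta_gt0 : 0 < theta.
Proof.
rewrite divr_gt0 ?mulr_gt0 ?ltr0n ?b0_gt0 // subr_gt0 invf_lt1 //.
exact: ms_rho HS.
Qed.

Lemma theta_le1 : theta <= 1.
Proof.
rewrite ler_pdivrMr ?mulr_gt0 ?ltr0n ?b0_gt0 // mul1r.
rewrite (@le_trans _ _ 1) ?lerBlDr ?lerDl ?invr_ge0 ?(ltW rho_gt0) //.
by rewrite -natrM ler1n muln_gt0 b0_gt0.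
Qed.

(** The total mass over the residues is at least [rho > 1] by [residue_mass], and a
single residue has mass at most 1. *)
Lemma two_children i t x : T t -> exists l1 l2, [/\ (l1 < l2 < q i)%N,
  theta <= sqmod (mask i (t%:~R * (x + l1%:R) / (q i)%:R)) &
  theta <= sqmod (mask i (t%:~R * (x + l2%:R) / (q i)%:R))].
Proof.
move=> Tt; pose F l := sqmod (mask i (t%:~R * (x + l%:R) / (q i)%:R)).
pose good := [seq l <- iota 0 (q i) | theta <= F l].
have szq : 0 < (size (dg i))%:R :> R by rewrite ltr0n lt0n size_eq0 (ms_dg0 HS).
(* the number of good residues is at least [(rho + 1) / 2] *)
have : 1 < (size good)%:R :> R.
  have S1 : (q i)%:R / (size (dg i))%:R <= (size good)%:R + (q i)%:R * theta.
    rewrite -(residue_mass _ x Tt) -[X in _ <= X%:R + _]sum1_size big_filter natr_sum.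
    rewrite [X in _ <= X + _]big_mkcond /= /index_iota subn0.
    have -> : (q i)%:R * theta = \sum_(l <- iota 0 (q i)) theta.
      by rewrite big_const_seq count_predT size_iota iter_addr_0 mulr_natl.
    rewrite -big_split /=; apply: ler_sum => l _; case: ifPn => [_|].
      rewrite -[leLHS]addr0 lerD ?(ltW theta_gt0) //; apply: sqmod_expmean_le1.
    by rewrite -ltNge add0r => /ltW.
  have S2 : (q i)%:R * theta <= (1 - rho^-1) / 2 * ((q i)%:R / (size (dg i))%:R).
    have -> : (1 - rho^-1) / 2 * ((q i)%:R / (size (dg i))%:R) =
        (q i)%:R * ((1 - rho^-1) / (2 * (size (dg i))%:R)).
      by field; rewrite ?gt_eqF.
    rewrite ler_wpM2l ?ler0n // ler_wpM2l //.
      by rewrite subr_ge0 invf_le1 // ltW // (ms_rho HS).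
    by rewrite lef_pV2 ?posrE ?mulr_gt0 ?ltr0n ?b0_gt0 // -?(ltr0n R) // ler_pM2l // ler_nat (ms_dgb HS).
  have S3 : rho <= (q i)%:R / (size (dg i))%:R by rewrite ler_pdivlMr // (ms_qdg HS).
  have S4 : (1 + rho^-1) / 2 * rho <= (1 + rho^-1) / 2 * ((q i)%:R / (size (dg i))%:R).
    by rewrite ler_wpM2l // divr_ge0 // addr_ge0 // invr_ge0 ltW.
  have E4 : (1 + rho^-1) / 2 * rho = (rho + 1) / 2 by field; rewrite gt_eqF.
  have := ms_rho HS; lra.
rewrite ltr1n.
have : sorted ltn good by apply: sorted_filter; [exact: ltn_trans|exact: iota_ltn_sorted].
have : {in good, forall l, (l < q i)%N /\ theta <= F l}.
  by move=> l; rewrite mem_filter mem_iota add0n => /andP[-> /andP[_ ->]].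
case: good => [|l1 [|l2 s]] //= H /andP[l12 _] _; exists l1, l2.
have [_ H1] := H l1 (mem_head _ _).
have [|l2q H2] := H l2; first by rewrite !inE eqxx orbT.
by rewrite l12 l2q.
Qed.

End MoranSystem.

(** * Equi-positivity *)

Section EquiPositivity.
Variable R : realType.
Context (q : nat -> nat) (dg W : nat -> seq int) (T : set int) (rho beta : R)
  (b0 : nat) (HS : moran_system q dg W T rho beta b0).

Local Notation mask := (digit_mask dg).
Local Notation tpow := (tpow q dg).
Local Notation scale := (scale q).
Local Notation theta := (theta rho b0).

Lemma tpowS k j t (x : R) (l l' : nat) :
  tpow k j.+1 (t%:~R * (x + (l + q k * l')%:R)) =
  sqmod (mask k (t%:~R * (x + l%:R) / (q k)%:R)) *
  tpow k.+1 j (t%:~R * ((x + l%:R) / (q k)%:R + l'%:R)).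
Proof.
have E : t%:~R * (x + (l + q k * l')%:R) / (q k)%:R =
    t%:~R * ((x + l%:R) / (q k)%:R + l'%:R).
  by rewrite natrD natrM; field; exact: q_neq0 HS k.
rewrite /tpow /= sqmodM E; congr (sqmod _ * _).
rewrite -(mask_period dg k (t%:~R * (x + l%:R) / (q k)%:R) (t * l'%:Z)).
by congr (digit_mask _ _ _); rewrite intrM; field; exact: q_neq0 HS k.
Qed.

(** Binary branching: two children at each of [r] levels. *)
Lemma good_leaves r k t x : T t -> exists ls : seq nat,
  [/\ size ls = (2 ^ r)%N, uniq ls &
    {in ls, forall l, (l < scale k r)%N /\
      theta ^+ r <= tpow k r (t%:~R * (x + l%:R))}].
Proof.
move=> Tt; elim: r k x => [|r IH] k x.
  exists [:: 0%N]; split => // l; rewrite inE => /eqP ->; split => //.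
  by rewrite expr0 /tpow /= sqmod1.
have [l1 [l2 [/andP[l12 l2q] g1 g2]]] := two_children HS k x Tt.
have [s1 [sz1 u1 h1]] := IH k.+1 ((x + l1%:R) / (q k)%:R).
have [s2 [sz2 u2 h2]] := IH k.+1 ((x + l2%:R) / (q k)%:R).
have l1q := ltn_trans l12 l2q.
have q0 : (0 < q k)%N by apply: leq_ltn_trans l2q.
have inj l : injective (fun l' => l + q k * l')%N.
  by move=> a b /addnI /eqP; rewrite eqn_pmul2l // => /eqP.
have good l s : (l < q k)%N ->
    theta <= sqmod (mask k (t%:~R * (x + l%:R) / (q k)%:R)) ->
    {in s, forall l', (l' < scale k.+1 r)%N /\
       theta ^+ r <= tpow k.+1 r (t%:~R * ((x + l%:R) / (q k)%:R + l'%:R))} ->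
    {in [seq l + q k * l' | l' <- s]%N, forall l, (l < scale k r.+1)%N /\
       theta ^+ r.+1 <= tpow k r.+1 (t%:~R * (x + l%:R))}.
  move=> lq gl hs _ /mapP[l' /hs [l's gl'] ->]; split.
    rewrite /= (@leq_trans (q k * l'.+1)) ?leq_pmul2l //.
    by rewrite mulnS ltn_add2r.
  rewrite tpowS exprS ler_pM ?exprn_ge0 ?(ltW (theta_gt0 HS)) //.
exists ([seq l1 + q k * l' | l' <- s1]%N ++ [seq l2 + q k * l' | l' <- s2]%N).
split.
- by rewrite size_cat !size_map sz1 sz2 expnS mul2n addnn.
- rewrite cat_uniq !(map_inj_uniq (inj _)) u1 u2 /= andbT.
  apply/hasPn => _ /mapP[l' _ ->]; apply/mapP => -[l'' _] /(congr1 (modn^~ (q k))).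
  rewrite ![(_ + q k * _)%N]addnC ![(q k * _)%N]mulnC !modnMDl !modn_small // => e.
  by move: l12; rewrite e ltnn.
- move=> l; rewrite mem_cat => /orP[]; first exact: (good l1 s1 l1q g1 h1).
  exact: (good l2 s2 l2q g2 h2).
Qed.

Lemma scale_le k r Q : (forall i, (i < r)%N -> (q (k + i) <= Q)%N) ->
  (scale k r <= Q ^ r)%N.
Proof.
elim: r k => [|r IH] k //= H; rewrite expnS leq_mul //.
  by have := H 0%N; rewrite addn0; apply.
by apply: IH => i ir; rewrite addSnnS H.
Qed.

Lemma exists_fact_gt (A : R) : exists n, A ^+ n / n`!%:R <= 4^-1.
Proof.
have /cvgr_lt H := cvg_exp_coeff A.
have [|n _ Hn] := H 4^-1; first by rewrite invr_gt0.
by exists n; exact: ltW (Hn n (leqnn n)).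
Qed.

(** [2 ^ r] points with a common denominator [M <= Q] are [1 / Q]-separated in the
unit interval, and [r] of them are nonzero, so [cosmean_few_small_values]
applies.  The exponent [r] depends on [t] only, through the bound on the
frequencies; the lower bound [e] depends on [Q]. *)
Lemma tail_not_uniformly_small t : exists r, forall Q : nat, (0 < Q)%N ->
  exists2 e : R, 0 < e & forall k j x (ls : seq nat) M, 0 <= x < 1 ->
   uniq ls -> (2 ^ r <= size ls)%N -> (M <= Q)%N -> {in ls, forall l, (l < M)%N} ->
   exists2 l, l \in ls & e <= tpow k j (t%:~R * ((x + l%:R) / M%:R)).
Proof.
pose c : R := 4 * pi * beta * `|t%:~R|.
have c0 : 0 <= 4 * pi * beta :> R by rewrite !mulr_ge0 ?pi_ge0 ?(beta_ge0 HS).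
have [r Hr] := exists_fact_gt c.
exists r => Q Q0; pose d : R := Q%:R^-1.
have Q0R : 0 < Q%:R :> R by rewrite ltr0n.
have d0 : 0 < d by rewrite invr_gt0.
have d1 : d <= 1 by rewrite invf_le1 // ler1n.
(* small enough for the [r] error terms of size [e / d ^+ r] to add up to at most 1/4,
   as does the term with the factorial, by the choice of [r] *)
exists (d ^+ r / (4 * (r.+1)%:R)).
  by rewrite divr_gt0 ?exprn_gt0 ?mulr_gt0.
move=> k j x ls M /andP[x0 x1] uls szls MQ lsM; apply: contrapT => Hno.
have M0 : (0 < M)%N.
  case: ls lsM szls {uls Hno} => [|l ls /(_ l (mem_head _ _)) lM _]; last exact: leq_ltn_trans lM.
  by rewrite leqNgt expn_gt0.
have M0R : 0 < M%:R :> R by rewrite ltr0n.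
set e := d ^+ r / _ in Hno.
pose pt (l : nat) : R := (x + l%:R) / M%:R.
(* the point of [0] may be too close to the node 0, so it is dropped *)
pose ls1 := take r [seq l <- ls | l != 0%N].
have szls1 : size ls1 = r.
  rewrite size_takel // size_filter.
  have E : ((0%N \in ls) + count (fun l => l != 0%N) ls)%N = size ls.
    by rewrite -(count_uniq_mem _ uls); exact: count_predC.
  have lt1 : (r < 2 ^ r)%N by rewrite ltn_expl.
  have lt2 := leq_trans lt1 szls; rewrite -ltnS (leq_trans lt2) // -E -add1n.
  by rewrite leq_add2r leq_b1.
have uls1 : uniq ls1 by rewrite take_uniq // filter_uniq.
have ls1P l : l \in ls1 -> (l \in ls) && (l != 0%N).
  by move=> /mem_take; rewrite mem_filter andbC.
have ptB (l l' : nat) : pt l - pt l' = (l%:R - l'%:R) / M%:R.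
  by rewrite /pt -mulrBl; congr (_ / _); rewrite opprD addrACA subrr add0r.
have pt_inj : injective pt.
  move=> l l' /eqP; rewrite -subr_eq0 ptB mulf_eq0 invr_eq0 (gt_eqF M0R) orbF.
  by rewrite subr_eq0 eqr_nat => /eqP.
have dM : d <= M%:R^-1 by rewrite lef_pV2 ?posrE // ler_nat.
have dist_nat (l l' : nat) : l != l' -> 1 <= `|l%:R - l'%:R| :> R.
  move=> ll'; wlog lt : l l' ll' / (l < l')%N.
    by move: ll'; rewrite neq_ltn => /orP[] lt H; [|rewrite distrC]; apply: H; rewrite ?neq_ltn ?lt ?orbT.
  rewrite distrC ger0_norm ?subr_ge0 ?ler_nat 1?ltnW // -natrB 1?ltnW // ler1n subn_gt0 //.
pose z := sort <=%R (map pt ls1).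
have zP y : y \in z -> exists2 l, l \in ls1 & y = pt l.
  by rewrite mem_sort => /mapP[l ll ->]; exists l.
have pt_pos l : l \in ls1 -> d <= pt l.
  move=> /ls1P/andP[_ l0]; apply: (le_trans dM).
  rewrite ler_pdivlMr // mulVf ?gt_eqF //.
  by rewrite (@le_trans _ _ l%:R) ?lerDr // ler1n lt0n.
have sqr_freqs := diff_freqs_le2 HS (k := k) (j := j).
have freqs_t : {in [seq t%:~R * a | a <- diffset (freqs R q dg k j)], forall a : R, `|a| <= c}.
  move=> _ /mapP[a /sqr_freqs Ha ->]; rewrite normrM mulrC ler_wpM2r //.
  by apply: (le_trans Ha); rewrite le_eqVlt; apply/orP; left; apply/eqP; ring.
have tpowE y : tpow k j (t%:~R * y) =
    cosmean [seq t%:~R * a | a <- diffset (freqs R q dg k j)] y.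
  rewrite tpow_cosmean /cosmean size_map big_map; congr (_ * _).
  by apply: eq_bigr => a _; congr cos; ring.
have := @cosmean_few_small_values R
  [seq t%:~R * a | a <- diffset (freqs R q dg k j)] c r z e d.
have small : r%:R * (e / d ^+ r) <= 4^-1.
  rewrite /e mulrAC divff ?expf_neq0 ?gt_eqF // mul1r invfM.
  rewrite mulrCA ger_pMr ?invr_gt0 // ler_pdivrMr ?ltr0n // mul1r ler_nat //.
move=> /(_ _ _ freqs_t d0 d1); have : (1 : R) <= 4^-1 + 4^-1 -> False by lra.
move=> contra H; apply: contra.
apply: (le_trans _ (lerD Hr small)); apply: H.
- by rewrite -size_eq0 size_map size_eq0 diffset_neq0 ?(freqs_neq0 HS).
- by rewrite mulr_ge0.
- by rewrite divr_ge0 ?exprn_ge0 ?(ltW d0) // mulr_ge0.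
- by rewrite size_sort size_map.
- have sz : sorted <%R z by rewrite /z sort_lt_sorted map_inj_uniq.
  case: (z) zP sz => [|y z'] //= zP' ->; rewrite andbT.
  have [l /pt_pos dl ->] := zP' y (mem_head _ _); exact: lt_le_trans dl.
- move=> y /zP[l /ls1P/andP[/lsM lM _] ->]; rewrite ler_pdivrMr // mul1r.
  rewrite (@le_trans _ _ (l.+1)%:R) ?ler_nat //.
  by rewrite -natr1 addrC lerD2l ltW.
- move=> y y'; rewrite !inE => /predU1P[->|/zP[l ll ->]] /predU1P[->|/zP[l' ll' ->]].
  + by rewrite eqxx.
  + move=> _; rewrite sub0r normrN; exact: le_trans (pt_pos _ ll') (ler_norm _).
  + move=> _; rewrite subr0; exact: le_trans (pt_pos _ ll) (ler_norm _).
  + rewrite (inj_eq pt_inj) => /dist_nat ll1; rewrite ptB normrM normfV normr_nat.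
    by apply: (le_trans dM); rewrite ler_peMl // invr_ge0 ler0n.
- move=> y /zP[l /ls1P/andP[ll _] ->]; rewrite -tpowE ger0_norm ?tpow_ge0 //.
  rewrite leNgt; apply/negP => /ltW le; apply: Hno; exists l => //.
Qed.

(** With [r] from [tail_not_uniformly_small], call a scale large if it is at least
[Q].  If one of the next [r] scales is large, stop just before the first such
scale: from there on the product is at least 1/2, by [tpow_near0].  Otherwise
the product of these scales is at most [Q ^ r] and the [2 ^ r] leaves of
[good_leaves] feed [tail_not_uniformly_small].  Either way the bounds do not
depend on [k] and [j]. *)
Lemma tail_equipositive t : T t -> exists2 e : R, 0 < e & exists N : nat,
  forall k j x, 0 <= x < 1 -> exists2 l, (l < N)%N & e <= tpow k j (t%:~R * (x + l%:R)).
Proof.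
move=> Tt; have [r Hr] := tail_not_uniformly_small t.
have c0 : 0 <= 8 * pi * beta * `|t%:~R| :> R.
  by rewrite !mulr_ge0 ?pi_ge0 ?(beta_ge0 HS).
pose Q := (Num.truncn (16 * pi * beta * `|t%:~R| : R)).+1.
have QP m : (Q <= m)%N -> 8 * pi * beta * `|t%:~R| / m%:R <= 2^-1 :> R.
  move=> Qm; have m0 : 0 < m%:R :> R by rewrite ltr0n (leq_trans _ Qm).
  rewrite ler_pdivrMr // [2^-1 * _]mulrC ler_pdivlMr //.
  rewrite (_ : _ * 2 = 16 * pi * beta * `|t%:~R|); last by ring.
  apply/ltW/(lt_le_trans (truncnS_gt _)); by rewrite ler_nat.
have [|e e0 He] := Hr (Q ^ r)%N; first by rewrite expn_gt0.
have th0 := theta_gt0 HS; have th1 := theta_le1 HS.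
pose e' := Num.min e 2^-1.
have e'0 : 0 < e' by rewrite lt_min e0 invr_gt0 ltr0n.
exists (theta ^+ r * e'); first by rewrite mulr_gt0 ?exprn_gt0.
exists (Q ^ r).+1 => k j x x01.
have e'1 : e' <= 1 by rewrite ge_min; apply/orP; right; rewrite invf_le1 ?ler1n.
have thle i : (i <= r)%N -> theta ^+ r <= theta ^+ i.
  by move=> ir; apply: ler_wiXn2l => //; exact: ltW.
have Qpow i : (i <= r)%N -> (Q ^ i <= Q ^ r)%N by move=> ir; rewrite leq_pexp2l.
have [/existsP[i0 hi0]|/existsPn hno] :=
  boolP [exists i : 'I_(minn r j), (Q <= q (k + i))%N].
  have ex : exists i, (i < minn r j)%N && (Q <= q (k + i))%N.
    by exists i0; rewrite ltn_ord.
  case: (ex_minnP ex) => i /andP[]; rewrite leq_min => /andP[ir ij] Qi imin.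
  have [ls [szls _ hls]] := good_leaves i k x Tt.
  case: ls szls hls => [/eqP|l ls _]; first by rewrite eq_sym expn_eq0.
  move=> /(_ l (mem_head _ _)) [li gl].
  have sQ : (scale k i <= Q ^ r)%N.
    apply: leq_trans (Qpow i (ltnW ir)); apply: scale_le => i' i'i.
    rewrite leqNgt; apply/negP => /ltnW Qi'.
    have := imin i'; rewrite leq_min (ltn_trans i'i ir) (ltn_trans i'i ij) Qi' => /(_ isT).
    by rewrite leqNgt i'i.
  exists l; first by rewrite ltnS (leq_trans (ltnW li)).
  rewrite -(subnKC (ltnW ij)) tpowD ler_pM //.
  - by rewrite exprn_ge0 // ltW.
  - exact: ltW.
  - by apply: le_trans gl; apply: thle; exact: ltnW.
  - apply: (le_trans _ (tpow_near0 HS _ _ _)).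
    have [x0 x1] := andP x01.
    have zle : `|t%:~R * (x + l%:R) / (scale k i)%:R| <= `|t%:~R| :> R.
      rewrite -mulrA normrM ler_piMr // ger0_norm ?divr_ge0 ?addr_ge0 //.
      rewrite ler_pdivrMr ?(scaleR_gt0 HS) // mul1r.
      rewrite (@le_trans _ _ (l.+1)%:R) ?ler_nat //.
      by rewrite -natr1 addrC lerD2l ltW.
    apply: (@le_trans _ _ (1 - 8 * pi * beta / (q (k + i))%:R * `|t%:~R|)).
      have := QP _ Qi; rewrite mulrAC => H.
      by rewrite (@le_trans _ _ 2^-1) ?ge_min ?lexx ?orbT //; lra.
    rewrite lerD2l lerN2 ler_wpM2l // divr_ge0 ?mulr_ge0 ?pi_ge0 ?(beta_ge0 HS) //.
have sQ i : (i <= minn r j)%N -> (scale k i <= Q ^ i)%N.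
  move=> ij; apply: scale_le => i' i'i.
  have := hno (Ordinal (leq_trans i'i ij)); rewrite -ltnNge /= => /ltnW //.
have [jr|rj] := leqP j r.
  have [ls [szls _ hls]] := good_leaves j k x Tt.
  case: ls szls hls => [/eqP|l ls _]; first by rewrite eq_sym expn_eq0.
  move=> /(_ l (mem_head _ _)) [li gl]; exists l.
    rewrite ltnS (leq_trans (ltnW li)) // (leq_trans (sQ j _)) ?Qpow //.
    by rewrite (minn_idPr jr).
  apply: (le_trans _ gl); apply: (@le_trans _ _ (theta ^+ r)); last exact: thle.
  by rewrite ler_piMr // exprn_ge0 // ltW.
have [ls [szls uls hls]] := good_leaves r k x Tt.
have sr : (scale k r <= Q ^ r)%N by apply: sQ; rewrite (minn_idPl (ltnW rj)).
have [|||l lls gl] := He (k + r)%N (j - r)%N x ls (scale k r) x01 uls.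
- by rewrite szls.
- exact: sr.
- by move=> l /hls [].
have [ll gl'] := hls l lls; exists l; first by rewrite ltnS (leq_trans (ltnW ll)).
rewrite -(subnKC (ltnW rj)) tpowD ler_pM //.
- by rewrite exprn_ge0 // ltW.
- exact: ltW.
- rewrite -mulrA; apply: le_trans gl; by rewrite ge_min lexx.
Qed.

(** The representative may be chosen independently of [j], because the products
decrease in [j]: if each of the [N] candidates failed at some [j], all of them
would fail at the largest of these. *)
Lemma equipositive t : T t -> exists2 e : R, 0 < e & exists N : nat,
  forall k x, 0 <= x < 1 -> exists2 l, (l < N)%N &
    forall j, e <= tpow k j (t%:~R * (x + l%:R)).
Proof.
move=> Tt; have [e e0 [N HN]] := tail_equipositive Tt.
exists e => //; exists N => k x x01; apply: contrapT => Hno.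
have bad l : (l < N)%N -> exists j, tpow k j (t%:~R * (x + l%:R)) < e.
  move=> lN; apply: contrapT => Hl; apply: Hno; exists l => // j.
  by rewrite leNgt; apply/negP => H; apply: Hl; exists j.
have [J HJ] : exists J, forall l, (l < N)%N -> tpow k J (t%:~R * (x + l%:R)) < e.
  elim: (N) bad => [|N' IH] bad; first by exists 0%N.
  have [l lN|J HJ] := IH; first by apply: bad; rewrite ltnS ltnW.
  have [j Hj] := bad N' (ltnSn _).
  exists (maxn J j) => l; rewrite ltnS leq_eqVlt => /predU1P[->|lN].
    by apply: le_lt_trans Hj; apply: tpow_anti_le; exact: leq_maxr.
  by apply: le_lt_trans (HJ l lN); apply: tpow_anti_le; exact: leq_maxl.
have [l lN] := HN k J x x01; rewrite leNgt; case/negP; exact: HJ.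
Qed.

(** Take a good representative [l0] over a long block of levels of scale [M], then
a nonzero residue [l2] at the next level, then good digits after it.  Adding
the multiple [M * u] with [u] nonzero pushes the result beyond [H] and leaves
the product over the block unchanged, by periodicity. *)
Lemma equipositive_far t : T t -> exists2 e : R, 0 < e &
  forall k x (H : nat), 0 <= x < 1 -> exists2 l, (H <= l)%N &
    forall j, e <= tpow k j (t%:~R * (x + l%:R)).
Proof.
move=> Tt; have [e e0 [N HN]] := equipositive Tt.
have th0 := theta_gt0 HS; have th1 := theta_le1 HS.
exists (e * (theta * e)); first exact: mulr_gt0 e0 (mulr_gt0 th0 e0).
move=> k x H x01; have [l0 l0N h0] := HN k x x01.
pose K := (l0 + H).+1; pose M := scale k K.
have KM : (K <= M)%N by apply: leq_trans (scale_ge HS k K); exact/ltnW/ltn_expl.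
have M0 : 0 < M%:R :> R by rewrite (scaleR_gt0 HS).
have [x0 x1] := andP x01.
pose y := (x + l0%:R) / M%:R.
have y0 : 0 <= y by rewrite divr_ge0 ?addr_ge0 ?ler0n // ltW.
have y1 : y < 1.
  rewrite ltr_pdivrMr // mul1r (@lt_le_trans _ _ K%:R) ?ler_nat //.
  rewrite (@lt_le_trans _ _ (l0.+1)%:R) ?ler_nat ?ltnS ?leq_addr //.
  by rewrite -natr1 addrC ltrD2l.
have [l1 [l2 [/andP[l12 l2q] _ g2]]] := two_children HS (k + K) y Tt.
pose y' := (y + l2%:R) / (q (k + K))%:R.
have y'01 : 0 <= y' < 1.
  rewrite divr_ge0 ?addr_ge0 ?ler0n //= ltr_pdivrMr ?(q_gt0 HS) // mul1r.
  by rewrite (@lt_le_trans _ _ (l2.+1)%:R) ?ler_nat // -natr1 addrC ltrD2l.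
have [l3 l3N h3] := HN (k + K).+1 y' y'01.
pose u := (l2 + q (k + K) * l3)%N.
exists (l0 + M * u)%N.
  rewrite (@leq_trans (M * u)) ?leq_addl //.
  rewrite (@leq_trans M) ?leq_pmulr //; last by rewrite addn_gt0 (leq_ltn_trans _ l12).
  by apply: leq_trans KM; rewrite /K; lia.
have E : t%:~R * (x + (l0 + M * u)%:R) =
    t%:~R * (x + l0%:R) + M%:R * (t * u%:Z)%:~R :> R.
  by rewrite natrD natrM intrM; ring.
have E2 : (t%:~R * (x + (l0 + M * u)%:R)) / M%:R = t%:~R * (y + u%:R) :> R.
  by rewrite natrD natrM /y; field; rewrite gt_eqF.
have main j : e * (theta * e) <= tpow k (K + j.+1) (t%:~R * (x + (l0 + M * u)%:R)).
  rewrite tpowD E2 E (tpow_period HS) ler_pM //; try exact: ltW; first exact: ltW (mulr_gt0 th0 e0).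
  by rewrite tpowS ler_pM ?(ltW th0) ?(ltW e0).
move=> j; apply: (le_trans (main j)); apply: tpow_anti_le.
by rewrite (leq_trans (leq_addl K j)) // leq_add2l.
Qed.

End EquiPositivity.

(** * Fourier transforms of measures *)

Section CharacteristicFunctions.
Variable R : realType.
Implicit Types (P Q mu : probability R R) (f g : R -> R).

Lemma bounded_integrable P f c : measurable_fun setT f -> (forall x, `|f x| <= c) ->
  P.-integrable setT (EFin \o f).
Proof.
move=> mf fc; apply: measurable_bounded_integrable => //.
  by rewrite (le_lt_trans (probability_le1 _ _)) // ltry.
exists c; split; first exact: num_real.
by move=> M cM x _; exact: le_trans (fc x) (ltW cM).
Qed.

Lemma measurable_cosM (a : R) : measurable_fun setT (fun x => cos (a * x)).
Proof.
apply: continuous_measurable_fun => x.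
by apply: continuous_comp; [exact: mulrl_continuous|exact: continuous_cos].
Qed.

Lemma measurable_sinM (a : R) : measurable_fun setT (fun x => sin (a * x)).
Proof.
apply: continuous_measurable_fun => x.
by apply: continuous_comp; [exact: mulrl_continuous|exact: continuous_sin].
Qed.

Lemma normr_cos_le1 (x : R) : `|cos x| <= 1.
Proof. by rewrite ler_norml cos_geN1 cos_le1. Qed.

Lemma normr_sin_le1 (x : R) : `|sin x| <= 1.
Proof. by rewrite ler_norml sin_geN1 sin_le1. Qed.

Lemma integrable_cosM P (a : R) : P.-integrable setT (EFin \o (fun x => cos (a * x))).
Proof.
by apply: (@bounded_integrable P _ 1) => [|x]; [exact: measurable_cosM|exact: normr_cos_le1].
Qed.

Lemma integrable_sinM P (a : R) : P.-integrable setT (EFin \o (fun x => sin (a * x))).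
Proof.
by apply: (@bounded_integrable P _ 1) => [|x]; [exact: measurable_sinM|exact: normr_sin_le1].
Qed.

Lemma integrable_mull P f r : P.-integrable setT (EFin \o f) ->
  P.-integrable setT (EFin \o (fun x => r * f x)).
Proof. by move=> fi; have := integrableZl measurableT r fi; apply: eq_integrable => // x _; rewrite /= EFinM. Qed.

Lemma integrable_mulr P f r : P.-integrable setT (EFin \o f) ->
  P.-integrable setT (EFin \o (fun x => f x * r)).
Proof. by move=> fi; have := integrableZr measurableT r fi; apply: eq_integrable => // x _; rewrite /= EFinM. Qed.

(** Normalised so that the integral of [expo l] is [cf P (2 * pi * l)]. *)
Definition cf P (a : R) : R[i] :=
  Complex (\int[P]_x cos (a * x)) (\int[P]_x sin (a * x)).

Lemma integral_convolution P Q f c : measurable_fun setT f -> (forall x, `|f x| <= c) ->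
  \int[convolution P Q]_x f x = \int[P]_u \int[Q]_v f (u + v).
Proof.
move=> mf fc.
have mfa : measurable_fun setT (f \o @addp R).
  by apply: measurableT_comp => //; exact: measurable_addp.
have fa : (P \x Q)%E.-integrable setT (EFin \o (f \o @addp R)).
  apply: measurable_bounded_integrable => //.
    by rewrite (le_lt_trans (probability_le1 (P \x Q)%E _)) // ltry.
  exists c; split; first exact: num_real.
  by move=> M cM x _; exact: le_trans (fc _) (ltW cM).
rewrite /Rintegral /convolution.
rewrite (integral_distribution (f := EFin \o f)); last exact: fa.
  rewrite -integral12_prod_meas1 //; congr fine; apply: eq_integral => u _.
  rewrite /fubini_F /= fineK //; apply: integrable_fin_num => //.
  apply: (@bounded_integrable Q _ c) => //.
  by apply: measurableT_comp mf _; exact: measurable_funD.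
exact/measurable_EFinP.
Qed.

Lemma cf_convolution P Q a : cf (convolution P Q) a = cf P a * cf Q a.
Proof.
apply: eq_complexP; rewrite ?complex_ReM ?complex_ImM /=.
  rewrite (integral_convolution _ _ (measurable_cosM a) (fun x => normr_cos_le1 (a * x))).
  transitivity (\int[P]_u (cos (a * u) * (\int[Q]_v cos (a * v)) -
                           sin (a * u) * (\int[Q]_v sin (a * v)))).
    apply: eq_Rintegral => u _; under eq_Rintegral do rewrite mulrDr cosD.
    rewrite RintegralB ?RintegralZl //; [exact: integrable_sinM|exact: integrable_cosM| |].
      by apply: integrable_mull; exact: integrable_cosM.
    by apply: integrable_mull; exact: integrable_sinM.
  rewrite RintegralB ?RintegralZr //; [exact: integrable_sinM|exact: integrable_cosM| |].
    by apply: integrable_mulr; exact: integrable_cosM.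
  by apply: integrable_mulr; exact: integrable_sinM.
rewrite (integral_convolution _ _ (measurable_sinM a) (fun x => normr_sin_le1 (a * x))).
transitivity (\int[P]_u (sin (a * u) * (\int[Q]_v cos (a * v)) +
                         cos (a * u) * (\int[Q]_v sin (a * v)))).
  apply: eq_Rintegral => u _; under eq_Rintegral do rewrite mulrDr sinD.
  rewrite RintegralD ?RintegralZl //; [exact: integrable_sinM|exact: integrable_cosM| |].
    by apply: integrable_mull; exact: integrable_cosM.
  by apply: integrable_mull; exact: integrable_sinM.
rewrite RintegralD ?RintegralZr //; [by rewrite addrC|exact: integrable_cosM|exact: integrable_sinM| |].
  by apply: integrable_mulr; exact: integrable_sinM.
by apply: integrable_mulr; exact: integrable_cosM.
Qed.

Lemma integral_udirac (D : {fset R}) f c : D != fset0 -> measurable_fun setT f ->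
  (forall x, `|f x| <= c) ->
  \int[udirac D]_x f x = #|` D|%:R^-1 * \sum_(d <- enum_fset D) f d.
Proof.
move=> D0 mf fc.
have n0 : 0 < #|` D|%:R :> R by rewrite ltr0n cardfs_gt0.
have nn0 : 0 <= #|` D|%:R^-1 :> R by rewrite invr_ge0 ltW.
have main (g : R -> R) : measurable_fun setT g -> (forall x, 0 <= g x) ->
    \int[udirac D]_x g x = #|` D|%:R^-1 * \sum_(d <- enum_fset D) g d.
  move=> mg g0; rewrite /Rintegral.
  rewrite (eq_measure_integral (mscale (NngNum nn0)
     (msum (fun k => dirac ((enum_fset D)`_k : R)) #|` D|))); last first.
    move=> A _ _; apply: (etrans (udiracE A D0)); rewrite /mscale /= /msum; congr (_ * _)%E.
    by rewrite (big_nth 0) big_mkord.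
  have mg' : measurable_fun setT (EFin \o g) by exact/measurable_EFinP.
  rewrite ge0_integral_mscale //; last by move=> x _; rewrite lee_fin.
  rewrite ge0_integral_measure_sum //; last by move=> x _; rewrite lee_fin.
  under eq_bigr => k _ do rewrite integral_dirac // diracT mul1e.
  rewrite sumEFin -EFinM /=; congr (_ * _).
  by rewrite [RHS](big_nth 0) big_mkord.
have E h : (forall x, h x = f x + c) -> \int[udirac D]_x h x = \int[udirac D]_x f x + c.
  move=> hE; under eq_Rintegral do rewrite hE.
  rewrite RintegralD //; last 2 first.
    exact: bounded_integrable fc.
    by apply: (@bounded_integrable _ _ `|c|) => //; exact: measurable_cst.
  rewrite Rintegral_cst //; congr (_ + _); rewrite -[RHS]mulr1; congr (_ * _).
  by have /(congr1 fine) := probability_setT (udirac D).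
apply: (addIr c); rewrite -(E (fun x => f x + c)) // main.
- rewrite big_split /= mulrDr; congr (_ + _).
  by rewrite big_const_seq count_predT iter_addr_0 -[c *+ _]mulr_natl mulKf // gt_eqF.
- by apply: measurable_funD => //; exact: measurable_cst.
- by move=> x; have := fc x; rewrite ler_norml -lerBlDr sub0r => /andP[].
Qed.

Lemma cf_udirac (D : {fset R}) a : D != fset0 ->
  cf (udirac D) a = expmean (enum_fset D) a.
Proof.
move=> D0; apply: eq_complexP; rewrite /expmean /=.
  rewrite (integral_udirac D0 (measurable_cosM a) (fun x => normr_cos_le1 (a * x))).
  rewrite complex_ReM complex_Re_sum /= mul0r subr0; congr (_ * _).
  by apply: eq_bigr => d _ /=; rewrite mulrC.
rewrite (integral_udirac D0 (measurable_sinM a) (fun x => normr_sin_le1 (a * x))).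
rewrite complex_ImM complex_Im_sum /= mul0r addr0; congr (_ * _).
by apply: eq_bigr => d _ /=; rewrite mulrC.
Qed.

Lemma weak_cvg_cf (P : nat -> probability R R) mu a : weak_cvg P mu ->
  (complex.Re (cf (P n) a) @[n --> \oo] --> complex.Re (cf mu a)) /\
  (complex.Im (cf (P n) a) @[n --> \oo] --> complex.Im (cf mu a)).
Proof.
move=> H; split; apply: H.
- move=> x; apply: continuous_comp; last exact: continuous_cos.
  exact: mulrl_continuous.
- exists 1; split; first exact: num_real.
  by move=> M M1 x _; exact: le_trans (normr_cos_le1 _) (ltW M1).
- move=> x; apply: continuous_comp; last exact: continuous_sin.
  exact: mulrl_continuous.
- exists 1; split; first exact: num_real.
  by move=> M M1 x _; exact: le_trans (normr_sin_le1 _) (ltW M1).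
Qed.

Lemma weak_cvg_sqmod_cf (P : nat -> probability R R) mu a : weak_cvg P mu ->
  sqmod (cf (P n) a) @[n --> \oo] --> sqmod (cf mu a).
Proof. by move=> /(weak_cvg_cf a)[cr ci]; apply: cvgD; rewrite !expr2; apply: cvgM. Qed.

End CharacteristicFunctions.

(** * Approximation by exponentials in square mean *)

Section SquareApproximation.
Variables (R : realType) (mu : probability R R) (Lam : set R).
Implicit Types (f g : R -> R[i]) (u v : R -> R) (ps : seq (R * R[i])).
Local Open Scope ereal_scope.

Definition cmeas f := measurable_fun setT (@complex.Re R \o f) /\
  measurable_fun setT (@complex.Im R \o f).

(** The square of the norm, as an integral that needs no root. *)
Definition N2 f : \bar R := \int[mu]_x (sqmod (f x))%:E.

Definition trig ps (x : R) : R[i] := (\sum_(p <- ps) p.2 * expo p.1 x)%R.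

(** Membership in the closed span of the exponentials with frequencies in [Lam].
Measurability is part of the definition so that the closure properties below
can be chained. *)
Definition approximable f := cmeas f /\ forall e : R, (0 < e)%R ->
  exists ps, {in ps, forall p, Lam p.1} /\ N2 (fun x => f x - trig ps x)%R < e%:E.

Lemma cmeasD f g : cmeas f -> cmeas g -> cmeas (fun x => f x + g x)%R.
Proof.
move=> [mf mf'] [mg mg']; split.
  rewrite (_ : _ \o _ = (fun x => complex.Re (f x) + complex.Re (g x))%R).
    exact: measurable_funD.
  by apply/funext => x /=; rewrite complex_ReD.
rewrite (_ : _ \o _ = (fun x => complex.Im (f x) + complex.Im (g x))%R).
  exact: measurable_funD.
by apply/funext => x /=; rewrite complex_ImD.
Qed.

Lemma cmeasM f g : cmeas f -> cmeas g -> cmeas (fun x => f x * g x)%R.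
Proof.
move=> [mf mf'] [mg mg']; split.
  rewrite (_ : _ \o _ = (fun x => complex.Re (f x) * complex.Re (g x) -
      complex.Im (f x) * complex.Im (g x))%R).
    by apply: measurable_funB; exact: measurable_funM.
  by apply/funext => x /=; rewrite complex_ReM.
rewrite (_ : _ \o _ = (fun x => complex.Re (f x) * complex.Im (g x) +
      complex.Im (f x) * complex.Re (g x))%R).
  by apply: measurable_funD; exact: measurable_funM.
by apply/funext => x /=; rewrite complex_ImM.
Qed.

Lemma cmeas_cst c : cmeas (fun=> c).
Proof. by split; exact: measurable_cst. Qed.

Lemma cmeasB f g : cmeas f -> cmeas g -> cmeas (fun x => f x - g x)%R.
Proof.
move=> mf mg; rewrite (_ : (fun x => f x - g x)%R = (fun x => f x + (-1) * g x)%R).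
  by apply: cmeasD => //; apply: cmeasM => //; exact: cmeas_cst.
by apply/funext => x; rewrite mulN1r.
Qed.

Lemma cmeas_expo l : cmeas (expo l).
Proof. by split; [exact: measurable_cosM|exact: measurable_sinM]. Qed.

Lemma cmeas_trig ps : cmeas (trig ps).
Proof.
elim: ps => [|p ps IH].
  rewrite (_ : trig [::] = fun=> 0%R); first exact: cmeas_cst.
  by apply/funext => x; rewrite /trig big_nil.
rewrite (_ : trig (p :: ps) = fun x => p.2 * expo p.1 x + trig ps x)%R.
  by apply: cmeasD => //; apply: cmeasM; [exact: cmeas_cst|exact: cmeas_expo].
by apply/funext => x; rewrite /trig big_cons.
Qed.

Lemma cmeas_real u : measurable_fun setT u -> cmeas (fun x => (u x)%:C%C).
Proof. by move=> mu'; split => //=; exact: measurable_cst. Qed.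

Lemma measurable_sqmod f : cmeas f -> measurable_fun setT (fun x => (sqmod (f x))%:E).
Proof.
move=> [mf mf']; apply/measurable_EFinP; apply: measurable_funD.
  exact: measurable_funX.
exact: measurable_funX.
Qed.


Lemma sqmodD_le (a b : R[i]) : (sqmod (a + b) <= 2 * sqmod a + 2 * sqmod b)%R.
Proof.
rewrite /sqmod complex_ReD complex_ImD.
set x := complex.Re a; set y := complex.Im a; set z := complex.Re b; set t := complex.Im b.
have := sqr_ge0 (x - z); have := sqr_ge0 (y - t); rewrite !sqrrB !sqrrD; lra.
Qed.

(** From [sqmod (a + b) <= 2 sqmod a + 2 sqmod b]; the factor 4 is what two summands
cost. *)
Lemma N2D_lt f g (e : R) : cmeas f -> cmeas g -> N2 f < (e / 4)%:E ->
  N2 g < (e / 4)%:E -> N2 (fun x => f x + g x)%R < e%:E.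
Proof.
move=> mf mg fe ge.
apply: (@le_lt_trans _ _ (2%:E * N2 f + 2%:E * N2 g)); last first.
  rewrite (_ : e%:E = 2%:E * (e / 4)%:E + 2%:E * (e / 4)%:E); last first.
    by rewrite -!EFinM -EFinD; congr EFin; field.
  by apply: lteD; rewrite lte_pmul2l.
rewrite /N2 -!ge0_integralZl //; try exact: measurable_sqmod;
  try by move=> x _; rewrite lee_fin sqmod_ge0.
rewrite -ge0_integralD //; try by apply: measurable_funeM; exact: measurable_sqmod.
- apply: ge0_le_integral => //.
  + by move=> x _; rewrite lee_fin sqmod_ge0.
  + by apply: measurable_sqmod; exact: cmeasD.
  + by apply: emeasurable_funD; apply: measurable_funeM; exact: measurable_sqmod.
  + by move=> x _; rewrite -!EFinM -EFinD lee_fin sqmodD_le.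
- by move=> x _; rewrite -EFinM lee_fin mulr_ge0 ?sqmod_ge0.
- by move=> x _; rewrite -EFinM lee_fin mulr_ge0 ?sqmod_ge0.
Qed.

Lemma N2Z f c : cmeas f -> N2 (fun x => c * f x)%R = (sqmod c)%:E * N2 f.
Proof.
move=> mf; rewrite /N2 -ge0_integralZl ?lee_fin ?sqmod_ge0 //.
- by apply: eq_integral => x _; rewrite sqmodM EFinM.
- exact: measurable_sqmod.
- by move=> x _; rewrite lee_fin sqmod_ge0.
Qed.

Lemma eq_N2 f g : f =1 g -> N2 f = N2 g.
Proof. by move=> fg; apply: eq_integral => x _; rewrite fg. Qed.

Lemma approximable_closed f : cmeas f -> (forall e : R, (0 < e)%R ->
   exists g, approximable g /\ N2 (fun x => f x - g x)%R < e%:E) -> approximable f.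
Proof.
move=> mf H; split => // e e0; have e4 : (0 < e / 4)%R by rewrite divr_gt0.
have [g [[mg ag] fg]] := H _ e4; have [ps [psL gps]] := ag _ e4.
exists ps; split => //.
rewrite (eq_N2 (g := fun x => (f x - g x) + (g x - trig ps x))%R); last first.
  by move=> x; rewrite addrA subrK.
by apply: N2D_lt => //; apply: cmeasB => //; exact: cmeas_trig.
Qed.

Lemma approximableD f g : approximable f -> approximable g ->
  approximable (fun x => f x + g x)%R.
Proof.
move=> [mf af] [mg ag]; split; first exact: cmeasD.
move=> e e0; have e4 : (0 < e / 4)%R by rewrite divr_gt0.
have [ps [psL fps]] := af _ e4; have [ps' [psL' gps]] := ag _ e4.
exists (ps ++ ps'); split.
  by move=> p; rewrite mem_cat => /orP[/psL|/psL'].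
rewrite (eq_N2 (g := fun x => (f x - trig ps x) + (g x - trig ps' x))%R); last first.
  by move=> x; rewrite /trig big_cat /= opprD addrACA.
by apply: N2D_lt => //; apply: cmeasB => //; exact: cmeas_trig.
Qed.

Lemma approximableZ f c : approximable f -> approximable (fun x => c * f x)%R.
Proof.
move=> [mf af]; split; first by apply: cmeasM => //; exact: cmeas_cst.
move=> e e0; have c1 : (0 < sqmod c + 1)%R by rewrite ltr_wpDl ?sqmod_ge0.
have [|ps [psL fps]] := af (e / (sqmod c + 1))%R; first by rewrite divr_gt0.
exists [seq (p.1, c * p.2)%R | p <- ps]; split.
  by move=> _ /mapP[p /psL pL ->].
rewrite (eq_N2 (g := fun x => c * (f x - trig ps x))%R); last first.
  move=> x; rewrite mulrBr /trig big_map mulr_sumr; congr (_ - _)%R.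
  by apply: eq_bigr => p _ /=; rewrite mulrA.
rewrite N2Z; last by apply: cmeasB => //; exact: cmeas_trig.
apply: (@le_lt_trans _ _ ((sqmod c)%:E * (e / (sqmod c + 1))%:E)).
  by rewrite lee_wpmul2l ?lee_fin ?sqmod_ge0 // ltW.
rewrite -EFinM lte_fin mulrCA gtr_pMr // ltr_pdivrMr // mul1r ltrDl //.
Qed.

Lemma eq_approximable f g : f =1 g -> approximable f -> approximable g.
Proof. by move=> fg; rewrite (_ : f = g) //; exact/funext. Qed.

(** Dominated convergence turns pointwise limits into limits in square mean. *)
Lemma approximable_dominated f (g : nat -> R -> R[i]) (h : R -> R) :
  cmeas f -> (forall n, approximable (g n)) ->
  mu.-integrable setT (EFin \o h) ->
  (forall x, (fun n => sqmod (f x - g n x))%R @ \oo --> (0 : R)%R) ->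
  (forall n x, sqmod (f x - g n x) <= h x)%R -> approximable f.
Proof.
move=> mf ag ih cvg0 dom; apply: approximable_closed => // e e0.
have mfg n : cmeas (fun x => f x - g n x)%R by apply: cmeasB => //; exact: (ag n).1.
have H : (fun n => N2 (fun x => f x - g n x)%R) @ \oo --> \int[mu]_x (cst 0 x : \bar R).
  apply: (@dominated_cvg _ _ _ mu setT _ _ _ (EFin \o h)) => //.
  - by move=> n; apply: measurable_sqmod.
  - by move=> x _; apply/cvg_EFin; [near=> n|exact: cvg0].
  - move=> n x _; rewrite gee0_abs ?lee_fin ?sqmod_ge0 //; exact: dom.
move: H; rewrite integral_cst // mul0e => /fine_cvgP[fin].
move=> /cvgr_lt /(_ e e0) H.
have [n] : exists n, N2 (fun x => f x - g n x)%R \is a fin_num /\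
    (fine (N2 (fun x => f x - g n x)) < e)%R.
  have := filterI fin H => -[n _ Hn]; exists n; exact: Hn n (leqnn n).
move=> [fn lt]; exists (g n); split => //.
by rewrite -(fineK fn) lte_fin.
Unshelve. all: by end_near.
Qed.

End SquareApproximation.

Section TrigonometricNorm.
Variables (R : realType) (mu : probability R R).
Implicit Types (ps : seq (R * R[i])).

Lemma sqmodE (z : R[i]) : sqmod z = complex.Re (z * conjc z).
Proof. by case: z => a b; rewrite /sqmod complex_ReM /=; ring. Qed.

Lemma conj_mulc (a b : R[i]) : conjc (a * b) = conjc a * conjc b.
Proof. exact: rmorphM. Qed.

Lemma conj_oppc (a : R[i]) : conjc (- a) = - conjc a.
Proof. exact: rmorphN. Qed.

Let term (p : R[i] * R) (x : R) : R := complex.Re (p.1 * expi (p.2 * x)).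

Lemma integrable_trig_sum (r : seq (R[i] * R)) :
  mu.-integrable setT (EFin \o (fun x => \sum_(p <- r) term p x)) /\
  \int[mu]_x (\sum_(p <- r) term p x) = \sum_(p <- r) complex.Re (p.1 * cf mu p.2).
Proof.
elim: r => [|p r [ir IH]].
  rewrite (_ : (fun x => _) = cst 0); last by apply/funext => x; rewrite big_nil.
  split; first by apply: (@bounded_integrable _ _ _ 0) => // x; rewrite normr0.
  by rewrite big_nil Rintegral_cst // mul0r.
have it : mu.-integrable setT (EFin \o term p).
  have i1 := integrable_mull (complex.Re p.1) (integrable_cosM mu p.2).
  have i2 := integrable_mull (complex.Im p.1) (integrable_sinM mu p.2).
  have := integrableB measurableT i1 i2; apply: eq_integrable => // x _.
  by rewrite /= /term complex_ReM EFinB.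
have et : \int[mu]_x term p x = complex.Re (p.1 * cf mu p.2).
  rewrite complex_ReM /= -!RintegralZl //; try exact: integrable_cosM; try exact: integrable_sinM.
  rewrite -RintegralB //; try by apply: integrable_mull; exact: integrable_cosM.
    by apply: eq_Rintegral => x _; rewrite /term complex_ReM.
  by apply: integrable_mull; exact: integrable_sinM.
have E : (fun x => \sum_(p <- p :: r) term p x) =
    (fun x => term p x + \sum_(p <- r) term p x).
  by apply/funext => x; rewrite big_cons.
split.
  rewrite E; have := integrableD measurableT it ir.
  by apply: eq_integrable.
rewrite E big_cons RintegralD //; congr (_ + _) => //.
Qed.

Definition trig_form (p p' : R * R[i]) : R :=
  complex.Re (p.2 * conjc p'.2 * cf mu (2 * pi * (p.1 - p'.1))).

(** The Gram matrix of the exponentials is given by the transform of [mu]. *)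
Lemma N2_trig ps : N2 mu (trig ps) =
  (\sum_(p <- ps) \sum_(p' <- ps) trig_form p p')%:E.
Proof.
pose r := [seq (p.2 * conjc p'.2, 2 * pi * (p.1 - p'.1)) | p <- ps, p' <- ps].
have [ir er] := integrable_trig_sum r.
have E x : sqmod (trig ps x) = \sum_(p <- r) term p x.
  rewrite sqmodE /trig rmorph_sum mulr_suml complex_Re_sum big_allpairs_dep /=.
  apply: eq_bigr => p _; rewrite mulr_sumr complex_Re_sum; apply: eq_bigr => p' _.
  rewrite /term /= conj_mulc /expo conj_expi mulrACA -expiD.
  by congr (complex.Re (_ * expi _)); ring.
rewrite /N2; under eq_integral do rewrite E.
rewrite -(fineK (integrable_fin_num measurableT ir)); congr EFin.
transitivity (\sum_(p <- r) complex.Re (p.1 * cf mu p.2)); first exact: er.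
by rewrite big_allpairs_dep.
Qed.

Lemma cf0 : cf mu 0 = 1.
Proof.
rewrite /cf; under eq_Rintegral do rewrite mul0r cos0.
under [X in Complex _ X]eq_Rintegral do rewrite mul0r sin0.
rewrite !Rintegral_cst // mul0r mul1r; congr Complex.
by have /(congr1 fine) := probability_setT mu.
Qed.

Lemma cfN a : cf mu (- a) = conjc (cf mu a).
Proof.
rewrite /cf /=; congr Complex.
  by apply: eq_Rintegral => x _; rewrite mulNr cosN.
under eq_Rintegral do rewrite mulNr sinN -mulN1r.
by rewrite RintegralZl ?mulN1r //; exact: integrable_sinM.
Qed.

(** Bessel's identity: the distance from an exponential to its projection onto an
orthonormal family. *)
Lemma N2_expo_residual x (s : seq R) : uniq s ->
  {in s &, forall a b, a != b -> cf mu (2 * pi * (a - b)) = 0} ->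
  exists ps, {in ps, forall p, p.1 \in s} /\
    N2 mu (fun y => expo x y - trig ps y) =
      (1 - \sum_(l <- s) sqmod (cf mu (2 * pi * (x - l))))%:E.
Proof.
move=> us os; pose c l := cf mu (2 * pi * (x - l)).
exists [seq (l, c l) | l <- s]; split.
  by move=> _ /mapP[l ls ->].
pose ps := (x, 1) :: [seq (l, - c l) | l <- s].
rewrite (eq_N2 _ (g := trig ps)); last first.
  move=> y; rewrite /trig big_cons mul1r !big_map; congr (_ + _).
  by rewrite -sumrN; apply: eq_bigr => l _ /=; rewrite mulNr.
have F0 : trig_form (x, 1) (x, 1) = 1.
  by rewrite /trig_form subrr mulr0 cf0 conjc1 !mulr1.
have F1 l : trig_form (x, 1) (l, - c l) = - sqmod (c l).
  rewrite /trig_form [fst _]/= [snd _]/= mul1r sqmodE conj_oppc mulrC mulrN.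
  by rewrite -/(c l); case: (_ * _).
have F2 l : trig_form (l, - c l) (x, 1) = - sqmod (c l).
  rewrite /trig_form [fst _]/= [snd _]/= conjc1 mulr1 -[l - x]opprB mulrN cfN.
  by rewrite -/(c l) sqmodE mulNr; case: (_ * _).
have F3 l l' : l \in s -> l' \in s ->
    trig_form (l, - c l) (l', - c l') = if l' == l then sqmod (c l) else 0.
  move=> ls l's; rewrite /trig_form [fst _]/= [snd _]/=.
  have [->|ne] := eqVneq; last by rewrite os ?mulr0 // eq_sym.
  by rewrite subrr mulr0 cf0 mulr1 conj_oppc mulrNN -sqmodE.
rewrite N2_trig; congr EFin; rewrite /ps big_cons big_cons F0 !big_map.
under eq_bigr do rewrite F1.
rewrite sumrN -[RHS]addr0; congr (_ + _).
rewrite big_seq big1 // => l ls; rewrite big_cons F2 big_map.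
rewrite big_seq (eq_bigr _ (fun l' l's => F3 l l' ls l's)) -big_seq.
rewrite (bigD1_seq l) //= eqxx big1_seq ?addr0 ?addNr // => l' /andP[/negbTE -> _] //.
Qed.

End TrigonometricNorm.

(** * Density of the exponentials *)

Section StepApproximation.
Variable R : realType.

Lemma bernoulli_ineq (x : R) n : -1 <= x -> 1 + n%:R * x <= (1 + x) ^+ n.
Proof.
move=> x1; elim: n => [|n IH]; first by rewrite mul0r addr0 expr0.
have x0 : 0 <= 1 + x by lra.
rewrite exprS; apply: (@le_trans _ _ ((1 + x) * (1 + n%:R * x))).
  rewrite -[n.+1%:R]natr1; have : 0 <= n%:R * (x * x) by rewrite mulr_ge0 // -expr2 sqr_ge0.
  by move=> H; rewrite -subr_ge0 (_ : _ - _ = n%:R * (x * x)) //; ring.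
exact: ler_wpM2l.
Qed.

Lemma cvg_natr_exp (w : R) : 0 <= w < 1 -> (fun n => n%:R * w ^+ n) @ \oo --> 0.
Proof.
move=> /andP[w0 w1]; have [->|wn0] := eqVneq w 0.
  apply/cvgrPdist_lt => e e0; near=> n; rewrite expr0n gtn_eqF ?mulr0 ?subrr ?normr0 //.
  by near: n; exact: nbhs_infty_gt.
have wp : 0 < w by rewrite lt_def wn0.
pose s := Num.sqrt w.
have s0 : 0 < s by rewrite sqrtr_gt0.
have s1 : s < 1 by rewrite -(@sqrtr1 R) ltr_sqrt.
have ss : s * s = w by rewrite -expr2 sqr_sqrtr.
pose h := s^-1 - 1.
have h0 : 0 < h by rewrite subr_gt0 invf_gt1.
have B n : n%:R * s ^+ n <= h^-1.
  have : 1 + n%:R * h <= (1 + h) ^+ n by apply: bernoulli_ineq; lra.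
  have -> : 1 + h = s^-1 by rewrite /h addrC subrK.
  rewrite exprVn => H.
  rewrite -[h^-1]mul1r ler_pdivlMr // mulrAC -ler_pdivlMr ?exprn_gt0 // mul1r.
  by apply: le_trans H; rewrite lerDr.
apply: (@squeeze_cvgr _ _ _ _ (fun=> 0) (fun n => h^-1 * s ^+ n)).
- near=> n; rewrite mulr_ge0 ?exprn_ge0 //= -ss exprMn mulrA.
  by rewrite ler_wpM2r ?B ?exprn_ge0 // ltW.
- exact: cvg_cst.
- rewrite -[0](mulr0 h^-1); apply: cvgM; first exact: cvg_cst.
  by apply: cvg_expr; rewrite ger0_norm // ltW.
Unshelve. all: by end_near.
Qed.

(** A polynomial approximation of the step function: the exponent [n * 2 ^ n] makes
the value at [w] tend to 1 for [w < 1] and to 0 for [w >= 1].  It is used in place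
of the Stone-Weierstrass theorem, to reach indicators from cosines. *)
Definition step_poly n (w : R) : R := (1 - (w / 2) ^+ n) ^+ (n * 2 ^ n).

Lemma step_poly_bound n w : 0 <= w <= 2 -> 0 <= step_poly n w <= 1.
Proof.
move=> /andP[w0 w2]; have u0 : 0 <= w / 2 by rewrite divr_ge0.
have u1 : w / 2 <= 1 by rewrite ler_pdivrMr // mul1r.
have e0 := exprn_ge0 n u0; have e1 : (w / 2) ^+ n <= 1 by rewrite exprn_ile1.
by rewrite exprn_ge0 ?exprn_ile1 //; lra.
Qed.

(** Both cases come from Bernoulli's inequality, applied to [1 - (w / 2) ^ n] and to
[1 + (w / 2) ^ n]; the product of the two powers is at most 1. *)
Lemma cvg_step_poly w : 0 <= w <= 2 ->
  (fun n => step_poly n w) @ \oo --> ((w < 1)%R%:R : R).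
Proof.
move=> w02; have /andP[w0 w2] := w02.
have u0 : 0 <= w / 2 by rewrite divr_ge0.
have u1 : w / 2 <= 1 by rewrite ler_pdivrMr // mul1r.
have ynE n : (n * 2 ^ n)%:R * (w / 2) ^+ n = n%:R * w ^+ n.
  rewrite natrM natrX -mulrA -exprMn; congr (_ * _ ^+ _).
  by rewrite mulrCA divff ?mulr1 // pnatr_eq0.
have e0 n := exprn_ge0 n u0; have e1 n : (w / 2) ^+ n <= 1 by rewrite exprn_ile1.
have [w1|w1] := ltP w 1.
  apply: (@squeeze_cvgr _ _ _ _ (fun n => 1 - n%:R * w ^+ n) (fun=> 1)).
  - near=> n; have /andP[_ ->] := step_poly_bound n w02; rewrite andbT.
    have := @bernoulli_ineq (- (w / 2) ^+ n) (n * 2 ^ n); rewrite mulrN ynE; apply.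
    by rewrite lerN2.
  - have H : (fun n => 1 - n%:R * w ^+ n) @ \oo --> (1 - 0 : R).
      apply: cvgB; first exact: cvg_cst.
      by apply: cvg_natr_exp; rewrite w0.
    by rewrite subr0 in H.
  - exact: cvg_cst.
apply: (@squeeze_cvgr _ _ _ _ (fun=> 0) harmonic).
- near=> n; have /andP[-> _] := step_poly_bound n w02; rewrite /=.
  set y := (w / 2) ^+ n.
  have B : 1 + n%:R * w ^+ n <= (1 + y) ^+ (n * 2 ^ n).
    rewrite -ynE; apply: bernoulli_ineq; rewrite (le_trans _ (e0 n)) //; lra.
  have n1 : n.+1%:R <= (1 + y) ^+ (n * 2 ^ n).
    apply: le_trans B; rewrite -natr1 addrC lerD2l ler_peMr //.
    exact: exprn_ege1.
  have np : 0 < n.+1%:R :> R by rewrite ltr0n.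
  rewrite /step_poly -/y.
  have : (1 - y) ^+ (n * 2 ^ n) * (1 + y) ^+ (n * 2 ^ n) <= 1.
    rewrite -exprMn exprn_ile1 //.
      by rewrite mulr_ge0 ?subr_ge0 ?e1 // addr_ge0 // e0.
    have := sqr_ge0 y; rewrite expr2; nra.
  move=> H; rewrite /harmonic /= -[leRHS]mul1r ler_pdivlMr //; apply: le_trans H.
  by rewrite ler_wpM2l // exprn_ge0 // subr_ge0 e1.
- exact: cvg_cst.
- exact: cvg_harmonic.
Unshelve. all: by end_near.
Qed.

End StepApproximation.

Section Density.
Variables (R : realType) (mu : probability R R) (Lam : set R).
Hypothesis hexpo : forall x, approximable mu Lam (expo x).
Implicit Types (f g : R -> R[i]) (u v : R -> R) (ps : seq (R * R[i])).

Lemma approximable_trig ps : approximable mu Lam (trig ps).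
Proof.
elim: ps => [|p ps IH].
  apply: (@eq_approximable _ _ _ (fun x => 0 * expo 0 x)); last exact: approximableZ.
  by move=> x; rewrite /trig big_nil mul0r.
apply: (@eq_approximable _ _ _ (fun x => p.2 * expo p.1 x + trig ps x)).
  by move=> x; rewrite /trig big_cons.
by apply: approximableD => //; exact: approximableZ.
Qed.

(** Real functions that are finite sums of exponentials: an algebra, so that
polynomials in cosines belong to it. *)
Definition is_trig u := exists ps, forall x, (u x)%:C%C = trig ps x.

Lemma is_trigD u v : is_trig u -> is_trig v -> is_trig (fun x => u x + v x).
Proof.
move=> [ps hu] [ps' hv]; exists (ps ++ ps') => x.
by rewrite rmorphD /= hu hv /trig big_cat.
Qed.

Lemma is_trigM u v : is_trig u -> is_trig v -> is_trig (fun x => u x * v x).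
Proof.
move=> [ps hu] [ps' hv].
exists [seq (p.1 + p'.1, p.2 * p'.2) | p <- ps, p' <- ps'] => x.
rewrite rmorphM /= hu hv /trig big_allpairs_dep mulr_suml.
apply: eq_bigr => p _; rewrite mulr_sumr; apply: eq_bigr => p' _ /=.
by rewrite mulrACA /expo -expiD; congr (_ * expi _); ring.
Qed.

Lemma is_trig_cst c : is_trig (fun=> c).
Proof.
exists [:: (0, c%:C%C)] => x; rewrite /trig big_seq1 /expo /=.
by rewrite mulr0 mul0r expi0 mulr1.
Qed.

Lemma is_trigX u n : is_trig u -> is_trig (fun x => u x ^+ n).
Proof.
move=> tu; elim: n => [|n IH].
  by rewrite (_ : (fun x => _) = fun=> 1) //; exact: is_trig_cst.
rewrite (_ : (fun x => _) = (fun x => u x * u x ^+ n)); first exact: is_trigM.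
by apply/funext => x; rewrite exprS.
Qed.

Lemma is_trig_cos a b : is_trig (fun x => cos (a * x + b)).
Proof.
pose l := a / (2 * pi).
exists [:: (l, 2^-1%:C%C * expi b); (- l, 2^-1%:C%C * expi (- b))] => x.
have pn0 : pi != 0 :> R by rewrite gt_eqF // pi_gt0.
rewrite /trig big_cons big_seq1.
transitivity (2^-1%:C%C * expi (a * x + b) + 2^-1%:C%C * expi (- (a * x + b))).
  apply: eq_complexP; rewrite ?complex_ReD ?complex_ImD ?complex_ReM ?complex_ImM /=.
    by rewrite cosN; field.
  by rewrite sinN; ring.
congr (_ + _).
  transitivity (2^-1%:C%C * expi b * expi (2 * pi * l * x)) => //.
  rewrite -mulrA -expiD; congr (_ * expi _); rewrite /l.
  by move: (pi : R) pn0 => p pn0; field.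
transitivity (2^-1%:C%C * expi (- b) * expi (2 * pi * - l * x)) => //.
rewrite -mulrA -expiD; congr (_ * expi _); rewrite /l.
by move: (pi : R) pn0 => p pn0; field.
Qed.

Lemma is_trig_approximable u : is_trig u -> approximable mu Lam (fun x => (u x)%:C%C).
Proof.
by move=> [ps hu]; apply: (eq_approximable _ (approximable_trig ps)) => x; rewrite hu.
Qed.

(** Uniform boundedness gives the dominating function, here the constant 4. *)
Lemma approximable_real_limit u (g : nat -> R -> R) : measurable_fun setT u ->
  (forall n, approximable mu Lam (fun x => (g n x)%:C%C)) ->
  (forall x, g n x @[n --> \oo] --> u x) ->
  (forall n x, `|g n x| <= 1) -> (forall x, `|u x| <= 1) ->
  approximable mu Lam (fun x => (u x)%:C%C).
Proof.
move=> mu' ag gu g1 u1.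
have E n x : sqmod ((u x)%:C%C - (g n x)%:C%C) = (u x - g n x) ^+ 2.
  by rewrite -rmorphB /sqmod /= expr0n addr0.
apply: (@approximable_dominated _ mu Lam _ (fun n x => (g n x)%:C%C) (fun=> 4)) => //.
- exact: cmeas_real.
- apply: (@bounded_integrable R mu (fun=> 4) 4); first exact: measurable_cst.
  by move=> x; rewrite ger0_norm.
- move=> x; under eq_fun do rewrite E expr2.
  have H : (fun n => (u x - g n x) * (u x - g n x)) @ \oo -->
      (u x - u x) * (u x - u x).
    by apply: cvgM; (apply: cvgB; [exact: cvg_cst|exact: gu]).
  by rewrite subrr mulr0 in H.
- move=> n x; rewrite E -real_normK ?num_real //.
  have H : `|u x - g n x| <= 2 by rewrite (le_trans (ler_normB _ _)) // lerD.
  by rewrite expr2 (_ : 4 = 2 * 2) ?ler_pM //; ring.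
Qed.

(** Compose the step approximation with an affine image of the cosine.  The bound
[0 <= k] keeps the argument within the interval where the approximation
converges. *)
Lemma approximable_arc a b k : 0 <= k ->
  approximable mu Lam (fun x => ((cos (a * x + b) < k)%R%:R : R)%:C%C).
Proof.
move=> k0; have k1 : 0 < 1 + k by lra.
pose w x := (1 + cos (a * x + b)) / (1 + k).
have w02 x : 0 <= w x <= 2.
  have cN1 := cos_geN1 (a * x + b); have c1 := cos_le1 (a * x + b).
  apply/andP; split; last by rewrite ler_pdivrMr //; lra.
  by rewrite divr_ge0 ?(ltW k1) //; lra.
have wk x : (w x < 1) = (cos (a * x + b) < k).
  by rewrite ltr_pdivrMr // mul1r ltrD2l.
have mcos : measurable_fun setT (fun x : R => cos (a * x + b)).
  apply: continuous_measurable_fun => x; apply: continuous_comp; last exact: continuous_cos.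
  by apply: cvgD; [exact: mulrl_continuous|exact: cvg_cst].
apply: (@approximable_real_limit _ (fun n x => step_poly n (w x))).
- rewrite (_ : (fun x => _) = \1_[set x | cos (a * x + b) < k]).
    apply: measurable_indic; rewrite -[X in measurable X]setTI.
    have := mcos measurableT `]-oo, k[%classic (measurable_itv _).
    by congr (measurable _); congr (_ `&` _); apply/seteqP; split => x /=; rewrite in_itv.
  apply/funext => x; rewrite indicE; congr (nat_of_bool _)%:R.
  by apply/idP/idP => [H|/set_mem//]; apply/mem_set.
- move=> n; apply: is_trig_approximable; apply: is_trigX.
  rewrite (_ : (fun x => _) = (fun x => 1 + (-1) * (w x / 2) ^+ n)).
    apply: is_trigD; first exact: is_trig_cst.
    apply: is_trigM; first exact: is_trig_cst.
    apply: is_trigX; apply: is_trigM; last exact: is_trig_cst.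
    apply: is_trigM; last exact: is_trig_cst.
    apply: is_trigD; [exact: is_trig_cst|exact: is_trig_cos].
  by apply/funext => x; rewrite mulN1r.
- by move=> x; rewrite -wk; exact: cvg_step_poly.
- move=> n x; have /andP[p0 p1] := step_poly_bound n (w02 x).
  by rewrite ger0_norm.
- by move=> x; case: (_ < _); rewrite ?normr1 ?normr0.
Qed.

End Density.

Import HBNNSimple.

Section IndicatorDensity.
Variables (R : realType) (mu : probability R R) (Lam : set R).
Hypothesis hexpo : forall x, approximable mu Lam (expo x).
Implicit Types (u v : R -> R) (A : set R).

Local Notation appr u := (approximable mu Lam (fun x => (u x)%:C%C)).

Definition approximable_set A := measurable A /\ appr (fun x => \1_A x : R).

Lemma approximable_set_limit A (F : nat -> set R) : measurable A ->
  (forall n, approximable_set (F n)) ->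
  (forall x, \forall n \near \oo, (x \in F n) = (x \in A)) -> approximable_set A.
Proof.
move=> mA aF FA; split => //.
have i1 B (x : R) : `|\1_B x : R| <= 1.
  by rewrite indicE; case: (_ \in _); rewrite ?normr1 ?normr0.
apply: (@approximable_real_limit _ _ _ _ (fun n x => \1_(F n) x)) => //.
- by move=> n; exact: (aF n).2.
- move=> x; apply: cvg_near_cst; apply: filterS (FA x) => n /= E.
  by rewrite !indicE E.
Qed.

Lemma approximable_real1 : appr (fun=> 1 : R).
Proof. by apply: is_trig_approximable => //; exact: is_trig_cst. Qed.

Lemma approximable_realD u v : appr u -> appr v -> appr (fun x => u x + v x).
Proof.
by move=> au av; apply: (eq_approximable _ (approximableD au av)) => x; rewrite rmorphD.
Qed.

Lemma approximable_realZ u (c : R) : appr u -> appr (fun x => c * u x).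
Proof.
by move=> au; apply: (eq_approximable _ (approximableZ c%:C%C au)) => x; rewrite rmorphM.
Qed.

Lemma eq_appr u v : u =1 v -> appr u -> appr v.
Proof. by move=> uv; apply: eq_approximable => x; rewrite uv. Qed.

Lemma approximable_setC A : approximable_set A -> approximable_set (~` A).
Proof.
move=> [mA aA]; split; first exact: measurableC.
apply: (eq_appr _ (approximable_realD approximable_real1 (approximable_realZ (-1) aA))).
by move=> x; rewrite !indicE in_setC; case: (_ \in _); rewrite ?mulr1 ?mulr0 ?subrr ?addr0.
Qed.

Lemma approximable_set_arc (a b k : R) : 0 <= k ->
  approximable_set [set x | k <= cos (a * x + b)].
Proof.
move=> k0; rewrite (_ : [set x | _] = ~` [set x | cos (a * x + b) < k]); last first.
  by apply/seteqP; split => x /=; rewrite leNgt => /negP.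
have aa := approximable_arc hexpo a b k0.
apply: approximable_setC; split; last first.
  apply: (eq_appr _ aa) => x; rewrite indicE; congr (nat_of_bool _)%:R.
  by apply/idP/idP => [H|/set_mem//]; apply/mem_set.
have mcos : measurable_fun setT (fun x : R => cos (a * x + b)).
  apply: continuous_measurable_fun => x; apply: continuous_comp; last exact: continuous_cos.
  by apply: cvgD; [exact: mulrl_continuous|exact: cvg_cst].
rewrite -[X in measurable X]setTI.
have := mcos measurableT `]-oo, k[%classic (measurable_itv _).
by congr (measurable _); congr (_ `&` _); apply/seteqP; split => x /=; rewrite in_itv.
Qed.

Lemma cos_le_abs (x y : R) : 0 <= y -> y <= pi -> `|x| <= pi ->
  (cos y <= cos x) = (`|x| <= y).
Proof.
move=> y0 ypi xpi; rewrite -(cos_norm x) !leNgt; congr (~~ _).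
by rewrite ltr_cos // in_itv /= ?normr_ge0 ?y0.
Qed.

(** A ball is the limit of the periodic sets [cos (a * r) <= cos (a * (x - c))] as [a]
tends to 0, since any given [x] is eventually in the central period. *)
Lemma approximable_set_ball (c r : R) : 0 <= r ->
  approximable_set [set x | `|x - c| <= r].
Proof.
move=> r0; pose a n : R := ((n.+2)%:R * (r + 1))^-1.
have r1 : 0 < r + 1 by lra.
have a0 n : 0 < a n by rewrite invr_gt0 mulr_gt0.
have pi1 : 1 <= pi :> R by apply: le_trans (pi_ge2 R); lra.
have ar n : 0 <= a n * r <= 1.
  rewrite mulr_ge0 ?(ltW (a0 n)) //= mulrC ler_pdivrMr ?mulr_gt0 // mul1r.
  by rewrite (@le_trans _ _ (r + 1)) ?lerDl ?ler_peMl ?ler1n // ltW.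
have cpos n : 0 <= cos (a n * r).
  apply: cos_ge0_pihalf; have /andP[h0 h1] := ar n; apply/andP; split.
    by rewrite (le_trans _ h0) // oppr_le0 divr_ge0 // pi_ge0.
  rewrite (le_trans h1) // ler_pdivlMr // mul1r; exact: pi_ge2.
have E n x : a n * x + - (a n * c) = a n * (x - c) by rewrite mulrBr.
apply: (@approximable_set_limit _ (fun n => [set x | cos (a n * r) <= cos (a n * x + - (a n * c))])).
- rewrite (_ : [set x | _] = `[c - r, c + r]%classic); first exact: measurable_itv.
  by apply/seteqP; split => x /=; rewrite in_itv /= ler_distl.
- by move=> n; exact: approximable_set_arc.
- move=> x.
  near=> n.
  have xn : a n * `|x - c| <= 1.
    rewrite mulrC ler_pdivrMr ?mulr_gt0 // mul1r.
    apply: (@le_trans _ _ (n.+2)%:R); last by rewrite ler_peMr // lerDr.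
    rewrite (@le_trans _ _ n%:R) // ?ler_nat 1?ltnW //.
    by near: n; exact: nbhs_infty_ger.
  have nE : `|a n * (x - c)| = a n * `|x - c| by rewrite normrM ger0_norm // ltW.
  have /andP[h0 h1] := ar n.
  have K : (cos (a n * r) <= cos (a n * x + - (a n * c))) = (`|x - c| <= r).
    have h3 : a n * r <= pi by exact: le_trans h1 pi1.
    have h4 : `|a n * (x - c)| <= pi by rewrite nE (le_trans xn).
    by rewrite E cos_le_abs // nE ler_pM2l.
  by apply/idP/idP => /set_mem /=; rewrite ?K => H; apply/mem_set; rewrite /= ?K.
Unshelve. all: by end_near.
Qed.

(** Half-open intervals form a pi-system that generates the Borel sets; they are
limits of balls whose left end moves towards [a]. *)
Lemma approximable_set_ocitv (a b : R) : approximable_set `]a, b]%classic.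
Proof.
have [ab|ba] := ltP a b; last first.
  rewrite set_itv_ge; last by rewrite bnd_simp -leNgt.
  rewrite -setCT; apply: approximable_setC; split => //.
  by apply: (eq_appr _ approximable_real1) => x; rewrite indicE in_setT.
pose d n : R := (b - a) / n.+2%:R.
have d0 n : 0 < d n by rewrite divr_gt0 // subr_gt0.
have dle n : d n <= b - a.
  by rewrite ler_pdivrMr // ler_peMr ?ler1n // subr_ge0 ltW.
apply: (@approximable_set_limit _
  (fun n => [set x | `|x - (a + d n + b) / 2| <= (b - (a + d n)) / 2])).
- exact: measurable_itv.
- move=> n; apply: approximable_set_ball; rewrite divr_ge0 // opprD addrA subr_ge0 //.
- move=> x; near=> n.
  have H : (x \in `]a, b]%classic) -> a + d n <= x.
    move=> /set_mem /=; rewrite in_itv /= => /andP[ax _].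
    rewrite -lerBrDl ler_pdivrMr // mulrC -ler_pdivrMr ?subr_gt0 //.
    rewrite (@le_trans _ _ n%:R) // ?ler_nat 1?ltnW //.
    by near: n; exact: nbhs_infty_ger.
  apply/idP/idP => [/set_mem /=|xab].
    rewrite ler_distl => /andP[h1 h2]; apply/mem_set; rewrite /= in_itv /=.
    by have dn := d0 n; apply/andP; split; lra.
  have := H xab; move: xab => /set_mem /=; rewrite in_itv /= => /andP[_ xb] ax.
  by apply/mem_set; rewrite /= ler_distl; apply/andP; split; lra.
Unshelve. all: by end_near.
Qed.

Lemma approximable_set_bigcup (F : (set R)^nat) : trivIset setT F ->
  (forall n, approximable_set (F n)) -> approximable_set (\bigcup_k F k).
Proof.
move=> tF aF.
have aU n : approximable_set (\big[setU/set0]_(i < n) F i).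
  elim: n => [|n IH].
    rewrite big_ord0 -setCT; apply: approximable_setC; split => //.
    by apply: (eq_appr _ approximable_real1) => x; rewrite indicE in_setT.
  rewrite big_ord_recr /=; split; first exact: measurableU IH.1 (aF n).1.
  apply: (eq_appr _ (approximable_realD IH.2 (aF n).2)) => x.
  rewrite !indicE in_setU -natrD; congr (_%:R).
  have : ~~ ((x \in \big[setU/set0]_(i < n) F i) && (x \in F n)).
    apply/negP => /andP[/set_mem + /set_mem Fn]; rewrite -bigcup_mkord.
    move=> [i /= ltin Fi]; have : i = n by apply: (tF i n) => //; exists x.
    by move=> E; rewrite E ltnn in ltin.
  by case: (x \in \big[_/_]_(_ < _) _); case: (x \in F n).
apply: (approximable_set_limit _ aU).
  by apply: bigcup_measurable => k _; exact: (aF k).1.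
move=> x; have [xU|xU] := boolP (x \in \bigcup_k F k).
  have /set_mem [k _ Fk] := xU.
  near=> n; apply/mem_set; rewrite -bigcup_mkord; exists k => //=.
  by near: n; exact: nbhs_infty_gt.
near=> n; apply/negbTE/negP => /set_mem; rewrite -bigcup_mkord => -[k _ Fk].
by move/negP: xU; apply; apply/mem_set; exists k.
Unshelve. all: by end_near.
Qed.

(** Dynkin's lemma: the approximable sets form a lambda-system. *)
Lemma approximable_measurable A : measurable A -> approximable_set A.
Proof.
have dyn : dynkin approximable_set.
  split.
  - split => //.
    by apply: (eq_appr _ approximable_real1) => x; rewrite indicE in_setT.
  - by move=> B; exact: approximable_setC.
  - by move=> F tF aF; exact: approximable_set_bigcup.
have /dynkin_lambda_system lam := dyn.
apply: (lambda_system_subset (@ocitvI R) lam) => //.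
by move=> _ [[a b] _ <-]; exact: approximable_set_ocitv.
Qed.

Lemma approximable_sum (I : Type) (r : seq I) (F : I -> R -> R) :
  (forall i, appr (F i)) -> appr (fun x => \sum_(i <- r) F i x).
Proof.
move=> aF; elim: r => [|i r IH].
  apply: (eq_appr _ (approximable_realZ 0 approximable_real1)) => x.
  by rewrite big_nil mul0r.
by apply: (eq_appr _ (approximable_realD (aF i) IH)) => x; rewrite big_cons.
Qed.

Lemma approximable_nnsfun (f : {nnsfun R >-> R}) : appr (f : R -> R).
Proof.
apply: (eq_appr _ (approximable_sum (index_enum _) _)) => [x|].
  by rewrite (fimfunEord f x).
by move=> i; apply: approximable_realZ; apply: (approximable_measurable _).2.
Qed.

Lemma approximable_nonneg u (h : R -> R) : measurable_fun setT u ->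
  (forall x, 0 <= u x) -> (forall x, u x ^+ 2 <= h x) ->
  mu.-integrable setT (EFin \o h) -> appr u.
Proof.
move=> mu' u0 uh ih.
have mf : measurable_fun setT (EFin \o u) by exact/measurable_EFinP.
pose g n := nnsfun_approx measurableT mf n.
have f0 x : setT x -> (0 <= (EFin \o u) x)%E by move=> _; rewrite lee_fin.
have gu x : g n x @[n --> \oo] --> u x.
  by have := cvg_nnsfun_approx measurableT mf f0 (x := x) Logic.I => /fine_cvgP[].
have gle n x : g n x <= u x.
  have := le_approx n f0 (x := x) Logic.I.
  by rewrite lee_fin /g nnsfun_approxE.
have E n x : sqmod ((u x)%:C%C - (g n x)%:C%C) = (u x - g n x) ^+ 2.
  by rewrite -rmorphB /sqmod /= expr0n addr0.
apply: (@approximable_dominated _ mu Lam _ (fun n x => (g n x)%:C%C) h) => //.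
- exact: cmeas_real.
- by move=> n; exact: approximable_nnsfun.
- move=> x; under eq_fun do rewrite E expr2.
  have H : (fun n => (u x - g n x) * (u x - g n x)) @ \oo -->
      (u x - u x) * (u x - u x).
    by apply: cvgM; (apply: cvgB; [exact: cvg_cst|exact: gu]).
  by rewrite subrr mulr0 in H.
- move=> n x; rewrite E; apply: le_trans (uh x).
  have g0 : 0 <= g n x by exact: fun_ge0.
  by rewrite lerXn2r // ?nnegrE ?subr_ge0 // ?gerBl.
Qed.

Lemma approximable_real_L2 u (h : R -> R) : measurable_fun setT u ->
  (forall x, u x ^+ 2 <= h x) -> mu.-integrable setT (EFin \o h) -> appr u.
Proof.
move=> mu' uh ih.
have h0 x : 0 <= h x by apply: le_trans (uh x); exact: sqr_ge0.
have P v : measurable_fun setT v -> (forall x, v x ^+ 2 <= h x) ->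
    appr (fun x => Num.max (v x) 0).
  move=> mv vh; apply: (@approximable_nonneg _ h) => //.
  - by apply: measurable_maxr => //; exact: measurable_cst.
  - by move=> x; rewrite le_max lexx orbT.
  - by move=> x; rewrite maxEle; case: ifP; rewrite ?expr0n.
apply: (eq_appr _ (approximable_realD (P u mu' uh)
   (approximable_realZ (-1) (P (fun x => - u x) _ _)))).
- by move=> x; rewrite !maxEle; case: (leP (u x) 0) => h1; case: (leP (- u x) 0) => h2; lra.
- exact: measurableT_comp.
- by move=> x; rewrite sqrrN.
Qed.

(** Simple functions, then positive and negative parts, then real and imaginary
parts. *)
Lemma approximable_L2 (f : R -> R[i]) : cmeas f ->
  mu.-integrable setT (EFin \o (fun x => sqmod (f x))) -> approximable mu Lam f.
Proof.
move=> [mr mi] ih.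
have ar : appr (fun x => complex.Re (f x)).
  apply: approximable_real_L2 ih => // x; by rewrite lerDl sqr_ge0.
have ai : appr (fun x => complex.Im (f x)).
  apply: approximable_real_L2 ih => // x; by rewrite lerDr sqr_ge0.
apply: (eq_approximable _ (approximableD ar (approximableZ (Complex 0 1) ai))).
move=> x; case: (f x) => a b; apply: eq_complexP.
  by rewrite complex_ReD complex_ReM /=; ring.
by rewrite complex_ImD complex_ImM /=; ring.
Qed.

End IndicatorDensity.

(** * A criterion for spectra *)

Section SpectrumCriterion.
Variables (R : realType) (mu : probability R R) (Lam : set R).
Implicit Types (f : R -> R[i]).

Lemma cintegral_expo a b :
  cintegral mu (fun x => expo a x * conjc (expo b x)) = cf mu (2 * pi * (a - b)).
Proof.
have E x : expo a x * conjc (expo b x) = expi (2 * pi * (a - b) * x).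
  by rewrite /expo conj_expi -expiD; congr expi; ring.
by rewrite /cintegral; congr Complex; apply: eq_Rintegral => x _; rewrite E.
Qed.

Lemma poweR_normc (z : R[i]) : (`|(Normc.normc z)%:E| `^ 2 = (sqmod z)%:E)%E.
Proof.
have s0 : 0 <= sqmod z by exact: sqmod_ge0.
have -> : Normc.normc z = Num.sqrt (sqmod z) by case: z s0.
by rewrite /= ger0_norm ?sqrtr_ge0 // powR_mulrn ?sqrtr_ge0 // sqr_sqrtr.
Qed.

Lemma cL2norm_sqr f : (cL2norm mu f `^ 2 = N2 mu f)%E.
Proof.
rewrite /cL2norm poweR_Lnorm //; apply: eq_integral => x _.
exact: poweR_normc.
Qed.

Lemma in_cL2_integrable f : in_cL2 mu f ->
  mu.-integrable setT (EFin \o (fun x => sqmod (f x))).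
Proof.
move=> [mr mi fin]; apply/integrableP; split; first exact: measurable_sqmod.
have := poweR_lty 2 fin; rewrite cL2norm_sqr; congr (_ < _)%E.
by apply: eq_integral => x _; rewrite /= ger0_norm ?sqmod_ge0.
Qed.

Lemma cL2norm_lt f (e : R) : 0 < e -> (N2 mu f < (e ^+ 2)%:E)%E ->
  (cL2norm mu f < e%:E)%E.
Proof.
move=> e0; rewrite -cL2norm_sqr.
have : (0 <= cL2norm mu f)%E by exact: Lnorm_ge0.
case: (cL2norm mu f) => [r| |] //=.
  rewrite lee_fin !lte_fin => r0; rewrite powR_mulrn // ltr_pXn2r ?nnegrE // ltW //.
by move=> _; rewrite pnatr_eq0.
Qed.

(** The definition of a spectrum uses one coefficient per frequency, so repeated
frequencies are merged. *)
Lemma trig_collect (ps : seq (R * R[i])) : {in ps, forall p, Lam p.1} ->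
  exists (s : seq R) (c : R -> R[i]), [set` s] `<=` Lam /\
    forall x, trig ps x = \sum_(l <- s) c l * expo l x.
Proof.
move=> psL; exists (undup (map fst ps)), (fun l => \sum_(p <- ps | p.1 == l) p.2).
split; first by move=> l /=; rewrite mem_undup => /mapP[p /psL pL ->].
move=> x; rewrite /trig.
under [RHS]eq_bigr do rewrite mulr_suml big_mkcond.
rewrite exchange_big /=; apply: eq_big_seq => p pps.
rewrite (bigD1_seq p.1) /= ?undup_uniq ?mem_undup ?map_f // eqxx.
by rewrite big1_seq ?addr0 // => l /andP[/negbTE]; rewrite eq_sym => ->.
Qed.

(** By Bessel's identity the third hypothesis puts every exponential into the closed
span of those in [Lam]; the exponentials of all real frequencies are dense. *)
Lemma spectrum_criterion : countable Lam ->
  (forall a b, Lam a -> Lam b -> a != b -> cf mu (2 * pi * (a - b)) = 0) ->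
  (forall x (e : R), 0 < e -> exists s : seq R, [/\ uniq s, {in s, forall l, Lam l} &
     1 - e < \sum_(l <- s) sqmod (cf mu (2 * pi * (x - l)))]) ->
  spectrum mu Lam.
Proof.
move=> cL orth bessel; split => //.
  move=> a b La Lb; rewrite cintegral_expo.
  by have [->|ab] := eqVneq a b; [rewrite subrr mulr0 cf0|exact: orth].
have hexpo x : approximable mu Lam (expo x).
  split; first exact: cmeas_expo.
  move=> e e0; have [s [us sL hs]] := bessel x e e0.
  have [|ps [pss Eps]] := @N2_expo_residual _ mu x s us.
    by move=> a b /sL La /sL Lb ab; apply: orth.
  exists ps; split; first by move=> p /pss /sL.
  by rewrite Eps lte_fin; move: hs; set S := \sum_(l <- s) _; lra.
move=> f fL2 e e0.
have mf : cmeas f by case: fL2.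
have [_ af] := approximable_L2 hexpo mf (in_cL2_integrable fL2).
have [|ps [psL Hps]] := af (e ^+ 2); first by rewrite exprn_gt0.
have [s [c [sL Ec]]] := trig_collect psL; exists s, c; split => //.
apply: cL2norm_lt => //; move: Hps; congr (_ < _)%E.
by apply: eq_N2 => x; rewrite Ec.
Qed.

End SpectrumCriterion.

(** * Tight sets *)

Section TightSets.
Variable R : realType.
Context (q : nat -> nat) (dg W : nat -> seq int) (T : set int) (rho beta : R)
  (b0 : nat) (HS : moran_system q dg W T rho beta b0).
Hypothesis T1 : T 1.

Local Notation mask := (digit_mask dg).
Local Notation tpow := (tpow q dg).
Local Notation scale := (scale q).

(** Orthonormality and completeness at level [e], in one identity, for all
multipliers in [T] together. *)
Definition tight e (L : seq int) := forall t, T t -> forall x : R,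
  \sum_(l <- L) tpow 0 e (t%:~R * (x + l%:~R)) = 1.

Definition residues e (L : seq int) := [seq (l %% (scale 0 e)%:Z)%Z | l <- L].

Lemma tpow_modz k e t (x : R) (l : int) :
  tpow k e (t%:~R * (x + (l %% (scale k e)%:Z)%Z%:~R)) = tpow k e (t%:~R * (x + l%:~R)).
Proof.
rewrite [in RHS](divz_eq l (scale k e)%:Z).
move: (l %% _)%Z (l %/ _)%Z => r d.
rewrite -(tpow_period HS k e (t%:~R * (x + r%:~R)) (t * d)).
by congr tpow; rewrite intrD !intrM -!pmulrn; ring.
Qed.

(** Moving an element by a multiple of the scale shifts the argument by a period.
All the freedom of the construction is here. *)
Lemma tight_residues e (L L' : seq int) : perm_eq (residues e L) (residues e L') ->
  tight e L -> tight e L'.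
Proof.
move=> LL' tL t Tt x; rewrite -[RHS](tL t Tt x).
have E K : \sum_(l <- K) tpow 0 e (t%:~R * (x + l%:~R)) =
    \sum_(l <- residues e K) tpow 0 e (t%:~R * (x + l%:~R)).
  by rewrite /residues big_map; apply: eq_bigr => l _; rewrite tpow_modz.
by rewrite E [RHS]E; apply/esym; exact: perm_big.
Qed.

(** Two elements in one class modulo the scale would both contribute the value 1 to
the sum at the opposite of that class. *)
Lemma mass_one_uniq k e (L : seq int) :
  (forall x : R, \sum_(l <- L) tpow k e (1%:~R * (x + l%:~R)) = 1) ->
  uniq [seq (l %% (scale k e)%:Z)%Z | l <- L].
Proof.
move=> tL; apply/count_mem_uniq => r; set rL := [seq _ | l <- L].
have [rrL|/count_memPn -> //] := boolP (r \in rL).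
have cpos : (0 < count_mem r rL)%N by rewrite -has_count has_pred1.
apply/eqP; rewrite eqn_leq cpos andbT -(ler_nat R) -[X in _ <= X](tL (- r%:~R)).
have -> : \sum_(l <- L) tpow k e (1%:~R * (- r%:~R + l%:~R)) =
    \sum_(l <- rL) tpow k e (1%:~R * (- r%:~R + l%:~R)) :> R.
  by rewrite big_map; apply: eq_bigr => l _; rewrite tpow_modz.
rewrite -sum1_count natr_sum big_mkcond /=.
apply: ler_sum => l _; case: eqP => [->|_]; last exact: tpow_ge0.
by rewrite addNr mulr0 (tpow0 HS).
Qed.

Lemma tight_uniq_residues e L : tight e L -> uniq (residues e L).
Proof. by move=> tL; apply: mass_one_uniq => x; exact: tL. Qed.

Lemma tight_uniq e L : tight e L -> uniq L.
Proof. by move=> /tight_uniq_residues /map_uniq. Qed.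

(** At [x = - b] the element [b] already contributes the full mass 1. *)
Lemma tight_orthogonal e L t : tight e L -> T t ->
  {in L &, forall a b : int, a != b -> tpow 0 e (t%:~R * (a%:~R - b%:~R) : R) = 0}.
Proof.
move=> tL Tt a b aL bL ab; have uL := tight_uniq tL.
apply/eqP; rewrite eq_le tpow_ge0 andbT.
have := tL t Tt (- b%:~R); rewrite (bigD1_seq b) //= addNr mulr0 (tpow0 HS).
rewrite -big_filter (bigD1_seq a) ?filter_uniq //=; last by rewrite mem_filter ab.
rewrite addrA [- _ + _]addrC => E; rewrite -(lerD2l 1) addr0 -[leRHS]E lerDl.
by apply: sumr_ge0 => l _; exact: tpow_ge0.
Qed.

(** The residues with digits in [W e], ..., [W (e + j - 1)]. *)
Fixpoint block e j : seq int :=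
  if j is j'.+1 then [seq w + (q e)%:Z * w' | w <- W e, w' <- block e.+1 j']
  else [:: 0].

Lemma tpowS_int k j t (x : R) (l l' : int) :
  tpow k j.+1 (t%:~R * (x + (l + (q k)%:Z * l')%:~R)) =
  sqmod (mask k (t%:~R * (x + l%:~R) / (q k)%:R)) *
  tpow k.+1 j (t%:~R * ((x + l%:~R) / (q k)%:R + l'%:~R)).
Proof.
have E : t%:~R * (x + (l + (q k)%:Z * l')%:~R) / (q k)%:R =
    t%:~R * ((x + l%:~R) / (q k)%:R + l'%:~R).
  by rewrite intrD intrM -!pmulrn; field; exact: q_neq0 HS k.
rewrite /tpow /= sqmodM E; congr (sqmod _ * _).
rewrite -(mask_period dg k (t%:~R * (x + l%:~R) / (q k)%:R) (t * l')).
by congr (digit_mask _ _ _); rewrite intrM; field; exact: q_neq0 HS k.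
Qed.

Lemma block_tight e j t (x : R) : T t ->
  \sum_(w <- block e j) tpow e j (t%:~R * (x + w%:~R)) = 1.
Proof.
move=> Tt; elim: j e x => [|j IH] e x /=; first by rewrite big_seq1 /tpow /= sqmod1.
rewrite big_allpairs_dep /= -[RHS](ms_tight HS e x Tt); apply: eq_bigr => w _.
under eq_bigr do rewrite tpowS_int.
by rewrite -mulr_sumr IH mulr1.
Qed.

Lemma block_uniq e j : uniq [seq (w %% (scale e j)%:Z)%Z | w <- block e j].
Proof. by apply: mass_one_uniq => x; exact: block_tight. Qed.

Lemma block0 e j : 0 \in block e j.
Proof.
elim: j e => [|j IH] e; first by rewrite mem_head.
apply/allpairsP; exists (0, 0) => /=.
by rewrite (ms_W0 HS) IH mulr0 addr0.
Qed.

Lemma size_block e j : size (block e j) = (\prod_(i < j) size (dg (e + i)))%N.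
Proof.
elim: j e => [|j IH] e /=; first by rewrite big_ord0.
rewrite size_allpairs IH (ms_sizeW HS) big_ord_recl addn0; congr (_ * _)%N.
by apply: eq_bigr => i _; rewrite addSnnS.
Qed.

Lemma mem_block e i j w w' : w \in block e i -> w' \in block (e + i) j ->
  w + (scale e i)%:Z * w' \in block e (i + j).
Proof.
elim: i e w => [|i IH] e w /=.
  by rewrite inE addn0 => /eqP ->; rewrite mul1r add0r.
case/allpairsP => -[w1 w2] /= [w1W w2b ->] w'b; apply/allpairsP.
exists (w1, w2 + (scale e.+1 i)%:Z * w') => /=; split => //.
  by apply: IH => //; rewrite addSnnS.
by rewrite PoszM; ring.
Qed.

Lemma block_split e i j w : w \in block e (i + j) ->
  exists w1 w2, w1 \in block e i /\ w = w1 + (scale e i)%:Z * w2.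
Proof.
elim: i e w => [|i IH] e w /=; first by exists 0, w; rewrite mem_head mul1r add0r.
case/allpairsP => -[w1 w2] /= [w1W /IH[w3 [w4 [w3b ->]]] ->].
exists (w1 + (q e)%:Z * w3), w4; split; last by rewrite PoszM; ring.
by apply/allpairsP; exists (w1, w3).
Qed.

Definition children e j (L : seq int) :=
  [seq l + (scale 0 e)%:Z * w | l <- L, w <- block e j].

Lemma tight_children e j L : tight e L -> tight (e + j) (children e j L).
Proof.
move=> tL t Tt x; rewrite -[RHS](tL t Tt x) big_allpairs_dep; apply: eq_bigr => l _ /=.
have M0 := gt_eqF (scaleR_gt0 HS 0 e).
have E w : tpow 0 (e + j) (t%:~R * (x + (l + (scale 0 e)%:Z * w)%:~R)) =
    tpow 0 e (t%:~R * (x + l%:~R)) *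
    tpow e j (t%:~R * ((x + l%:~R) / (scale 0 e)%:R + w%:~R)).
  rewrite tpowD add0n; congr (_ * _).
    rewrite -[RHS](tpow_period HS 0 e _ (t * w)); congr tpow.
    by rewrite intrD !intrM -!pmulrn; ring.
  by congr tpow; rewrite intrD intrM -!pmulrn; field; rewrite M0.
by under eq_bigr do rewrite E; rewrite -mulr_sumr block_tight // mulr1.
Qed.

(** Because 0 is one of the residues in each [W], earlier elements persist. *)
Lemma children_old e j L : {subset L <= children e j L}.
Proof.
move=> l lL; apply/allpairsP; exists (l, 0) => /=; split => //; first exact: block0.
by rewrite mulr0 addr0.
Qed.

Lemma tight_root : tight 0 [:: 0].
Proof. by move=> t Tt x; rewrite big_seq1 /tpow /= sqmod1. Qed.


(** The factors after level [e] do not destroy the mass that they meet at [y]. *)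
Definition good t e (eps : R) (y : int) :=
  forall j, eps <= tpow e j (t%:~R * (y%:~R / (scale 0 e)%:R)).

Lemma frac_modz e (v : int) :
  0 <= (((v %% (scale 0 e)%:Z)%Z)%:~R / (scale 0 e)%:R : R) < 1.
Proof.
have M0 := scaleR_gt0 HS 0 e.
have M0z : (scale 0 e)%:Z != 0 by rewrite gt_eqF // ltz_nat (scale_gt0 HS).
rewrite divr_ge0 ?ler0z ?modz_ge0 ?(ltW M0) //=.
rewrite ltr_pdivrMr // mul1r -[(scale 0 e)%:R]/((scale 0 e)%:Z%:~R) ltr_int.
by rewrite ltz_pmod // ltz_nat (scale_gt0 HS).
Qed.

Lemma good_shift e t eps (v : int) (l : nat) :
  (forall j, eps <= tpow e j (t%:~R * ((v %% (scale 0 e)%:Z)%Z%:~R / (scale 0 e)%:R + l%:R))) ->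
  good t e eps ((v %% (scale 0 e)%:Z)%Z + (scale 0 e)%:Z * l%:Z).
Proof.
move=> H j; apply: le_trans (H j) _; rewrite le_eqVlt; apply/orP; left; apply/eqP.
congr tpow; rewrite intrD intrM -!pmulrn; field.
by rewrite gt_eqF // (scaleR_gt0 HS).
Qed.

Lemma modz_shift e (v : int) (l : nat) :
  (((v %% (scale 0 e)%:Z)%Z + (scale 0 e)%:Z * l%:Z) %% (scale 0 e)%:Z)%Z =
  (v %% (scale 0 e)%:Z)%Z.
Proof. by rewrite addrC mulrC modzMDl modz_mod. Qed.

(** An element that is small compared with the scale sits near 0, where the
transform of the remaining factors is close to 1. *)
Lemma good_old t e (y : int) : 0 <= y ->
  8 * pi * beta * `|t%:~R| * y%:~R <= (scale 0 e)%:R -> good t e 2^-1 y.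
Proof.
move=> y0 H j; have := tpow_lipschitz HS e j 0 (t%:~R * (y%:~R / (scale 0 e)%:R)).
rewrite (tpow0 HS) sub0r normrN normrM normrM normfV normr_nat => L.
have M0 := scaleR_gt0 HS 0 e.
have : 4 * pi * beta * (`|t%:~R| * (`|y%:~R| / (scale 0 e)%:R)) <= 2^-1 :> R.
  rewrite (ger0_norm (x := y%:~R)) ?ler0z // !mulrA ler_pdivrMr // [2^-1 * _]mulrC ler_pdivlMr //.
  by apply: le_trans H; rewrite le_eqVlt; apply/orP; left; apply/eqP; ring.
move: L; rewrite ler_distl => /andP[]; lra.
Qed.

(** The spreading relation: increasing by more than a factor 2. *)
Definition doubling (a b : int) := (0 < a) && (2 * a < b).

Lemma place_sparse t : T t -> exists2 eps : R, 0 < eps & forall e (vs : seq int) (H : int), 0 < H ->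
  exists ys, [/\ residues e ys = residues e vs, path doubling H ys &
    {in ys, forall y, good t e eps y}].
Proof.
move=> Tt; have [eps eps0 EP] := equipositive_far HS Tt.
exists eps => // e; elim=> [|v vs IH] H H0; first by exists [::].
have [l Hl gl] := EP e _ (absz (2 * H)).+1 (frac_modz e v).
pose y := (v %% (scale 0 e)%:Z)%Z + (scale 0 e)%:Z * l%:Z.
have Hy : 2 * H < y.
  rewrite (@lt_le_trans _ _ (absz (2 * H)).+1%:Z) //.
    by rewrite (le_lt_trans (ler_norm _)) // -abszE ltz_nat.
  rewrite /y (@le_trans _ _ l%:Z) // -[leLHS]add0r lerD //.
    by rewrite modz_ge0 // gt_eqF // ltz_nat (scale_gt0 HS).
  by rewrite ler_peMl // lez_nat (scale_gt0 HS).
have [|ys [rys pys gys]] := IH y.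
  by apply: lt_trans Hy; rewrite mulr_gt0.
exists (y :: ys); split => /=.
- by rewrite /residues /= modz_shift; congr (_ :: _).
- by rewrite pys andbT /doubling H0.
- by move=> z; rewrite inE => /predU1P[->|/gys //]; exact: good_shift gl.
Qed.

Lemma place_near t : T t -> exists2 eps : R, 0 < eps & exists N : nat, forall e (vs : seq int),
  exists ys, [/\ residues e ys = residues e vs,
    {in ys, forall y, 0 <= y < (N * scale 0 e)%:Z} &
    {in ys, forall y, good t e eps y}].
Proof.
move=> Tt; have [eps eps0 [N EP]] := equipositive HS Tt.
exists eps => //; exists N => e; elim=> [|v vs [ys [rys bys gys]]]; first by exists [::].
have [l Hl gl] := EP e _ (frac_modz e v).
pose y := (v %% (scale 0 e)%:Z)%Z + (scale 0 e)%:Z * l%:Z.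
have M0z : 0 < (scale 0 e)%:Z by rewrite ltz_nat (scale_gt0 HS).
exists (y :: ys); split => /=.
- by rewrite /residues /= modz_shift; congr (_ :: _).
- move=> z; rewrite inE => /predU1P[->|/bys //]; apply/andP; split.
    by rewrite addr_ge0 ?modz_ge0 ?gt_eqF // mulr_ge0.
  rewrite /y (@lt_le_trans _ _ ((scale 0 e)%:Z + (scale 0 e)%:Z * l%:Z)) //.
    by rewrite ltrD2r ltz_pmod.
  by rewrite -PoszM -PoszD lez_nat -mulnS mulnC leq_mul2r Hl orbT.
- by move=> z; rewrite inE => /predU1P[->|/gys //]; exact: good_shift gl.
Qed.

(** The residues at level [e'] are those of the children of [L].  Elements of [L]
keep their places; the other residues that are multiples of the scale of level
[i] go to near representatives [cl]; the rest go to sparse ones [sp].  The last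
clause says that all of the multiples are represented near 0, some of them by
elements of [L]. *)
Lemma extend_tight t : T t -> exists2 eps : R, 0 < eps & exists N : nat,
  forall e L k i e' (H : int), 0 < H -> tight e L -> 0 \in L -> {in L, forall l, 0 <= l} ->
    (e <= k <= i)%N -> (i <= e')%N ->
    {in L, forall l : int, 8 * pi * beta * `|t%:~R| * l%:~R <= (scale 0 k)%:R} ->
  exists cl sp, [/\ tight e' (L ++ cl ++ sp),
    size (L ++ cl ++ sp) = (size L * size (block e (e' - e)))%N /\
    {in L ++ cl ++ sp, forall y, good t e' eps y},
    {in cl, forall y, 0 <= y < (N * scale 0 e')%:Z /\
       exists2 w, w \in block i (e' - i) & (y = (scale 0 i)%:Z * w %[mod (scale 0 e')%:Z])%Z},
    path doubling H sp &
    {in block i (e' - i), forall w, exists2 y, y \in L ++ cl &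
       (y = (scale 0 i)%:Z * w %[mod (scale 0 e')%:Z])%Z}].
Proof.
move=> Tt; have [eps1 eps1_gt0 [N near]] := place_near Tt.
have [eps2 eps2_gt0 sparse] := place_sparse Tt.
pose eps := Num.min (2^-1) (Num.min eps1 eps2).
have eps_le : [/\ eps <= 2^-1, eps <= eps1 & eps <= eps2].
  by rewrite /eps !ge_min !lexx !orbT.
case: eps_le => le0 le1 le2.
have good_le e y c : eps <= c -> good t e c y -> good t e eps y.
  by move=> ec g j; exact: le_trans ec (g j).
exists eps; first by rewrite !lt_min invr_gt0 ltr0n eps1_gt0.
exists N => e L k i e' H H0 tL L0 Lpos /andP[ek ki] ie' small.
have ee' : (e <= e')%N by rewrite (leq_trans ek) // (leq_trans ki).
pose V := children e (e' - e) L.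
have tV : tight e' V by have := tight_children (e' - e) tL; rewrite subnKC.
have uV := tight_uniq tV.
(* the children that are multiples of the scale of level [i]: they extend 0 by
   vanishing digits up to level [i] *)
pose C := [seq (scale 0 i)%:Z * w | w <- block i (e' - i)].
have CV : {subset C <= V}.
  move=> _ /mapP[w wb ->]; apply/allpairsP.
  exists (0, 0 + (scale e (i - e))%:Z * w) => /=; split => //.
    have ei : (e <= i)%N by exact: leq_trans ki.
    rewrite (_ : (e' - e = (i - e) + (e' - i))%N); last by lia.
    by apply: mem_block; [exact: block0|rewrite subnKC].
  by rewrite !add0r mulrA -PoszM -{1}(subnKC (leq_trans ek ki)) scaleD add0n.
pose V1 := [seq v <- V | (v \in C) && (v \notin L)].
pose V2 := [seq v <- V | (v \notin C) && (v \notin L)].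
have [cl [rcl bcl gcl]] := near e' V1.
have [sp [rsp psp gsp]] := sparse e' V2 H H0.
have pV : perm_eq V (L ++ V1 ++ V2).
  have V0 : perm_eq [seq v <- V | v \in L] L.
    apply: uniq_perm; [exact: filter_uniq|exact: tight_uniq tL|move=> v].
    by rewrite mem_filter andb_idr //; exact: children_old.
  apply: (perm_trans (y := [seq v <- V | v \in L] ++ [seq v <- V | v \notin L])).
    by rewrite perm_sym; apply/permEl/(perm_filterC (fun v => v \in L)).
  rewrite perm_cat // perm_sym.
  have -> : V1 = [seq v <- [seq v <- V | v \notin L] | v \in C] by rewrite -filter_predI.
  have -> : V2 = [seq v <- [seq v <- V | v \notin L] | v \notin C] by rewrite -filter_predI.
  exact/permEl/(perm_filterC (fun v => v \in C)).
have pR : perm_eq (residues e' V) (residues e' (L ++ cl ++ sp)).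
  have rc A B : residues e' (A ++ B) = residues e' A ++ residues e' B by exact: map_cat.
  rewrite !rc rcl rsp -!rc.
  exact: perm_map.
have Lcl : {in C, forall v, exists2 y, y \in L ++ cl & (y = v %[mod (scale 0 e')%:Z])%Z}.
  move=> v vC; have [vL|vL] := boolP (v \in L).
    by exists v; rewrite // mem_cat vL.
  have : (v %% (scale 0 e')%:Z)%Z \in residues e' V1.
    by apply: map_f; rewrite mem_filter vC vL CV.
  by rewrite -rcl => /mapP[y ycl ->]; exists y; rewrite // mem_cat ycl orbT.
exists cl, sp; split.
- exact: tight_residues pR tV.
- split; first by have := perm_size pR; rewrite !size_map => <-; rewrite size_allpairs.
  move=> y; rewrite !mem_cat => /or3P[yL|/gcl|/gsp]; [|exact: good_le..].
  apply: good_le le0 _; apply: good_old; first exact: Lpos.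
  apply: le_trans (small y yL) _; rewrite ler_nat.
  have ke' : (k <= e')%N by exact: leq_trans ie'.
  by rewrite -(subnKC ke') scaleD leq_pmulr // (scale_gt0 HS).
- move=> y ycl; split; first exact: bcl.
  have : (y %% (scale 0 e')%:Z)%Z \in residues e' V1 by rewrite -rcl; exact: map_f.
  move=> /mapP[v]; rewrite mem_filter => /andP[/andP[/mapP[w wb ->] _] _] E.
  by exists w.
- exact: psp.
- by move=> w wb; apply: Lcl; exact: map_f.
Qed.

End TightSets.

(** * Unions of tight sets *)

Section TowerLimit.
Variable R : realType.
Context (q : nat -> nat) (dg W : nat -> seq int) (T : set int) (rho beta : R)
  (b0 : nat) (HS : moran_system q dg W T rho beta b0).
Hypothesis T1 : T 1.

Local Notation tpow := (tpow q dg).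
Local Notation scale := (scale q).
Local Notation tight := (tight R q dg T).
Local Notation good := (good q dg).

Variable phi : R -> R.
Hypothesis cvg_phi : forall x, (fun n => tpow 0 n x) @ \oo --> phi x.

Lemma phi_ge (c : R) x : (\forall n \near \oo, c <= tpow 0 n x) -> c <= phi x.
Proof.
move=> H; rewrite -(cvg_lim _ (@cvg_phi x)) //; apply: limr_ge => //.
by apply/cvg_ex; exists (phi x); exact: cvg_phi.
Qed.

Lemma phi_le n x : phi x <= tpow 0 n x.
Proof.
rewrite -(cvg_lim _ (@cvg_phi x)) //; apply: limr_le.
  by apply/cvg_ex; exists (phi x); exact: cvg_phi.
by near=> m; apply: tpow_anti_le; near: m; exact: nbhs_infty_ge.
Unshelve. all: by end_near.
Qed.

Lemma phi_ge0 x : 0 <= phi x.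
Proof. by apply: phi_ge; near=> n; exact: tpow_ge0.
Unshelve. all: by end_near. Qed.

(** An increasing sequence of tight sets in which each multiplier has infinitely
many good stages, with a constant that may depend on the multiplier. *)
Record tower (Ls : nat -> seq int) (es : nat -> nat) : Prop := Tower {
  tower_tight : forall j, tight (es j) (Ls j);
  tower_sub : forall j, {subset Ls j <= Ls j.+1};
  tower_level : forall j, (j <= es j)%N;
  tower_good : forall t, T t -> exists2 eps : R, 0 < eps &
    forall J, exists2 j, (J <= j)%N & {in Ls j, forall y, good t (es j) eps y} }.

Context (Ls : nat -> seq int) (es : nat -> nat) (HT : tower Ls es).

Lemma tower_sub_le i j : (i <= j)%N -> {subset Ls i <= Ls j}.
Proof.
move=> /subnKC <-; elim: (j - i)%N => [|d IH] l lL; first by rewrite addn0.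
by rewrite addnS; apply: (tower_sub HT); exact: IH.
Qed.

Lemma tower_orthogonal t j : T t -> {in Ls j &, forall a b : int, a != b ->
  phi (t%:~R * (a%:~R - b%:~R)) = 0}.
Proof.
move=> Tt a b aL bL ab; apply/eqP; rewrite eq_le phi_ge0 andbT.
apply: (le_trans (phi_le (es j) _)).
by rewrite (tight_orthogonal HS T1 (tower_tight HT j) Tt).
Qed.

(** Goodness bounds the remaining product at [t * y / M_e], and the point of interest
differs by [t * x / M_e], which tends to 0. *)
Lemma good_phi t eps x : 0 < eps -> exists J, forall e (y : int), (J <= e)%N ->
  good t e eps y ->
  eps / 2 * tpow 0 e (t%:~R * (x + y%:~R)) <= phi (t%:~R * (x + y%:~R)).
Proof.
move=> eps0; pose c : R := 4 * pi * beta * (`|t%:~R| * `|x|).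
have c0 : 0 <= c by rewrite !mulr_ge0 ?pi_ge0 ?(beta_ge0 HS).
pose J := (Num.truncn (c / (eps / 2))).+1.
exists J => e y Je gy.
have M0 := scaleR_gt0 HS 0 e.
have cM : c / (scale 0 e)%:R <= eps / 2.
  rewrite ler_pdivrMr // mulrC -ler_pdivrMr ?divr_gt0 //.
  apply/ltW/(lt_le_trans (truncnS_gt _)); rewrite ler_nat (leq_trans Je) //.
  exact: leq_trans (ltnW (ltn_expl _ (ltnSn 1))) (scale_ge HS 0 e).
apply: phi_ge; near=> n.
have en : (e <= n)%N by near: n; exact: nbhs_infty_ge.
rewrite -(subnKC en) tpowD add0n mulrC ler_wpM2l ?tpow_ge0 //.
have := tpow_lipschitz HS e (n - e) (t%:~R * (x + y%:~R) / (scale 0 e)%:R)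
  (t%:~R * (y%:~R / (scale 0 e)%:R)).
rewrite (_ : t%:~R * (x + y%:~R) / (scale 0 e)%:R - t%:~R * (y%:~R / (scale 0 e)%:R) =
   t%:~R * x / (scale 0 e)%:R); last first.
  by field; rewrite gt_eqF.
have -> : 4 * pi * beta * `|t%:~R * x / (scale 0 e)%:R| = c / (scale 0 e)%:R.
  by rewrite 2!normrM normfV normr_nat /c mulrA.
move=> L.
have L2 : `|tpow e (n - e) (t%:~R * (x + y%:~R) / (scale 0 e)%:R) -
   tpow e (n - e) (t%:~R * (y%:~R / (scale 0 e)%:R))| <= eps / 2.
  exact: le_trans L cM.
by move: L2 (gy (n - e)%N); rewrite ler_distl => /andP[]; lra.
Unshelve. all: by end_near.
Qed.

Lemma tower_sum_le1 t x j : T t -> \sum_(l <- Ls j) phi (t%:~R * (x + l%:~R)) <= 1.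
Proof.
move=> Tt; rewrite -[leRHS](tower_tight HT j Tt x).
by apply: ler_sum => l _; exact: phi_le.
Qed.

Lemma tower_uniq j : uniq (Ls j).
Proof. exact: tight_uniq HS T1 _ _ (tower_tight HT j). Qed.

Lemma tower_split i j : (i <= j)%N ->
  perm_eq (Ls j) (Ls i ++ [seq l <- Ls j | l \notin Ls i]).
Proof.
move=> ij; apply: (perm_trans (y := [seq l <- Ls j | l \in Ls i] ++
    [seq l <- Ls j | l \notin Ls i])).
  by rewrite perm_sym; apply/permEl/(perm_filterC (fun v => v \in Ls i)).
rewrite perm_cat2r; apply: uniq_perm; rewrite ?filter_uniq ?tower_uniq // => l.
by rewrite mem_filter andb_idr //; exact: tower_sub_le.
Qed.

(** Let [Q j] be the sum over the stage [j]; it is bounded by 1 and nondecreasing, so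
beyond some [j0] it hardly grows.  At a later good stage [j] the level-[es j] mass
of the elements outside [Ls j0] is at most a constant times their contribution
to [Q j], which is tiny.  Hence almost all of the mass 1 of stage [j] lies on
[Ls j0], where the level-[es j] sum is close to [Q j0]. *)
Lemma tower_parseval t x (e : R) : T t -> 0 < e ->
  exists j, 1 - e < \sum_(l <- Ls j) phi (t%:~R * (x + l%:~R)).
Proof.
move=> Tt e0; have [eps eps0 Hgood] := tower_good HT Tt.
pose Q j := \sum_(l <- Ls j) phi (t%:~R * (x + l%:~R)).
(* if [Q] grows by less than [eta] after [j0], the mass placed after [j0] is at most
   [2 * eta / eps = e / 4] *)
pose eta := eps * e / 8.
have eta0 : 0 < eta by rewrite divr_gt0 ?mulr_gt0.
have Qsup : has_sup (range Q).
  split; first by exists (Q 0%N), 0%N.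
  by exists 1 => _ [j _ <-]; exact: tower_sum_le1.
have [_ [j0 _ <-] Hj0] := sup_adherent eta0 Qsup.
have Qle j : Q j <= Q j0 + eta.
  have : Q j <= sup (range Q) by apply: ub_le_sup; [exact: Qsup.2|exists j].
  move: Hj0; lra.
have [J HJ] := good_phi t x eps0.
have cvgF : (fun n => \sum_(l <- Ls j0) tpow 0 n (t%:~R * (x + l%:~R))) @ \oo --> Q j0.
  rewrite /Q; elim: (Ls j0) => [|l s IH].
    by rewrite big_nil; under eq_fun do rewrite big_nil; exact: cvg_cst.
  by rewrite big_cons; under eq_fun do rewrite big_cons; apply: cvgD.
have e4 : 0 < e / 4 by rewrite divr_gt0.
have /cvgrPdist_lt/(_ _ e4)[K _ HK] := cvgF.
have [j Jj gj] := Hgood (maxn (maxn J K) j0).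
have [JJ KK jj] : [/\ (J <= es j)%N, (K <= es j)%N & (j0 <= j)%N].
  have := tower_level HT j; move: Jj; rewrite !geq_max => /andP[/andP[h1 h2] h3] h4.
  by split => //; [exact: leq_trans h4|exact: leq_trans h4].
exists j0; rewrite -/(Q j0).
have := tower_tight HT j Tt x; rewrite (perm_big _ (tower_split jj)) big_cat /= => E.
have := HK (es j) KK; rewrite /= distrC => /(le_lt_trans (ler_norm _)) H1.
set S1 := \sum_(l <- Ls j0) _ in E H1.
set D := [seq l <- Ls j | l \notin Ls j0] in E.
have H2 : eps / 2 * \sum_(l <- D) tpow 0 (es j) (t%:~R * (x + l%:~R)) <=
    \sum_(l <- D) phi (t%:~R * (x + l%:~R)).
  rewrite mulr_sumr big_seq [leRHS]big_seq; apply: ler_sum => l.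
  by rewrite mem_filter => /andP[_ lj]; apply: HJ => //; exact: gj.
have H3 : \sum_(l <- D) phi (t%:~R * (x + l%:~R)) <= eta.
  have := Qle j; rewrite {1}/Q (perm_big _ (tower_split jj)) big_cat /= -/(Q j0).
  by rewrite -/D; lra.
have H4 : \sum_(l <- D) tpow 0 (es j) (t%:~R * (x + l%:~R)) <= e / 4.
  rewrite -(ler_pM2l (divr_gt0 eps0 (ltr0n _ 2 : 0 < 2%:R))).
  apply: (le_trans H2); apply: (le_trans H3).
  by rewrite /eta le_eqVlt; apply/orP; left; apply/eqP; field.
move: E H1 H4; lra.
Qed.

End TowerLimit.

(** * Counting in windows *)

Section WindowCounting.
Variable R : realType.
Implicit Types (a b : R) (L : seq int).

Definition wcount a b L := count (fun l : int => a < l%:~R < b) L.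

Lemma wcount_cat a b L L' : wcount a b (L ++ L') = (wcount a b L + wcount a b L')%N.
Proof. exact: count_cat. Qed.

Lemma wcount_size a b L : (wcount a b L <= size L)%N.
Proof. exact: count_size. Qed.

(** In a window no longer than [M] the elements of a residue class modulo [M] occur
at most once. *)
Lemma wcount_residues a b (M : nat) L (ms : seq int) : uniq L -> b - a <= M%:R ->
  {in L, forall y, (y %% M%:Z)%Z \in ms} -> (wcount a b L <= size ms)%N.
Proof.
move=> uL baM Lms; rewrite /wcount -size_filter; set s := [seq _ <- L | _].
have [->//|s0] := eqVneq s [::].
rewrite -(size_map (modz^~ M%:Z)); apply: uniq_leq_size; last first.
  by move=> z /mapP[y]; rewrite mem_filter => /andP[_ yL] ->; exact: Lms.
rewrite map_inj_in_uniq ?filter_uniq // => y y'.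
rewrite !mem_filter => /andP[/andP[ya yb] _] /andP[/andP[y'a y'b] _] E.
have M0 : (0 < M)%N.
  by rewrite -(ltr0n R) (lt_le_trans _ baM) // subr_gt0 (lt_trans ya).
have d : `|y - y'| < M%:Z.
  rewrite -(ltr_int R) intr_norm intrD mulrNz.
  apply: (@lt_le_trans _ _ (b - a)) => //.
  by rewrite ltr_norml; apply/andP; split; lra.
have dv : (M%:Z %| (y - y'))%Z by rewrite -eqz_mod_dvd; apply/eqP.
apply/eqP; rewrite -subr_eq0; apply: contraTT d => yy'.
rewrite -leNgt -[M%:Z]/(Posz `|M%:Z|) abszE.
by have := dvdn_leq _ dv; rewrite absz_gt0 yy' => /(_ isT); rewrite -lez_nat !abszE.
Qed.

Lemma doubling_trans : transitive doubling.
Proof. by move=> y x z; rewrite /doubling => /andP[x0 xy] /andP[y0 yz]; apply/andP; lia. Qed.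

Lemma doubling_last (H : int) s : 0 < H -> path doubling H s -> 2 ^+ size s * H <= last H s.
Proof.
elim: s H => [|y s IH] H H0 /=; first by rewrite mul1r.
rewrite {1}/doubling => /andP[/andP[_ Hy] ps].
have y0 : 0 < y by apply: lt_trans Hy; rewrite mulr_gt0.
apply: le_trans (IH y y0 ps); rewrite exprSr -mulrA ler_wpM2l ?exprn_ge0 //.
exact: ltW.
Qed.

Lemma wcount_doubling a b (H : int) s : 0 < H -> path doubling H s ->
  (1 < wcount a b s)%N -> 2 ^+ (wcount a b s).-1 <= b - a.
Proof.
move=> H0 ps; rewrite /wcount -size_filter; set s' := [seq _ <- s | _].
have ps' : path doubling H s'.
  by apply: subseq_path ps; [exact: doubling_trans|exact: filter_subseq].
have ins' y : y \in s' -> a < y%:~R < b by rewrite mem_filter => /andP[].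
case/lastP: s' ps' ins' => [//|s1 v]; case/lastP: s1 => [//|s1 u] ps' ins' _.
rewrite size_rcons /=.
move: ps'; rewrite rcons_path last_rcons => /andP[pu /andP[u0 uv]].
have := doubling_last H0 pu; rewrite last_rcons => Hu.
have /andP[ua _] : a < u%:~R < b.
  by apply: ins'; rewrite mem_rcons inE mem_rcons mem_head orbT.
have /andP[_ vb] : a < v%:~R < b by apply: ins'; rewrite mem_rcons mem_head.
have : (2 ^+ size (rcons s1 u) : int) <= v - u.
  have : 2 ^+ size (rcons s1 u) * 1 <= 2 ^+ size (rcons s1 u) * H :> int.
    by rewrite ler_wpM2l ?exprn_ge0 //; lia.
  rewrite mulr1; lia.
rewrite -(ler_int R) intrD mulrNz rmorphXn /= => HH.
by apply: (le_trans HH); lra.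
Qed.

(** If several elements fall in a window, the last one exceeds the first by a factor
exponential in their number. *)
Lemma wcount_doubling_ln a b (H : int) s : 0 < H -> path doubling H s -> 1 <= b - a ->
  (wcount a b s)%:R <= 2 + ln (b - a) / ln 2.
Proof.
move=> H0 ps ba; have l2 : 0 < ln (2 : R) by rewrite ln_gt0 // ltr1n.
have lba : 0 <= ln (b - a) by exact: ln_ge0.
have q0 : 0 <= ln (b - a) / ln 2 by rewrite divr_ge0 // ltW.
have [c1|c1] := leqP (wcount a b s) 1.
  by rewrite (@le_trans _ _ 1%:R) ?ler_nat //; lra.
have := wcount_doubling H0 ps c1; rewrite -ler_ln ?posrE ?exprn_gt0 //; last by lra.
rewrite lnXn // -[ln 2 *+ _]mulr_natl -ler_pdivlMr // => H1.
have -> : (wcount a b s)%:R = ((wcount a b s).-1)%:R + 1 :> R.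
  by rewrite natr1 prednK // ltnW.
by lra.
Qed.

End WindowCounting.

(** * One stage of the construction *)

Section Stage.
Variable R : realType.
Context (q : nat -> nat) (dg W : nat -> seq int) (T : set int) (rho beta : R)
  (b0 : nat) (HS : moran_system q dg W T rho beta b0).
Hypothesis T1 : T 1.

Local Notation tpow := (tpow q dg).
Local Notation scale := (scale q).
Local Notation tight := (tight R q dg T).
Local Notation good := (good q dg).
Local Notation block := (block q W).

(** Along [log_card a / log_scale a] the upper limit is the exponent kappa. *)
Definition log_card a : R := ln (size (block 0 a))%:R.
Definition log_scale a : R := ln (scale 0 a)%:R.

Lemma size_blockD e i j :
  size (block e (i + j)) = (size (block e i) * size (block (e + i) j))%N.
Proof.
elim: i e => [|i IH] e; first by rewrite mul1n addn0.
by rewrite addSn /= !size_allpairs IH mulnA addSnnS.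
Qed.

Lemma size_block_gt0 e i : (0 < size (block e i))%N.
Proof. by have := block0 HS e i; case: (block e i). Qed.

Lemma size_block1 e : (size (block e 1) <= b0)%N.
Proof. by rewrite (size_block HS) big_ord1 addn0 (ms_dgb HS). Qed.

Lemma log_card_add i d :
  log_card (i + d) = log_card i + ln (size (block i d))%:R.
Proof.
by rewrite /log_card size_blockD add0n natrM lnM // posrE ltr0n size_block_gt0.
Qed.

Lemma log_scale_ge0 a : 0 <= log_scale a.
Proof. by rewrite ln_ge0 // ler1n (scale_gt0 HS). Qed.

Lemma scale_mono a b : (a <= b)%N -> (scale 0 a <= scale 0 b)%N.
Proof. by move=> /subnKC <-; rewrite scaleD leq_pmulr // (scale_gt0 HS). Qed.

Lemma log_scale_mono a b : (a <= b)%N -> log_scale a <= log_scale b.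
Proof.
by move=> ab; rewrite ler_ln ?posrE ?(scaleR_gt0 HS) // ler_nat scale_mono.
Qed.

Lemma log_scale_unbounded (c : R) : exists A, forall a, (A <= a)%N -> c <= log_scale a.
Proof.
have l2 : 0 < ln (2 : R) by rewrite ln_gt0 // ltr1n.
exists (Num.truncn (c / ln 2)).+1 => a Aa.
apply: (@le_trans _ _ (a%:R * ln 2)).
  rewrite -ler_pdivrMr //; apply/ltW/(lt_le_trans (truncnS_gt _)).
  by rewrite ler_nat.
rewrite mulr_natl -lnXn // -natrX ler_ln ?posrE ?(scaleR_gt0 HS) ?ltr0n ?expn_gt0 //.
by rewrite ler_nat (scale_ge HS).
Qed.

Variables (kappa s : R).
Hypotheses (s0 : 0 <= s) (s_kappa : s <= kappa).

(** Let [c] be the level with [M_c <= b - a <= M_(c+1)].  Modulo [M_(c+1)] the cluster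
takes at most [b0 * size (block i (c - i))] values, and each value at most once in
the window.  The logarithm of the size of this block is
[log_card c - log_card i], at most [(kappa + d) * log M_c - (kappa - s) * log M_c]
by the upper bound on [log_card] and the choice of [i]. *)
Lemma wcount_cluster i e' cl (A : nat) (d a b : R) :
  (i <= e')%N -> i = e' \/ (kappa - s) * log_scale e' <= log_card i ->
  {in cl, forall y, exists2 w, w \in block i (e' - i) &
     (y = (scale 0 i)%:Z * w %[mod (scale 0 e')%:Z])%Z} ->
  uniq (residues q e' cl) -> 0 <= d ->
  (forall a, (A <= a)%N -> log_card a <= (kappa + d) * log_scale a) -> (A <= i)%N ->
  1 <= b - a -> (wcount a b cl)%:R <= b0%:R * (b - a) `^ (s + d).
Proof.
move=> ie' hi hcl ucl d0 hA Ai ba.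
have b0R : 1 <= b0%:R :> R by rewrite ler1n (b0_gt0 HS).
have ba0 : 0 < b - a by lra.
have pow1 : 1 <= (b - a) `^ (s + d).
  rewrite -[leLHS](powRr0 (b - a)); apply: ler_powR => //; exact: addr_ge0.
have ucl' : uniq cl by exact: map_uniq ucl.
have step1 c : (i <= c <= e')%N -> b - a <= (scale 0 c)%:R ->
    (wcount a b cl <= size (block i (c - i)))%N.
  move=> /andP[ic ce'] hc.
  rewrite -(size_map (fun w => ((scale 0 i)%:Z * w %% (scale 0 c)%:Z)%Z)).
  apply: wcount_residues hc _ => // y ycl.
  have [w wb ye] := hcl y ycl.
  have E1 : (scale 0 e' = scale 0 c * scale c (e' - c))%N.
    by rewrite -{1}(subnKC ce') scaleD.
  have E2 : (scale 0 c = scale 0 i * scale i (c - i))%N.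
    by rewrite -{1}(subnKC ic) scaleD.
  have ce : (y = (scale 0 i)%:Z * w %[mod (scale 0 c)%:Z])%Z.
    apply/eqP; rewrite eqz_mod_dvd; apply: dvdz_trans; last first.
      by rewrite -eqz_mod_dvd; apply/eqP; exact: ye.
    by rewrite E1 PoszM dvdz_mulr.
  have : w \in block i ((c - i) + (e' - c)) by rewrite addnC addnBA // subnK.
  move=> /(@block_split _ _ _ _ _ _)[w1 [w2 [w1b ew]]].
  rewrite ce; apply/mapP; exists w1 => //.
  by rewrite ew mulrDr mulrA -PoszM -E2 addrC mulrC modzMDl.
have step2 : (wcount a b cl <= size (block i (e' - i)))%N.
  apply: (leq_trans (wcount_size _ _ _)).
  rewrite -(size_map (modz^~ (scale 0 e')%:Z) cl).
  rewrite -(size_map (fun w => ((scale 0 i)%:Z * w %% (scale 0 e')%:Z)%Z) (block _ _)).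
  apply: uniq_leq_size => // z /mapP[y /hcl[w wb ye] ->].
  by rewrite ye; apply/mapP; exists w.
have one : (wcount a b cl <= 1)%N -> (wcount a b cl)%:R <= b0%:R * (b - a) `^ (s + d).
  move=> c1; rewrite (@le_trans _ _ 1%:R) ?ler_nat // -[1%:R]mul1r ler_pM //.
have [iE|ine] := eqVneq i e'.
  by apply: one; move: step2; rewrite iE subnn.
have {}hi : (kappa - s) * log_scale e' <= log_card i by case: hi => // /eqP; rewrite (negbTE ine).
have [hMi|hMi] := leP (b - a) (scale 0 i)%:R.
  by apply: one; have := step1 i; rewrite leqnn ie' subnn; apply.
have [c [/andP[ic ce'] hc cnt]] : exists c, [/\ (i <= c <= e')%N,
    (scale 0 c)%:R <= b - a & (wcount a b cl <= b0 * size (block i (c - i)))%N].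
  have [hMe|hMe] := leP (b - a) (scale 0 e')%:R; last first.
    exists e'; split; [by rewrite ie' leqnn|exact: ltW|].
    by rewrite (leq_trans step2) // leq_pmull // (b0_gt0 HS).
  have ex : exists c, b - a <= (scale 0 c)%:R by exists e'.
  case: (ex_minnP ex) => c hc cmin.
  have ic : (i < c)%N.
    rewrite ltnNge; apply/negP => ci; move: hMi; rewrite ltNge => /negP; apply.
    by apply: (le_trans hc); rewrite ler_nat scale_mono.
  have ce : (c <= e')%N by exact: cmin.
  have c0 : (0 < c)%N by exact: leq_ltn_trans ic.
  exists c.-1; split.
  - by rewrite -ltnS prednK // ic /= (leq_trans (leq_pred _)).
  - rewrite leNgt; apply/negP => /ltW /cmin; by rewrite -ltnS prednK // ltnn.
  - have := step1 c; rewrite (ltnW ic) ce => /(_ isT hc) /leq_trans; apply.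
    have -> : (c - i = (c.-1 - i) + 1)%N by rewrite addn1 -subSn ?prednK // -ltnS prednK.
    by rewrite size_blockD mulnC leq_mul2r size_block1 orbT.
have p0 : 0 < (size (block i (c - i)))%:R :> R by rewrite ltr0n size_block_gt0.
apply: (@le_trans _ _ (b0 * size (block i (c - i)))%:R); first by rewrite ler_nat.
rewrite natrM ler_wpM2l // -(@lnK _ (size _)%:R) ?posrE //.
rewrite /powR gt_eqF // ler_expR.
have := log_card_add i (c - i); rewrite subnKC // => lc.
have := hA c (leq_trans Ai ic) => hc1.
have mc : (kappa - s) * log_scale c <= (kappa - s) * log_scale e'.
  by rewrite ler_wpM2l ?subr_ge0 // log_scale_mono.
have lnh : (s + d) * log_scale c <= (s + d) * ln (b - a).
  by rewrite ler_wpM2l ?addr_ge0 // ler_ln ?posrE // (scaleR_gt0 HS).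
move: lc hc1 mc lnh hi; set X := ln _%:R; lra.
Qed.

(** The elements placed so far and the level at which they are tight. *)
Definition state : Type := seq int * nat.

Record valid (S : state) : Prop := Valid {
  valid_tight : tight S.2 S.1;
  valid0 : 0 \in S.1;
  valid_ge0 : {in S.1, forall l : int, 0 <= l} }.

Definition tolerance j : R := j.+1%:R^-1.

(** What one stage guarantees.  [t] is the multiplier that it serves and [H] a lower
bound for the new elements, left free for later use.  In [step_new] the gap
[size S.1 ^ j.+1] separates the stages so widely that a window meeting both old
and new elements is long enough for the old ones to be negligible; the bound
on windows is stated for all [d] at once because the stage cannot know the [d] for
which it will be used.  [step_lower] exhibits one window with nearly the
maximal number of elements. *)
Record step (eps : R) (t : int) (j : nat) (H : int) (S S' : state) : Prop := Step {
  step_valid : valid S';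
  step_level : (j < S'.2)%N;
  step_good : {in S'.1, forall y, good t S'.2 eps y};
  step_new : exists cl sp, [/\ S'.1 = S.1 ++ cl ++ sp,
     {in cl ++ sp, forall y, H < y /\
        {in S.1, forall l : int, (size S.1 ^ j.+1)%:Z + l < y}},
     exists2 H0, 0 < H0 & path doubling H0 sp,
     forall (A : nat) d a b, (A <= j)%N -> 0 <= d ->
        (forall a, (A <= a)%N -> log_card a <= (kappa + d) * log_scale a) ->
        1 <= b - a -> (wcount a b cl)%:R <= b0%:R * (b - a) `^ (s + d) &
     (forall K, exists2 k, (K <= k)%N & (1 < size (dg k))%N) -> cl ++ sp != [::]];
  step_lower : exists h m : R, [/\ j.+1%:R <= h,
     m <= ln h <= (1 + tolerance j) * m,
     (0 < wcount (0 - h / 2) (0 + h / 2) S'.1)%N &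
     (s - 2 * tolerance j) * m <= ln (wcount (0 - h / 2) (0 + h / 2) S'.1)%:R] }.

Hypothesis kappa_recurrent : forall d : R, 0 < d -> forall A : nat,
  exists2 a, (A <= a)%N & (kappa - d) * log_scale a <= log_card a.

Lemma nat_bound (L : seq int) (f : int -> R) : exists n : nat, {in L, forall l, f l <= n%:R}.
Proof.
elim: L => [|l L [n hn]]; first by exists 0%N.
exists (maxn n (Num.truncn (f l)).+1) => l'; rewrite inE => /predU1P[->|/hn h].
  by apply/ltW/(lt_le_trans (truncnS_gt _)); rewrite ler_nat leq_maxr.
by apply: (le_trans h); rewrite ler_nat leq_maxl.
Qed.

Lemma above4 (a b c d : nat) : exists k, [/\ (a <= k)%N, (b <= k)%N, (c <= k)%N & (d <= k)%N].
Proof. by exists (a + b + c + d)%N; split; lia. Qed.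

Lemma level_lt_scale a : (a < scale 0 a)%N.
Proof. by apply: leq_trans (scale_ge HS 0 a); rewrite ltn_expl. Qed.

Lemma size_block_gt1 e k e' : (e <= k < e')%N -> (1 < size (dg k))%N ->
  (1 < size (block e (e' - e)))%N.
Proof.
move=> /andP[ek ke'] dk.
have -> : (e' - e = (k - e) + (1 + (e' - k.+1)))%N by lia.
rewrite !size_blockD subnKC //.
have -> : size (block k 1) = size (dg k) by rewrite (size_block HS) big_ord1 addn0.
rewrite (leq_trans dk) // mulnA -mulnA mulnCA leq_pmulr // muln_gt0.
by rewrite !size_block_gt0.
Qed.

Lemma size_cluster i e' (K : seq int) : (i <= e')%N ->
  {in block i (e' - i), forall w, exists2 y, y \in K &
       (y = (scale 0 i)%:Z * w %[mod (scale 0 e')%:Z])%Z} ->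
  (size (block i (e' - i)) <= size K)%N.
Proof.
move=> ie' hK; have M0 : 0 < (scale 0 i)%:Z by rewrite ltz_nat (scale_gt0 HS).
rewrite -(size_map (fun w => ((scale 0 i)%:Z * w %% (scale 0 e')%:Z)%Z)).
rewrite -(size_map (modz^~ (scale 0 e')%:Z) K); apply: uniq_leq_size.
  have -> : [seq ((scale 0 i)%:Z * w %% (scale 0 e')%:Z)%Z | w <- block i (e' - i)] =
    [seq (scale 0 i)%:Z * r | r <- [seq (w %% (scale i (e' - i))%:Z)%Z | w <- block i (e' - i)]].
    rewrite -map_comp; apply: eq_map => w /=.
    by rewrite -{1}(subnKC ie') scaleD add0n PoszM mulz_modr.
  rewrite map_inj_uniq ?(block_uniq HS T1) //.
  by apply: mulfI; rewrite gt_eqF.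
by move=> z /mapP[w /hK[y yK <-] ->]; apply: map_f.
Qed.

(** The level [e'] is taken where [log_card] is almost [kappa * log_scale], and so far
out that the old levels and all the constants are negligible on the logarithmic
scale.  The cluster starts at the least level [i] where [log_card i] reaches
[(kappa - s) * log_scale e'], so it has about [M_e' ^ s] elements. *)
Lemma step_exists t : T t -> exists2 eps : R, 0 < eps &
  forall j H S, valid S -> exists S', step eps t j H S S'.
Proof.
move=> Tt; have [eps eps0 [N EXT]] := extend_tight HS T1 Tt.
exists eps => // j H [L e] [/= tL L0 Lpos].
have [X1 hX1] := nat_bound L (fun l => 8 * pi * beta * `|t%:~R| * l%:~R).
have [X2 hX2] := nat_bound L (fun l => l%:~R).
have [Bd [HBd XBd]] : exists Bd : nat, H <= Bd%:Z /\ (X2 + size L ^ j.+1 < Bd)%N.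
  exists (absz H + (X2 + size L ^ j.+1)).+1; split; last by rewrite ltnS leq_addl.
  by rewrite (le_trans (ler_norm H)) // -abszE lez_nat -addnS leq_addr.
have [k [ek jk X1k Bdk]] := above4 e j X1 Bd.
have tol0 : 0 < tolerance j by rewrite invr_gt0.
have mul_tol (c : R) m : c * j.+1%:R <= m -> c <= tolerance j * m.
  by move=> h; rewrite /tolerance mulrC ler_pdivlMr.
(* the three errors on the logarithmic scale: the digits before level [k], one
   digit set at level [i], and the width of the window *)
have [A1 hA1] := log_scale_unbounded (log_card k * j.+1%:R).
have [A2 hA2] := log_scale_unbounded (ln b0%:R * j.+1%:R).
have [A3 hA3] := log_scale_unbounded (ln (2 * N.+1)%:R * j.+1%:R).
have [nt hnt] : exists nt : nat, (forall K, exists2 k, (K <= k)%N & (1 < size (dg k))%N) ->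
     (e <= nt)%N /\ (1 < size (dg nt))%N.
  have [nontriv|] := pselect (forall K, exists2 k, (K <= k)%N & (1 < size (dg k))%N).
    by have [nt h1 h2] := nontriv e; exists nt.
  by exists 0%N.
have [A' [A1A A2A A3A ntA]] := above4 A1 A2 A3 nt.
have [A [kA A'A _ _]] := above4 k A' 0 0.
have [e' e'big he'] := kappa_recurrent tol0 A.+1.
have ke' : (k < e')%N by exact: leq_ltn_trans e'big.
have Ae' : (A' < e')%N by exact: leq_ltn_trans e'big.
have m1 : log_card k <= tolerance j * log_scale e'.
  by apply/mul_tol/hA1; exact: leq_trans A1A (ltnW Ae').
have m2 : ln b0%:R <= tolerance j * log_scale e'.
  by apply/mul_tol/hA2; exact: leq_trans A2A (ltnW Ae').
have m3 : ln (2 * N.+1)%:R <= tolerance j * log_scale e'.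
  by apply/mul_tol/hA3; exact: leq_trans A3A (ltnW Ae').
have nte' : (nt < e')%N by exact: leq_ltn_trans Ae'.
have m0 := log_scale_ge0 e'.
(* [i] is the least admissible level at which [log_card] has reached the deficit;
   being least, it overshoots by at most one digit set *)
have [i [/andP[ki ie'] hi1 hi2]] : exists i, [/\ (k <= i <= e')%N,
    i = e' \/ (kappa - s) * log_scale e' <= log_card i &
    log_card i <= log_card k \/ log_card i <= (kappa - s) * log_scale e' + ln b0%:R].
  have ex : exists i, (k <= i)%N && ((i == e') || ((kappa - s) * log_scale e' <= log_card i)).
    by exists e'; rewrite (ltnW ke') eqxx.
  case: (ex_minnP ex) => i /andP[ki hi] imin; exists i; split.
  - by rewrite ki imin // (ltnW ke') eqxx.
  - by case/orP: hi => [/eqP|]; [left|right].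
  - have [->|ik] := eqVneq i k; [by left|right].
    have ki' : (k < i)%N by rewrite ltn_neqAle eq_sym ik.
    have i0 : (0 < i)%N by exact: leq_ltn_trans ki'.
    have kp : (k <= i.-1)%N by rewrite -ltnS prednK.
    have : ~~ ((i.-1 == e') || ((kappa - s) * log_scale e' <= log_card i.-1)).
      apply/negP => Hp; have := imin i.-1; rewrite kp Hp => /(_ isT).
      by rewrite leqNgt prednK // leqnn.
    rewrite negb_or => /andP[_]; rewrite -ltNge => lt.
    have -> : i = (i.-1 + 1)%N by rewrite addn1 prednK.
    rewrite log_card_add lerD ?(ltW lt) // ler_ln ?posrE ?ltr0n ?size_block_gt0 ?(b0_gt0 HS) //.
    by rewrite ler_nat size_block1.
have scale_small : {in L, forall l : int, 8 * pi * beta * `|t%:~R| * l%:~R <= (scale 0 k)%:R}.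
  move=> l /hX1 h; apply: (le_trans h); rewrite ler_nat.
  exact: leq_trans X1k (ltnW (level_lt_scale k)).
have Bd0 : (0 : int) < Bd%:Z by rewrite ltz_nat (leq_ltn_trans _ XBd).
have eki : (e <= k <= i)%N by rewrite ki ek.
have [cl [sp [tL' [sz gd] hcl psp hC]]] := EXT e L k i e' Bd%:Z Bd0 tL L0 Lpos eki ie' scale_small.
have ures := tight_uniq_residues HS T1 tL'.
have L'ge : {in cl ++ sp, forall y : int, Bd%:Z < y}.
  move=> y; rewrite mem_cat => /orP[ycl|ysp].
    have [/andP[y0 _] [w wb ye]] := hcl y ycl.
    have dv : ((scale 0 i)%:Z %| y)%Z.
      have : ((scale 0 i)%:Z %| y - (scale 0 i)%:Z * w)%Z.
        have ye' : ((scale 0 e')%:Z %| y - (scale 0 i)%:Z * w)%Z.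
          by rewrite -eqz_mod_dvd; apply/eqP.
        apply: dvdz_trans ye'.
        by rewrite -(subnKC ie') scaleD PoszM dvdz_mulr.
      by move=> h; rewrite -[y](subrK ((scale 0 i)%:Z * w)); apply: rpredD => //; exact: dvdz_mulr.
    have yn0 : y != 0.
      apply/eqP => y00; have := tight_uniq HS T1 tL'.
      rewrite cat_uniq => /and3P[_ /hasPn/(_ y)]; rewrite mem_cat ycl => /(_ isT) /=.
      by rewrite y00 L0.
    have iM : (scale 0 i)%:Z <= y.
      rewrite -(gez0_abs y0) lez_nat; apply: dvdn_leq; last by [].
      by rewrite absz_gt0.
    apply: lt_le_trans iM; rewrite ltz_nat.
    exact: leq_ltn_trans Bdk (leq_trans (level_lt_scale k) (scale_mono ki)).
  have /allP/(_ y ysp) := order_path_min doubling_trans psp.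
  rewrite /doubling => /andP[_]; apply: le_lt_trans.
  by rewrite -[leLHS]mul1r ler_wpM2r // ltW.
have Lle : {in L, forall l : int, l <= X2%:Z}.
  by move=> l /hX2; rewrite -[X2%:R]/(X2%:Z%:~R) ler_int.
exists (L ++ cl ++ sp, e'); split => /=.
- split => //=; first by rewrite mem_cat L0.
  move=> l; rewrite mem_cat => /orP[/Lpos//|/L'ge lB].
  exact: ltW (lt_trans Bd0 lB).
- exact: leq_ltn_trans jk ke'.
- exact: gd.
- exists cl, sp; split => //.
  + move=> y /L'ge hy; split; first exact: le_lt_trans hy.
    move=> l /Lle hl; apply: lt_trans hy; apply: (@le_lt_trans _ _ ((size L ^ j.+1)%:Z + X2%:Z)).
      by rewrite lerD2l.
    by rewrite -PoszD ltz_nat addnC.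
  + by exists Bd%:Z.
  + move=> A0 d a b A0j d0 hA; apply: (@wcount_cluster i e' cl A0 d a b ie' hi1 _ _ d0 hA) => //.
    * by move=> y /hcl[].
    * by move: ures; rewrite /residues !map_cat !cat_uniq => /and3P[_ _ /and3P[]].
    * exact: leq_trans A0j (leq_trans jk ki).
  + move=> /hnt[ent snt]; apply/eqP => new0.
    have ente' : (e <= nt < e')%N by rewrite ent.
    have := size_block_gt1 ente' snt.
    have szL : (0 < size L)%N by case: (L) L0.
    move: sz; rewrite new0 cats0 => /eqP; rewrite -[X in X == _]muln1 eqn_pmul2l //.
    by move=> /eqP <-.
- exists (2 * N.+1 * scale 0 e')%:R, (log_scale e').
  have sc0 := scale_gt0 HS 0 e'.
  have h0 : 0 < (2 * N.+1 * scale 0 e')%:R :> R by rewrite ltr0n !muln_gt0 sc0.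
  have hhalf : (2 * N.+1 * scale 0 e')%:R / 2 = (N.+1 * scale 0 e')%:R :> R.
    by rewrite -mulnA natrM mulrC mulKf // pnatr_eq0.
  have lnh : ln (2 * N.+1 * scale 0 e')%:R = ln (2 * N.+1)%:R + log_scale e'.
    by rewrite natrM lnM ?posrE ?ltr0n ?muln_gt0.
  have ln2N : 0 <= ln (2 * N.+1)%:R :> R by rewrite ln_ge0 // ler1n muln_gt0.
  have inwin y : y \in L ++ cl ->
      0 - (2 * N.+1 * scale 0 e')%:R / 2 < (y%:~R : R) < 0 + (2 * N.+1 * scale 0 e')%:R / 2.
    move=> yin; rewrite hhalf sub0r add0r.
    have /andP[y0 y1] : 0 <= y < (N.+1 * scale 0 e')%:Z.
      move: yin; rewrite mem_cat => /orP[yL|ycl].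
        rewrite Lpos //=; apply: le_lt_trans (Lle y yL) _; rewrite ltz_nat.
        apply: (@leq_ltn_trans Bd); first exact: leq_trans (leq_addr _ _) (ltnW XBd).
        apply: (leq_ltn_trans Bdk); apply: (ltn_trans ke').
        by apply: leq_trans (level_lt_scale e') _; rewrite leq_pmull.
      have [/andP[-> h] _] := hcl y ycl; apply: (lt_le_trans h).
      by rewrite lez_nat leq_mul2r leqnSn orbT.
    apply/andP; split.
      rewrite (@lt_le_trans _ _ 0) ?ler0z // oppr_lt0 ltr0n muln_gt0 sc0 //.
    by rewrite -[(N.+1 * _)%:R]/((N.+1 * scale 0 e')%N%:Z%:~R) ltr_int.
  have cnt : (size (block i (e' - i)) <= wcount (0 - (2 * N.+1 * scale 0 e')%:R / 2)
      (0 + (2 * N.+1 * scale 0 e')%:R / 2 : R) (L ++ cl ++ sp))%N.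
    apply: (leq_trans (size_cluster ie' hC)).
    rewrite catA wcount_cat.
    have -> : wcount (0 - (2 * N.+1 * scale 0 e')%:R / 2)
      (0 + (2 * N.+1 * scale 0 e')%:R / 2 : R) (L ++ cl) = size (L ++ cl).
      by apply/eqP; rewrite -all_count; apply/allP => y /inwin.
    exact: leq_addr.
  split.
  + rewrite ler_nat; apply: leq_trans (leq_pmull _ _); last by rewrite muln_gt0.
    exact: ltn_trans (leq_ltn_trans jk ke') (level_lt_scale e').
  + rewrite lnh; apply/andP; split; lra.
  + exact: leq_trans (size_block_gt0 _ _) cnt.
  + apply: (@le_trans _ _ (ln (size (block i (e' - i)))%:R)); last first.
      rewrite ler_ln ?posrE ?ltr0n ?size_block_gt0 ?ler_nat //.
      exact: leq_trans (size_block_gt0 _ _) cnt.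
    have := log_card_add i (e' - i); rewrite subnKC //; set X := ln _%:R => lc.
    have sm : s * log_scale e' <= kappa * log_scale e' by rewrite ler_wpM2r.
    have t2 : tolerance j * log_scale e' >= 0 by rewrite mulr_ge0 // ltW.
    by case: hi2 => hi2; move: lc hi2 he' m1 m2 sm t2; lra.
Qed.

End Stage.

(** * Beurling dimension of the limit set *)

Section CountingBounds.
Variables (R : realType) (X : set R).

Lemma counting_le (c : R) :
  (forall u : seq R, uniq u -> {in u, forall y, X y} -> (size u)%:R <= c) ->
  (counting X <= c%:E)%E.
Proof.
move=> H; rewrite /counting; case: asboolP => [fX|iX].
  by rewrite lee_fin; apply: H => [|y]; rewrite ?fset_uniq ?in_fset_set ?inE.
have [B BX] := infinite_set_fset (Num.truncn c).+1 iX.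
have := H (enum_fset B) (fset_uniq B) (fun y yB => BX y yB).
move=> h1 h2; have := truncnS_gt c; rewrite ltNge => /negP[].
by apply: (le_trans _ h1); rewrite ler_nat.
Qed.

Lemma counting_ge (u : seq R) : uniq u -> {in u, forall y, X y} ->
  (((size u)%:R : R)%:E <= counting X)%E.
Proof.
move=> uu uX; rewrite /counting; case: asboolP => [fX|_]; last by rewrite leey.
rewrite lee_fin ler_nat; apply: uniq_leq_size => // y yu.
by rewrite in_fset_set // inE; exact: uX.
Qed.

End CountingBounds.

Section Dimension.
Variable R : realType.
Context (q : nat -> nat) (dg W : nat -> seq int) (T : set int) (rho beta : R)
  (b0 : nat) (HS : moran_system q dg W T rho beta b0).
Hypothesis T1 : T 1.
Variables (kappa s : R).
Hypotheses (s0 : 0 <= s).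

Local Notation step := (step q dg W T b0 kappa s).
Local Notation log_card a := (log_card R q W a).
Local Notation log_scale a := (log_scale R q a).

Hypothesis kappa_limit : forall d : R, 0 < d -> exists A : nat,
  forall a, (A <= a)%N -> log_card a <= (kappa + d) * log_scale a.

Variables (Ss : nat -> state) (eps : nat -> R) (ts H : nat -> int).
Hypothesis steps : forall j, step (eps j) (ts j) j (H j) (Ss j) (Ss j.+1).
Hypothesis Ss0 : (Ss 0%N).1 = [:: 0].

Definition limit_set : set int := [set l | exists j, l \in (Ss j).1].

Lemma steps_sub i j : (i <= j)%N -> {subset (Ss i).1 <= (Ss j).1}.
Proof.
move=> /subnKC <-; elim: (j - i)%N => [|d IH] l lL; first by rewrite addn0.
rewrite addnS; have [cl [sp [-> _ _ _ _]]] := step_new (steps (i + d)).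
by rewrite mem_cat IH.
Qed.

Lemma steps_size i j : (i <= j)%N -> (size (Ss i).1 <= size (Ss j).1)%N.
Proof.
move=> /subnKC <-; elim: (j - i)%N => [|d IH]; first by rewrite addn0.
rewrite addnS; have [cl [sp [-> _ _ _ _]]] := step_new (steps (i + d)).
by rewrite size_cat (leq_trans IH) // leq_addr.
Qed.

Lemma steps_uniq j : uniq (Ss j).1.
Proof.
case: j => [|j]; first by rewrite Ss0.
exact: tight_uniq HS T1 _ _ (valid_tight (step_valid (steps j))).
Qed.

Lemma powR_ge_ln (h d : R) : 1 <= h -> 0 < d -> ln h <= h `^ d / d.
Proof.
move=> h1 d0; have h0 : 0 < h by lra.
rewrite ler_pdivlMr // mulrC /powR gt_eqF //.
by apply: le_trans (expR_ge1Dx _); rewrite lerDr.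
Qed.

(** Induction on the stages.  New elements are counted by the bound of their own
stage.  If the window also contains old elements, it is longer than
[size ^ j.+1], where [size] counts all the old elements, so that these number at
most [(b - a) `^ d] once [j] is large.  Finitely many early stages are absorbed in
the constant. *)
Lemma window_upper (d : R) : 0 < d -> exists2 K : R, 0 < K & forall a b n,
  1 <= b - a -> (wcount a b (Ss n).1)%:R <= K * (b - a) `^ (s + d).
Proof.
move=> d0; have [A hA] := kappa_limit d0.
(* from stage [J] on, the upper bound on [log_card] holds and [1 <= d * j] *)
pose J := maxn A (Num.truncn d^-1).+1.
pose C : R := (size (Ss J).1)%:R.
have l2 : 0 < ln (2 : R) by rewrite ln_gt0 // ltr1n.
pose K := C + 1 + 2 + (d * ln 2)^-1 + b0%:R.
exists K.
  have : 0 <= C by []. have : 0 <= b0%:R :> R by []. 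
  have : 0 < (d * ln 2)^-1 by rewrite invr_gt0 mulr_gt0.
  rewrite /K; lra.
move=> a b n; set h := b - a => h1.
have h0 : 0 < h by lra.
have lh0 : 0 <= ln h by exact: ln_ge0.
have pd : h `^ d <= h `^ (s + d) by apply: ler_powR => //; rewrite lerDr.
have p1 : 1 <= h `^ d by rewrite -[leLHS](powRr0 h); apply: ler_powR => //; exact: ltW.
have lnh : ln h / ln 2 <= (d * ln 2)^-1 * h `^ d.
  rewrite ler_pdivrMr // invfM mulrAC -[_ * ln 2]mulrA [_ * ln 2]mulrC.
  have := powR_ge_ln h1 d0; rewrite mulrCA mulrA => H1.
  apply: (le_trans H1); rewrite le_eqVlt; apply/orP; left; apply/eqP.
  by field; rewrite gt_eqF //= gt_eqF.
suff main : (wcount a b (Ss n).1)%:R <= C + h `^ d + (2 + ln h / ln 2) + b0%:R * h `^ (s + d).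
  apply: (le_trans main).
  have C0 : 0 <= C by [].
  have e1 : C <= C * h `^ (s + d) by rewrite ler_peMr // (le_trans p1).
  have e2 : (d * ln 2)^-1 * h `^ d <= (d * ln 2)^-1 * h `^ (s + d).
    by rewrite ler_wpM2l // invr_ge0 mulr_ge0 // ltW.
  have pp := le_trans p1 pd.
  rewrite /K !mulrDl; move: pp pd lnh e1 e2; lra.
have nn0 : 0 <= h `^ d by lra.
have nn1 : 0 <= ln h / ln 2 by rewrite divr_ge0 // ltW.
have nn2 : 0 <= b0%:R * h `^ (s + d) by rewrite mulr_ge0 // powR_ge0.
have small j : (j <= J)%N -> (wcount a b (Ss j).1)%:R <= C.
  by move=> jJ; rewrite ler_nat (leq_trans (wcount_size _ _ _)) // steps_size.
elim: n => [|j IH]; first by apply: (le_trans (small 0%N _)) => //; lra.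
have [jJ|Jj] := leqP j.+1 J; first by apply: (le_trans (small _ jJ)); lra.
have [cl [sp [-> hnew [H0 H00 psp] hcl _]]] := step_new (steps j).
have [new0|newn0] := eqVneq (wcount a b (cl ++ sp)) 0%N.
  by rewrite wcount_cat new0 addn0.
have Aj : (A <= j)%N by rewrite -ltnS (leq_trans _ Jj) // ltnS leq_maxl.
have hclb := hcl A d a b Aj (ltW d0) hA h1.
have hspb := wcount_doubling_ln H00 psp h1.
rewrite !wcount_cat !natrD.
suff old : (wcount a b (Ss j).1)%:R <= h `^ d.
  by have C0 : 0 <= C by []; move: old hclb hspb; rewrite -/h; lra.
have [->|oldn0] := eqVneq (wcount a b (Ss j).1) 0%N; first exact: powR_ge0.
move: newn0; rewrite -lt0n -has_count => /hasP[y ynew /andP[ya yb]].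
move: oldn0; rewrite -lt0n -has_count => /hasP[l lold /andP[la lb]].
have [_ /(_ l lold) hyl] := hnew y ynew.
have sz : (size (Ss j).1)%:R ^+ j.+1 <= h.
  have : ((size (Ss j).1 ^ j.+1)%:Z + l)%:~R < y%:~R :> R by rewrite ltr_int.
  rewrite intrD -pmulrn natrX /h => hh; lra.
apply: (@le_trans _ _ (size (Ss j).1)%:R); first by rewrite ler_nat wcount_size.
have szp : 0 < (size (Ss j).1)%:R :> R by rewrite ltr0n; case: (Ss j).1 lold.
rewrite -(@lnK _ (size _)%:R) ?posrE // /powR gt_eqF // ler_expR.
have h2 : j.+1%:R * ln (size (Ss j).1)%:R <= ln h.
  rewrite mulr_natl -lnXn //; apply: (le_trans _ (le_refl _)).
  by rewrite ler_ln ?posrE // exprn_gt0.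
have dj : 1 <= d * j.+1%:R.
  rewrite mulrC -ler_pdivrMr // mul1r; apply/ltW/(lt_le_trans (truncnS_gt _)).
  by rewrite ler_nat (leq_trans _ (ltnW Jj)) // leq_maxr.
apply: (@le_trans _ _ (d * (j.+1%:R * ln (size (Ss j).1)%:R))); last by rewrite ler_wpM2l // ltW.
rewrite mulrA ler_peMl // ln_ge0 // ler1n -(ltr0n R) //.
Qed.

Let win (x h : R) : set R := `](x - h / 2), (x + h / 2)[%classic.

Lemma counting_upper (x h c : R) : (forall n, (wcount (x - h / 2) (x + h / 2) (Ss n).1)%:R <= c) ->
  (counting ((intset limit_set : set R) `&` win x h) <= c%:E)%E.
Proof.
move=> hc; apply: counting_le => u uu uX.
have [v [vE vX]] : exists v : seq int, u = [seq l%:~R | l <- v] /\ {in v, forall l, limit_set l}.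
  elim: u uX {uu} => [|y u IH] uX; first by exists [::].
  have [v [-> vX]] := IH (fun z zu => uX z (mem_behead (s := y :: u) zu)).
  have [[l lL ly] _] := uX y (mem_head _ _).
  exists (l :: v); split; first by rewrite /= ly.
  by move=> l'; rewrite inE => /predU1P[->|/vX].
have [n hn] : exists n, {subset v <= (Ss n).1}.
  elim: v vX {vE} => [|l v IH] vX; first by exists 0%N.
  have [n hn] := IH (fun z zv => vX z (mem_behead (s := l :: v) zv)).
  have [m hm] := vX l (mem_head _ _).
  exists (maxn n m) => z; rewrite inE => /predU1P[->|/hn zn].
    by apply: steps_sub hm; exact: leq_maxr.
  by apply: steps_sub zn; exact: leq_maxl.
apply: le_trans (hc n); rewrite ler_nat vE size_map /wcount -size_filter.
apply: uniq_leq_size; first by move: uu; rewrite vE => /map_uniq.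
move=> l lv; rewrite mem_filter hn // andbT.
have [_] : ((intset limit_set : set R) `&` win x h) l%:~R by apply: uX; rewrite vE map_f.
by rewrite /win /= in_itv.
Qed.

Lemma counting_lower n (x h : R) :
  (((wcount (x - h / 2) (x + h / 2) (Ss n).1)%:R : R)%:E <=
   counting ((intset limit_set : set R) `&` win x h))%E.
Proof.
rewrite /wcount -size_filter -(size_map (fun l : int => l%:~R : R)).
apply: counting_ge.
  rewrite map_inj_uniq; last by move=> a b /eqP; rewrite eqr_int => /eqP.
  by apply: filter_uniq; exact: steps_uniq.
move=> _ /mapP[l + ->]; rewrite mem_filter => /andP[lw lS]; split.
  by exists l => //; exists n.
by rewrite /win /= in_itv.
Qed.

(** The upper bound is [window_upper] with the constant removed by taking the window
large; the lower bound uses the windows of [step_lower], whose lengths tend to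
infinity. *)
Lemma beurling_dim_limit : beurling_dim ((intset limit_set : set R)) = s%:E.
Proof.
rewrite /beurling_dim; set f := (X in limf_esup X _); rewrite /limf_esup.
apply/eqP; rewrite eq_le; apply/andP; split.
  apply/lee_addgt0Pr => e e0; have d0 : 0 < e / 2 by rewrite divr_gt0.
  have [K K0 hK] := window_upper d0.
  pose M := expR (Num.max 1 (ln K / (e / 2))).
  apply: (@le_trans _ _ (ereal_sup (f @` [set h | M < h]))).
    apply: ereal_inf_lbound; exists [set h | M < h] => //.
    by exists M; split => //; exact: num_real.
  apply: ge_ereal_sup => _ [h /= Mh <-]; apply: ge_ereal_sup => _ [x _ <-].
  have h0 : 0 < h by apply: lt_trans Mh; exact: expR_gt0.
  have lnh : Num.max 1 (ln K / (e / 2)) <= ln h.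
    by rewrite -[leLHS]expRK ler_ln ?posrE ?expR_gt0 // ltW.
  have lnh1 : 1 <= ln h by apply: le_trans lnh; rewrite le_max lexx.
  have lnhp : 0 < ln h by lra.
  have lnKe : ln K <= (e / 2) * ln h.
    by rewrite mulrC -ler_pdivrMr //; apply: le_trans lnh; rewrite le_max lexx orbT.
  have h1 : 1 <= h.
    by rewrite -(@lnK _ h) ?posrE // -[leLHS]expR0 ler_expR ltW.
  have wE : (x + h / 2) - (x - h / 2) = h by field.
  have up : (counting ((intset limit_set : set R) `&` win x h) <= (K * h `^ (s + e / 2))%:E)%E.
    by apply: counting_upper => n; have := hK (x - h / 2) (x + h / 2) n; rewrite wE; apply.
  have pp : 0 < h `^ (s + e / 2) by rewrite powR_gt0.
  have cnt0 : (0 <= counting ((intset limit_set : set R) `&` win x h))%E.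
    by rewrite /counting; case: asboolP => _; rewrite ?lee_fin ?leey.
  have lneup : (lne (counting ((intset limit_set : set R) `&` win x h)) <=
      (ln K + (s + e / 2) * ln h)%:E)%E.
    have Kp : 0 < K * h `^ (s + e / 2) by rewrite mulr_gt0.
    rewrite -ln_powR -lnM ?posrE // -(lne_EFin Kp) lee_lne //.
      by rewrite in_itv /= cnt0 leey.
    by rewrite in_itv /= leey lee_fin ltW.
  apply: (@le_trans _ _ ((ln K + (s + e / 2) * ln h)%:E * ((ln h)^-1)%:E)%E).
    by rewrite lee_wpmul2r // lee_fin invr_ge0 ltW.
  rewrite -EFinM -EFinD lee_fin ler_pdivrMr //.
  by move: lnKe; rewrite !mulrDl; lra.
apply: le_ereal_inf_tmp => _ [V [M [_ MV]] <-].
apply/lee_addgt0Pr => e e0.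
pose j := (Num.truncn (Num.max M ((2 + s) / e)) + 2)%N.
have jM : Num.max M ((2 + s) / e) < j.+1%:R.
  by apply: (lt_trans (truncnS_gt _)); rewrite ltr_nat /j addn2 ?ltnS.
have [h [m [jh /andP[mh hm] cnt0 cnt]]] := step_lower (steps j).
have Vh : V h.
  by apply: MV; apply: lt_le_trans jh; apply: le_lt_trans jM; rewrite le_max lexx.
have tole : tolerance R j * (2 + s) <= e.
  rewrite /tolerance mulrC ler_pdivrMr // mulrC -ler_pdivrMr //.
  by apply: (le_trans _ (ltW jM)); rewrite le_max lexx orbT.
have tol0 : 0 < tolerance R j by rewrite invr_gt0.
have h2 : 2%:R < h by apply: lt_le_trans jh; rewrite ltr_nat /j addn2 ?ltnS.
have h0 : 0 < h by lra.
have lnhp : 0 < ln h by rewrite ln_gt0 //; lra.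
set c := wcount _ _ _ in cnt0 cnt.
have cR : 0 < c%:R :> R by rewrite ltr0n.
have lnc0 : 0 <= ln c%:R :> R by rewrite ln_ge0 // ler1n.
have key : s * ln h <= ln c%:R + e * ln h.
  have [se|se] := leP s e.
    by apply: (@le_trans _ _ (e * ln h)); [rewrite ler_wpM2r // ltW|rewrite lerDr].
  have m0 : 0 <= m by have : 0 < (1 + tolerance R j) * m by [exact: lt_le_trans hm]; nra.
  have k1 : (s - e) * ln h <= (s - e) * ((1 + tolerance R j) * m).
    by rewrite ler_wpM2l // subr_ge0 ltW.
  have k2 : (s - e) * (1 + tolerance R j) <= s - 2 * tolerance R j.
    by have : 0 <= e * tolerance R j by [rewrite mulr_ge0 // ltW]; move: tole; lra.
  have k3 : (s - e) * (1 + tolerance R j) * m <= (s - 2 * tolerance R j) * m.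
    exact: ler_wpM2r.
  move: k1 k3 cnt; rewrite mulrA mulrBl; lra.
apply: (@le_trans _ _ (f h + e%:E)%E); last first.
  by rewrite leeD2r //; apply: ereal_sup_ubound; exists h.
apply: (@le_trans _ _ ((ln c%:R)%:E * ((ln h)^-1)%:E + e%:E)%E).
  by rewrite -EFinM -EFinD lee_fin -(ler_pM2r lnhp) mulrDl divfK ?gt_eqF.
rewrite leeD2r //; apply: (@le_trans _ _
   (lne (counting ((intset limit_set : set R) `&` win 0 h)) * ((ln h)^-1)%:E)%E).
  apply: lee_wpmul2r; first by rewrite lee_fin invr_ge0 ltW.
  have := counting_lower j.+1 0 h; rewrite -/c => cl.
  rewrite -(lne_EFin cR) lee_lne //.
    by rewrite in_itv /= lee_fin leey ler0n.
  by rewrite in_itv /= leey andbT (le_trans _ cl) // lee_fin.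
by apply: ereal_sup_ubound; exists 0.
Qed.

End Dimension.

(** * Infinite runs of the construction *)

Section Visits.
Variable T : set int.
Hypothesis T1 : T 1.

(** The exponent of 2 in [j.+1] takes every value infinitely often, so every element
of [T] is visited infinitely often. *)
Definition visit (j : nat) : int :=
  if choice.unpickle (logn 2 j.+1) is Some t then if `[< T t >] then t else 1 else 1.

Lemma visit_in j : T (visit j).
Proof. by rewrite /visit; case: choice.unpickle => // t; case: asboolP. Qed.

Lemma visit_infinitely_often t J : T t -> exists2 j, (J <= j)%N & visit j = t.
Proof.
move=> Tt; exists (2 ^ choice.pickle t * J.*2.+1).-1.
  rewrite -ltnS prednK ?muln_gt0 ?expn_gt0 //.
  apply: leq_trans (leq_pmull _ _); last by rewrite expn_gt0.
  by rewrite ltnS -addnn leq_addr.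
rewrite /visit prednK ?muln_gt0 ?expn_gt0 // lognM ?expn_gt0 // pfactorK //.
rewrite [X in (_ + X)%N]lognE /= dvdn2 /= odd_double /= addn0 choice.pickleK.
by case: asboolP.
Qed.

End Visits.

Section Runs.
Variable R : realType.
Context (q : nat -> nat) (dg W : nat -> seq int) (T : set int) (rho beta : R)
  (b0 : nat) (HS : moran_system q dg W T rho beta b0).
Hypothesis T1 : T 1.
Variables (kappa s : R).
Hypotheses (s0 : 0 <= s) (s_kappa : s <= kappa).

Local Notation step := (step q dg W T b0 kappa s).
Local Notation valid := (valid R q dg T).
Local Notation log_card a := (log_card R q W a).
Local Notation log_scale a := (log_scale R q a).
Local Notation nontrivial :=
  (forall K, exists2 k, (K <= k)%N & (1 < size (dg k))%N).

Hypothesis kappa_limit : forall d : R, 0 < d -> exists A : nat,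
  forall a, (A <= a)%N -> log_card a <= (kappa + d) * log_scale a.
Hypothesis kappa_recurrent : forall d : R, 0 < d -> forall A : nat,
  exists2 a, (A <= a)%N & (kappa - d) * log_scale a <= log_card a.

Lemma steps_tower (Ss : nat -> state) (eps : int -> R) (H : nat -> int) :
  Ss 0%N = ([:: 0], 0%N) -> (forall t, T t -> 0 < eps t) ->
  (forall j, step (eps (visit T j)) (visit T j) j (H j) (Ss j) (Ss j.+1)) ->
  tower R q dg T (fun j => (Ss j).1) (fun j => (Ss j).2).
Proof.
move=> Ss0 eps0 hstep; split.
- case=> [|j]; first by rewrite Ss0; exact: tight_root.
  exact: valid_tight (step_valid (hstep j)).
- move=> j l lS; have [cl [sp [-> _ _ _ _]]] := step_new (hstep j).
  by rewrite mem_cat lS.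
- case=> [|j] //; exact: step_level (hstep j).
- move=> t Tt; exists (eps t); first exact: eps0.
  move=> J; have [j Jj vj] := visit_infinitely_often J Tt.
  exists j.+1; first exact: ltnW.
  by have := step_good (hstep j); rewrite vj.
Qed.

(** Raising the threshold [H j] above [y] keeps [y] out of all later stages: the
elements added at stage [j] exceed [y], and every later one exceeds these. *)
Lemma steps_skip (Ss : nat -> state) (eps : nat -> R) (t H : nat -> int) j y :
  (forall j, step (eps j) (t j) j (H j) (Ss j) (Ss j.+1)) -> nontrivial ->
  y <= H j -> y \notin (Ss j).1 -> ~ limit_set Ss y.
Proof.
move=> hstep nt yH yS [k].
have inc i d : {subset (Ss i).1 <= (Ss (i + d)%N).1}.
  elim: d => [|d IH] l lL; first by rewrite addn0.
  rewrite addnS; have [cl [sp [-> _ _ _ _]]] := step_new (hstep (i + d)%N).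
  by rewrite mem_cat IH.
have [kj|jk] := leqP k j.
  by move=> yk; move: yS; rewrite -(subnKC kj) (inc k (j - k)%N y yk).
rewrite -(subnKC jk); elim: (k - j.+1)%N => [|d IH].
  rewrite addn0; have [cl [sp [-> hnew _ _ _]]] := step_new (hstep j).
  rewrite mem_cat (negbTE yS) /= => /hnew[Hy _].
  by have := lt_le_trans Hy yH; rewrite ltxx.
rewrite addnS; have [cl [sp [-> hnew _ _ _]]] := step_new (hstep (j.+1 + d)%N).
rewrite mem_cat => /orP[//|/hnew[_ hy]].
have [cl' [sp' [e' hnew' _ _ /(_ nt)]]] := step_new (hstep j).
case E : (cl' ++ sp') => [//|z r] _.
have zn : z \in cl' ++ sp' by rewrite E mem_head.
have zS : z \in (Ss (j.+1 + d)%N).1.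
  by apply: (inc j.+1 d); rewrite e' mem_cat zn orbT.
have [Hz _] := hnew' z zn.
have : z < y by apply: le_lt_trans (hy z zS); rewrite lerDr.
by move/(lt_trans Hz); rewrite ltNge yH.
Qed.

Lemma seq_bounded (L : seq int) : exists M, {in L, forall l : int, l <= M}.
Proof.
elim: L => [|l L [M hM]]; first by exists 0.
exists (Num.max l M) => l'; rewrite inE le_max => /predU1P[->|/hM ->].
  by rewrite lexx.
by rewrite orbT.
Qed.

(** At each stage, a bit decides whether the threshold is 0 or the maximum of the set
that threshold 0 would give.  At the first difference of two bit sequences, a
new element of the run with bit 0 is skipped by the other run, by [steps_skip]. *)
Lemma runs_exist : exists Lam : (nat -> bool) -> set int,
  [/\ forall b, beurling_dim (intset (Lam b) : set R) = s%:E,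
      forall b, exists Ls es, tower R q dg T Ls es /\
        Lam b = [set l | exists j, l \in Ls j] &
      nontrivial -> injective Lam].
Proof.
have /choice[F hF] : forall t, exists z : R * (nat -> int -> state -> state),
    T t -> 0 < z.1 /\ forall j H S, valid S -> step z.1 t j H S (z.2 j H S).
  move=> t; have [Tt|nTt] := pselect (T t); last first.
    by exists (0, fun _ _ S => S) => /nTt.
  have [eps eps0 hs] := step_exists HS T1 s0 s_kappa kappa_recurrent Tt.
  have /choice[G hG] : forall x : nat * int * state, exists S',
      valid x.2 -> step eps t x.1.1 x.1.2 x.2 S'.
    move=> [[j H] S] /=; have [vS|nvS] := pselect (valid S).
      by have [S' hS'] := hs j H S vS; exists S'.
    by exists S.
  exists (eps, fun j H S => G (j, H, S)) => _; split=> //= j H S vS.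
  exact: (hG (j, H, S)).
have /choice[M hM] := seq_bounded.
pose nx j := (F (visit T j)).2 j; pose eps t := (F t).1.
pose thr (b : nat -> bool) j S : int := if b j then M (nx j 0 S).1 else 0.
pose run b := fix run j : state :=
  if j is i.+1 then nx i (thr b i (run i)) (run i) else ([:: 0], 0%N).
have vrun b j : valid (run b j).
  elim: j => [|j IH].
    split=> //=; first exact: tight_root.
    by move=> l; rewrite inE => /eqP ->.
  exact: step_valid ((hF _ (visit_in T1 j)).2 j _ _ IH).
have srun b j : step (eps (visit T j)) (visit T j) j
    (thr b j (run b j)) (run b j) (run b j.+1).
  exact: (hF _ (visit_in T1 j)).2.
exists (fun b => limit_set (run b)); split.
- by move=> b; apply: (beurling_dim_limit HS T1 s0 kappa_limit (srun b)).
- move=> b; exists (fun j => (run b j).1), (fun j => (run b j).2); split=> //.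
  by apply: (steps_tower _ _ (srun b)) => // t /hF[].
move=> nt b b' bb'; apply/funext => j; apply/eqP; apply: contra_eqT bb' => bj.
have ex : exists j, b j != b' j by exists j.
case: (ex_minnP ex) => {bj}i bi mini {j ex}.
have runE : run b i = run b' i.
  have : forall j, (j < i)%N -> b j = b' j.
    by move=> j ji; apply/eqP; apply: contraTT ji => /mini; rewrite -leqNgt.
  elim: i {bi mini} => [//|i IH hi] /=.
  by rewrite IH => [|j ji]; [rewrite /thr hi|apply: hi; exact: ltnW].
suff main c c' : run c i = run c' i -> c i -> ~~ c' i -> limit_set (run c) <> limit_set (run c').
  apply/eqP; case ebi : (b i) bi; case ebi' : (b' i) => // _.
    by apply: main; rewrite ?ebi'.
  by apply/nesym/main; rewrite ?ebi.
move=> cE ci c'i ll.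
have [cl [sp [e hnew _ _ /(_ nt)]]] := step_new (srun c' i).
case E : (cl ++ sp) => [//|y r] _.
have yn : y \in cl ++ sp by rewrite E mem_head.
have yc' : y \in (run c' i.+1).1 by rewrite e mem_cat yn orbT.
have : ~ limit_set (run c) y.
  apply: (steps_skip (j := i) (srun c) nt).
    rewrite {1}/thr ci; apply: hM; rewrite cE.
    by move: yc' => /=; rewrite {1}/thr (negbTE c'i).
  rewrite cE; apply/negP => yS; have [_ /(_ y yS)] := hnew y yn.
  by rewrite ltNge lerDr.
by rewrite ll; apply; exists i.+1.
Qed.

End Runs.

(** * Hadamard triples *)

Section Hadamard.
Variables (R : realType) (N : nat) (B L : {fset int}).
Hypothesis hBL : hadamard_triple R N B L.

(** The orthogonality of two rows of the Hadamard matrix, without normalisation. *)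
Lemma hadamard_row_orthogonal i j : (i < #|` B|)%N -> (j < #|` B|)%N ->
  \sum_(l <- enum_fset L)
    expi (2 * pi * (((enum_fset B)`_j - (enum_fset B)`_i) * l)%:~R / N%:R)
  = ((i == j)%:R * #|` B|%:R)%:C%C :> R[i].
Proof.
move=> iB jB; have [_ eBL /unitarymxP uni] := hBL.
have B0 : 0 < #|` B|%:R :> R by rewrite ltr0n (leq_trans _ iB).
move/matrixP: uni => /(_ (Ordinal iB) (Ordinal jB)).
rewrite !mxE => E; pose c : R := (Num.sqrt #|` B|%:R)^-1.
have cc : c * c = #|` B|%:R^-1.
  by rewrite /c -invfM -expr2 sqr_sqrtr // ltW.
have term (l : 'I_(#|` L|)) : (#|` B|%:R^-1)%:C%C * expi (2 * pi *
      (((enum_fset B)`_j - (enum_fset B)`_i) * (enum_fset L)`_l)%:~R / N%:R) =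
   hadamard_mx R N B L (Ordinal iB) l * map_mx Num.conj (hadamard_mx R N B L)^T l (Ordinal jB).
  rewrite !mxE /= -cc -/c.
  have -> : Num.conj (c%:C%C * expi (- (2 * pi * ((enum_fset B)`_j * (enum_fset L)`_l)%:~R / N%:R)))
     = c%:C%C * expi (2 * pi * ((enum_fset B)`_j * (enum_fset L)`_l)%:~R / N%:R).
    rewrite rmorphM /=; congr (_ * _); first by rewrite [LHS]/Num.conj /= oppr0.
    by rewrite -[RHS]conjcK conj_expi.
  rewrite mulrACA -expiD -rmorphM; congr (_ * expi _).
  by rewrite mulrBl intrB; ring.
rewrite -(eq_bigr _ (fun l _ => term l)) -mulr_sumr in E.
rewrite (big_nth 0) big_mkord.
transitivity ((#|` B|%:R)%:C%C * (Ordinal iB == Ordinal jB)%:R : R[i]).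
  by rewrite -E mulrA -rmorphM /= divff ?gt_eqF // mul1r.
by rewrite -val_eqE /= mulrC rmorphM; case: eqP => _; rewrite ?rmorph1 ?rmorph0.
Qed.

(** Expanding the squared modulus and summing over [L] first leaves only the diagonal
terms, by orthogonality of the rows. *)
Lemma hadamard_tight x : B != fset0 ->
  \sum_(l <- enum_fset L) sqmod
    (expmean [seq 2 * pi * d%:~R | d <- enum_fset B] ((x + l%:~R) / N%:R)) = 1 :> R.
Proof.
move=> B0; set b : R := #|` B|%:R.
have b0 : b != 0 by rewrite pnatr_eq0 cardfs_eq0.
pose g d d' l : R := 2 * pi * ((d - d') * l)%:~R / N%:R.
pose f d d' : R := 2 * pi * (d%:~R - d'%:~R) * x / N%:R.
transitivity (\sum_(l <- enum_fset L) (b * b)^-1 *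
    \sum_(d <- enum_fset B) \sum_(d' <- enum_fset B) 
     complex.Re (expi (f d d') * expi (g d d' l))).
  apply: eq_bigr => l _; rewrite sqmod_expmean /cosmean !size_allpairs !size_map natrM.
  congr (_ * _); rewrite big_allpairs_dep big_map; apply: eq_bigr => d _.
  rewrite big_map; apply: eq_bigr => d' _.
  by rewrite -expiD /=; congr cos; rewrite /f /g intrM intrB; ring.
rewrite -mulr_sumr exchange_big /=.
under eq_bigr do rewrite exchange_big /=.
suff -> : \sum_(d <- enum_fset B) \sum_(d' <- enum_fset B) \sum_(l <- enum_fset L)
     complex.Re (expi (f d d') * expi (g d d' l)) = b * b.
  by rewrite mulVf // mulf_neq0.
have -> : b * b = \sum_(d <- enum_fset B) b.
  by rewrite big_const_seq count_predT iter_addr_0 -[b *+ _]mulr_natl.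
rewrite (big_nth 0) [RHS](big_nth 0) !big_mkord; apply: eq_bigr => i _.
rewrite (big_nth 0) big_mkord.
have term (j : 'I_(#|` B|)) : \sum_(l <- enum_fset L)
    complex.Re (expi (f (enum_fset B)`_i (enum_fset B)`_j) *
       expi (g (enum_fset B)`_i (enum_fset B)`_j l)) = if j == i then b else 0.
  rewrite -complex_Re_sum -mulr_sumr hadamard_row_orthogonal //.
  rewrite complex_ReM /= mulr0 subr0; case: eqVneq => [/val_inj ->|ji].
    by rewrite eqxx /f subrr mulr0 !mul0r cos0 !mul1r.
  by rewrite -val_eqE /= (negbTE ji) mul0r mulr0.
rewrite (eq_bigr _ (fun j _ => term j)) -big_mkcond /= big_pred1_eq //.
Qed.

End Hadamard.

(** * The transform of the infinite convolution *)

Section ConvolutionTransform.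
Variable R : realType.
Context (q : nat -> nat) (D : nat -> {fset int}).
Hypothesis q2 : forall i, (2 <= q i)%N.
Hypothesis D0 : forall i, D i != fset0.

Let dg k := enum_fset (D k).
Local Notation scale := (scale q).

Lemma scaling_productE k : scaling_product q k = scale 0 k.+1.
Proof.
suff main j e : (\prod_(i < j) q (e + i))%N = scale e j by exact: (main k.+1 0%N).
elim: j e => [|j IH] e; first by rewrite big_ord0.
rewrite big_ord_recl addn0 /= -IH; congr (_ * _)%N; apply: eq_bigr => i _.
by rewrite addSnnS.
Qed.

Lemma perm_expmean (s s' : seq R) x : perm_eq s s' -> expmean s x = expmean s' x.
Proof. by move=> ss'; rewrite /expmean (perm_size ss') (perm_big _ ss'). Qed.

Lemma cf_scaled_digits k (xi : R) :
  cf (udirac (scaled_digits R q D k)) (2 * pi * xi) =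
  digit_mask dg k (xi / (scale 0 k.+1)%:R).
Proof.
have Mk : (scaling_product q k)%:R != 0 :> R.
  rewrite pnatr_eq0 -lt0n prodn_gt0 // => i; exact: leq_trans (q2 i).
rewrite cf_udirac; last first.
  by rewrite -cardfs_gt0 card_imfset ?cardfs_gt0 // => a b /(mulIf (invr_neq0 Mk))/eqP; rewrite eqr_int => /eqP.
have P : perm_eq (enum_fset (scaled_digits R q D k))
    [seq d%:~R / (scaling_product q k)%:R | d <- dg k].
  by apply: enum_imfset => a b _ _ /(mulIf (invr_neq0 Mk))/eqP; rewrite eqr_int => /eqP.
rewrite (perm_expmean _ P) /digit_mask /expmean !size_map !big_map; congr (_ * _).
apply: eq_bigr => d _; congr expi; rewrite -scaling_productE; field; exact: Mk.
Qed.

Lemma sqmod_cf_convolutions k (xi : R) :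
  sqmod (cf (convolutions (fun k => udirac (scaled_digits R q D k)) k)
    (2 * pi * xi)) = tpow q dg 0 k.+1 xi.
Proof.
elim: k => [|k IH].
  rewrite [convolutions _ _]/= cf_scaled_digits /tpow /tail sqmodM sqmod1 mulr1.
  by rewrite [scale 0 1]/= muln1.
rewrite [convolutions _ _]/= cf_convolution sqmodM IH cf_scaled_digits.
rewrite -[in RHS](addn1 k.+1) tpowD; congr (_ * _).
rewrite -[in LHS](addn1 k.+1) scaleD natrM invfM mulrA.
by rewrite /tpow /tail mulr1 add0n [scale k.+1 1]/= muln1.
Qed.

Lemma cvg_sqmod_cf mu xi :
  infinite_convolution (fun k => udirac (scaled_digits R q D k)) mu ->
  tpow q dg 0 n xi @[n --> \oo] --> sqmod (cf mu (2 * pi * xi)).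
Proof.
move=> hmu; have h := weak_cvg_sqmod_cf (a := 2 * pi * xi) hmu.
rewrite -cvg_shiftS; apply: cvg_trans h; apply: near_eq_cvg.
by near=> n; rewrite sqmod_cf_convolutions.
Unshelve. all: by end_near.
Qed.

End ConvolutionTransform.

(** * The exponent kappa *)

Section UpperLimit.
Variables (R : realType) (u : nat -> R).
Hypothesis u01 : forall n, 0 <= u n <= 1.

(** The upper limit in the two-sided form in which it is used: an eventual upper
bound and a recurrent lower bound. *)
Lemma limn_esup_bounded : exists kap : R, [/\ limn_esup (EFin \o u) = kap%:E,
  0 <= kap,
  forall d, 0 < d -> exists A, forall n, (A <= n)%N -> u n <= kap + d &
  forall d, 0 < d -> forall A, exists2 n, (A <= n)%N & kap - d <= u n].
Proof.
rewrite /limn_esup /limf_esup; set K := ereal_inf _.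
have K0 : (0 <= K)%E.
  apply: le_ereal_inf_tmp => _ [V [n _ nV] <-].
  apply: (@le_trans _ _ (u n)%:E); first by rewrite lee_fin; case/andP: (u01 n).
  by apply: ereal_sup_ubound; exists n => //; apply: nV => /=.
have K1 : (K <= 1)%E.
  apply: (@le_trans _ _ (ereal_sup ((EFin \o u) @` setT))).
    by apply: ereal_inf_lbound; exists setT => //; exact: filterT.
  by apply: ge_ereal_sup => _ [n _ <-]; rewrite lee_fin; case/andP: (u01 n).
have Kfin : K \is a fin_num by rewrite ge0_fin_numE // (le_lt_trans K1) // ltry.
exists (fine K); split; first by rewrite fineK.
- exact: fine_ge0.
- move=> d d0; have : (K < (fine K + d)%:E)%E.
    by rewrite EFinD fineK // lteDl // lte_fin.
  move/ereal_inf_lt => [_ [V [A _ AV] <-]] hV; exists A => n An.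
  rewrite -lee_fin; apply: (le_trans _ (ltW hV)).
  by apply: ereal_sup_ubound; exists n => //; apply: AV.
- move=> d d0 A.
  have : ((fine K - d)%:E < ereal_sup ((EFin \o u) @` [set n | (A <= n)%N]))%E.
    apply: (@lt_le_trans _ _ K).
      by rewrite EFinB fineK // lteBlDr // lteDl // lte_fin.
    by apply: ereal_inf_lbound; exists [set n | (A <= n)%N] => //; exists A.
  move/ereal_sup_gt => [_ [n /= An <-]]; rewrite lte_fin => /ltW h.
  by exists n.
Qed.

End UpperLimit.

Section Kappa.
Variable R : realType.
Context (q : nat -> nat) (D : nat -> {fset int}) (W : nat -> seq int) (T : set int)
  (rho beta : R) (b0 : nat).
Local Notation dg := (fun k => enum_fset (D k)).
Hypothesis HS : moran_system q dg W T rho beta b0.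

Lemma log_cardE k : log_card R q W k = \sum_(r < k) ln (#|` D r|%:R : R).
Proof.
rewrite /log_card (size_block HS); elim: k => [|k IH].
  by rewrite !big_ord0 ln1.
rewrite !big_ord_recr /= natrM lnM ?posrE ?ltr0n ?prodn_gt0 ?IH // => [i|];
  by rewrite lt0n size_eq0 (ms_dg0 HS).
Qed.

Lemma log_scaleE k : log_scale R q k = \sum_(r < k) ln ((q r)%:R : R).
Proof.
rewrite /log_scale; elim: k => [|k IH]; first by rewrite big_ord0 ln1.
rewrite big_ord_recr -IH -[in LHS](addn1 k) scaleD add0n natrM lnM ?posrE ?(scaleR_gt0 HS) //.
by rewrite /= muln1.
Qed.

Lemma log_scale_gt0 k : 0 < log_scale R q k.+1.
Proof. by rewrite ln_gt0 // ltr1n (leq_trans _ (scale_ge HS 0 k.+1)) // expnS leq_pmulr // expn_gt0. Qed.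

(** The quotients lie between 0 and 1 since each digit set has at most [q i] elements. *)
Lemma kappa_real : exists kap : R, [/\ kappa R q D = kap%:E, 0 <= kap,
  forall d, 0 < d -> exists A, forall a, (A <= a)%N ->
    log_card R q W a <= (kap + d) * log_scale R q a &
  forall d, 0 < d -> forall A, exists2 a, (A <= a)%N &
    (kap - d) * log_scale R q a <= log_card R q W a].
Proof.
pose u k : R := log_card R q W k.+1 / log_scale R q k.+1.
have u01 k : 0 <= u k <= 1.
  apply/andP; split.
    by rewrite divr_ge0 // ?(log_scale_ge0 HS) // ln_ge0 // ler1n (size_block_gt0 HS).
  rewrite ler_pdivrMr ?log_scale_gt0 // mul1r log_cardE log_scaleE.
  apply: ler_sum => r _; have dg0 : (0 < #|` D r|)%N by rewrite lt0n size_eq0 (ms_dg0 HS).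
  rewrite ler_ln ?posrE ?(q_gt0 HS) ?ltr0n //; apply: le_trans (ms_qdg HS r).
  by rewrite ler_peMl // ltW // (ms_rho HS).
have [kap [kE kap0 up lo]] := limn_esup_bounded u01; exists kap; split => //.
- rewrite -kE /kappa; congr limn_esup; apply/funext => k.
  by rewrite /= /u log_cardE log_scaleE.
- move=> d /up[A hA]; exists A.+1 => -[//|a] Aa.
  by rewrite -ler_pdivrMr ?log_scale_gt0 //; exact: hA.
- move=> d d0 A; have [a Aa ha] := lo d d0 A; exists a.+1; first exact: ltnW.
  by rewrite -ler_pdivlMr ?log_scale_gt0.
Qed.

End Kappa.

(** * From towers to spectra *)

Section TowerSpectrum.
Variable R : realType.
Context (q : nat -> nat) (dg W : nat -> seq int) (T : set int) (rho beta : R)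
  (b0 : nat) (HS : moran_system q dg W T rho beta b0).
Hypothesis T1 : T 1.
Variable mu : probability R R.
Hypothesis cvg_mu : forall x,
  tpow q dg 0 n x @[n --> \oo] --> sqmod (cf mu (2 * pi * x)).

(** The mass at [x] is read at [- x / t], since [x - t * l = - t * (- x / t + l)] and the
modulus of the transform is even. *)
Lemma tower_spectrum Ls es t : tower R q dg T Ls es -> T t -> t != 0 ->
  spectrum mu (scale_set t%:~R (intset [set l | exists j, l \in Ls j])).
Proof.
move=> HT Tt t0; have tR : t%:~R != 0 :> R by rewrite intr_eq0.
apply: spectrum_criterion.
- apply: sub_countable (card_image_le _ _) _.
  by apply: sub_countable (card_image_le _ _) _; exact: countableP.
- move=> _ _ [_ [a [i ai] <-] <-] [_ [b [j bj] <-] <-] ab.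
  have ne : a != b by apply: contra_neq ab => ->.
  have aL := tower_sub_le HT (leq_maxl i j) ai.
  have bL := tower_sub_le HT (leq_maxr i j) bj.
  have := tower_orthogonal HS T1 cvg_mu HT Tt aL bL ne.
  rewrite mulrBr /sqmod => /eqP; rewrite paddr_eq0 ?sqr_ge0 // !sqrf_eq0.
  by move=> /andP[/eqP r0 /eqP i0]; apply: eq_complexP.
- move=> x e e0.
  have [j hj] := tower_parseval HS T1 cvg_mu HT (- x / t%:~R) Tt e0.
  exists [seq t%:~R * l%:~R | l <- Ls j]; split.
  + rewrite map_inj_uniq ?(tower_uniq HS T1 HT) // => a b /(mulfI tR)/eqP.
    by rewrite eqr_int => /eqP.
  + by move=> _ /mapP[l lL ->]; exists l%:~R => //; exists l => //; exists j.
  + rewrite big_map; congr (_ < _) : hj; apply: eq_bigr => l _.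
    have -> : 2 * pi * (x - t%:~R * l%:~R) =
        - (2 * pi * (t%:~R * (- x / t%:~R + l%:~R))) by field.
    by rewrite cfN /sqmod; case: (cf mu _) => a b /=; rewrite sqrrN.
Qed.

End TowerSpectrum.

(** * Spectra of the infinite convolution *)

Section HadamardMoran.
Variables (R : realType) (m : nat).
Context (N : 'I_m.+1 -> nat) (B L : 'I_m.+1 -> {fset int}).
Hypothesis hBL : forall j, hadamard_triple R (N j) (B j) (L j).
Hypothesis hrho : 1 < min_ratio R N B.
Context (omega : nat -> 'I_m.+1) (n : nat -> nat).
Hypothesis hn : forall k, (0 < n k)%N.

Let T := common_scalings R N B L.
Let q k := (N (omega k) ^ n k)%N.

Lemma common_scalings1 : T 1.
Proof.
split=> // j; rewrite (_ : [fset 1 * l | l in L j]%fset = L j) //.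
apply/fsetP => l; apply/imfsetP/idP => [[l' l'L ->]|lL]; first by rewrite mul1r.
by exists l; rewrite ?mul1r.
Qed.

Lemma min_ratio_le j : min_ratio R N B <= (N j)%:R / #|` B j|%:R.
Proof. exact: bigmin_le_cond. Qed.

Lemma digits_neq0 j : B j != fset0.
Proof.
rewrite -cardfs_eq0; apply/eqP => B0; have := lt_le_trans hrho (min_ratio_le j).
by rewrite B0 invr0 mulr0 ltr10.
Qed.

(** The factor [N ^ (n - 1)] adapts the dual set of [N] to the scale [N ^ n], and
subtracting an element of [L] puts 0 into the set. *)
Definition hadamard_residues k : seq int :=
  [seq (N (omega k) ^ (n k).-1)%:Z * (l - head 0 (enum_fset (L (omega k))))
    | l <- enum_fset (L (omega k))].

(** With [q = N ^ n] and [P = N ^ (n - 1)], the point [t * (x + P * (l - l0)) / q] is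
[(t * x / P - t * l0 + t * l) / N], so the identity for [W] is that of the triple
[(N, B, t L)] at a shifted point. *)
Lemma hadamard_moran : exists beta b0,
  moran_system q (fun k => enum_fset (B (omega k))) hadamard_residues T
    (min_ratio R N B) beta b0.
Proof.
have [beta hbeta] := nat_bound (flatten [seq enum_fset (B j) | j : 'I_m.+1])
  (fun d => `|d%:~R| : R).
have Nq k : (N (omega k) <= q k)%N.
  have [N2 _ _] := hBL (omega k).
  rewrite /q -{1}[N (omega k)]expn1; apply: leq_pexp2l => //; exact: ltnW.
exists beta%:R, (\max_j #|` B j|)%N; split=> //.
- move=> k; have [N2 _ _] := hBL (omega k).
  exact: leq_trans N2 (Nq k).
- move=> k; have [N2 _ _] := hBL (omega k).
  have B0 : 0 < #|` B (omega k)|%:R :> R by rewrite ltr0n cardfs_gt0 digits_neq0.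
  have := min_ratio_le (omega k); rewrite ler_pdivlMr // => /le_trans; apply.
  by rewrite ler_nat Nq.
- by move=> k; rewrite -size_eq0 cardfs_eq0 digits_neq0.
- by move=> k; exact: (leq_bigmax (omega k)).
- move=> k d dB; apply: hbeta; apply/flatten_mapP.
  by exists (omega k); rewrite ?mem_enum.
- move=> k; have [_ eBL _] := hBL (omega k).
  have : enum_fset (L (omega k)) != [::] by rewrite -size_eq0 -eBL cardfs_eq0 digits_neq0.
  rewrite /hadamard_residues; case: (enum_fset _) => // l s _.
  by rewrite /= subrr mulr0 mem_head.
- by move=> k; have [_ eBL _] := hBL (omega k); rewrite size_map.
move=> k t x [t0 /(_ (omega k)) ht]; have [N2 _ _] := hBL (omega k).
rewrite big_map; set l0 := head _ _; set P := (N (omega k) ^ (n k).-1)%N.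
have P0 : P%:R != 0 :> R by rewrite pnatr_eq0 -lt0n expn_gt0 ltnW.
have N0 : (N (omega k))%:R != 0 :> R by rewrite pnatr_eq0 -lt0n ltnW.
have perm : perm_eq (enum_fset [fset t * l | l in L (omega k)]%fset)
    [seq t * l | l <- enum_fset (L (omega k))].
  by apply: enum_imfset => a b _ _; exact: (mulfI t0).
rewrite -[RHS](hadamard_tight ht (t%:~R * x / P%:R - t%:~R * l0%:~R) (digits_neq0 _)).
rewrite [RHS](perm_big _ perm) [RHS]big_map; apply: eq_bigr => l _.
congr (sqmod (expmean _ _)).
rewrite (_ : (q k)%:R = (N (omega k))%:R * P%:R); last first.
  by rewrite -natrM /q -expnS prednK.
rewrite !intrM intrB -pmulrn; field.
by rewrite P0 N0.
Qed.

End HadamardMoran.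

Lemma set_int_card_le (A : set (set int)) : (A #<= [set: set nat])%card.
Proof.
apply/pcard_injP; exists (fun X => choice.pickle @` X) => X Y _ _ E.
apply/seteqP; split=> x Xx.
  have : (choice.pickle @` Y) (choice.pickle x) by rewrite -E; exists x.
  by move=> [y Yy /(pcan_inj choice.pickleK)<-].
have : (choice.pickle @` X) (choice.pickle x) by rewrite E; exists x.
by move=> [y Yy /(pcan_inj choice.pickleK)<-].
Qed.

(* The cardinality claim needs infinitely many digit sets with at least two
   elements: otherwise mu is finitely supported, all its spectra are finite,
   and only countably many of them lie in the integers. *)
Theorem theorem1p3 (R : realType) (m : nat)
    (N : 'I_m.+1 -> nat) (B L : 'I_m.+1 -> {fset int})
    (hBL : forall j, hadamard_triple R (N j) (B j) (L j))
    (hrho : 1 < min_ratio R N B)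
    (omega : nat -> 'I_m.+1) (n : nat -> nat)
    (hn : forall k, (0 < n k)%N)
    (q : nat -> nat) (hq : forall k, q k = (N (omega k) ^ n k)%N)
    (D : nat -> {fset int}) (hD : forall k, D k = B (omega k))
    (mu : probability R R)
    (hmu : infinite_convolution (fun k => udirac (scaled_digits R q D k)) mu) :
  let T := common_scalings R N B L in
  spectral_eigenvalue_set mu (intset T) /\
  ((forall K, exists2 k, (K <= k)%N & (1 < #|` D k|)%N) ->
   forall s : R, 0 <= s -> (s%:E <= kappa R q D)%E ->
     (integer_spectra mu T s #= [set: set nat])%card).
Proof.
move=> T; have T1 : T 1 := common_scalings1 hBL.
have [beta [b0 HS0]] := hadamard_moran hBL hrho omega hn.
pose dg k := enum_fset (D k); pose W := hadamard_residues N L omega n.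
have HS : moran_system q dg W T (min_ratio R N B) beta b0.
  rewrite (_ : q = fun k => N (omega k) ^ n k)%N; last exact/funext.
  by rewrite (_ : dg = fun k => enum_fset (B (omega k))) //; apply/funext => k; rewrite /dg hD.
have D0 k : D k != fset0 by rewrite hD; exact: digits_neq0 hrho _.
have cvg_mu x := cvg_sqmod_cf (xi := x) (ms_q2 HS) D0 hmu.
have [kap [kE kap0 up lo]] := kappa_real HS.
have spec Ls es t : tower R q dg T Ls es -> T t ->
    spectrum mu (scale_set t%:~R (intset [set l | exists j, l \in Ls j])).
  by move=> HT Tt; apply: (tower_spectrum HS T1 cvg_mu HT Tt); case: Tt.
split.
  split; first by move=> [t [t0 _] /eqP]; rewrite intr_eq0 (negbTE t0).
  have [Lam [_ hL _]] := runs_exist HS T1 kap0 (lexx _) up lo.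
  have [Ls [es [HT _]]] := hL xpredT.
  exists (intset [set l | exists j, l \in Ls j]); split; last first.
    by move=> _ [t Tt <-]; exact: spec HT Tt.
  have := spec _ _ _ HT T1; congr (spectrum mu _).
  rewrite /scale_set; apply/seteqP; split => [_ [x Xx <-]|x Xx]; first by rewrite mul1r.
  by exists x => //; rewrite mul1r.
move=> nt s s0; rewrite kE lee_fin => skap.
have [Lam [hdim hL /(_ nt) Laminj]] := runs_exist HS T1 s0 skap up lo.
apply: Cantor_Bernstein; first exact: set_int_card_le.
(* the bits of a run are read off a set of natural numbers *)
pose F (X : set nat) := Lam (fun j => `[< X j >]).
have Finj : injective F.
  move=> X Y /Laminj E; apply/funext => j; apply/propext.
  by apply: asbool_eq_equiv; exact: (congr1 (fun f => f j) E).
rewrite -(card_le_eql (inj_card_eq (in2W Finj) : F @` setT #= setT)%card).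
apply: subset_card_le => _ [X _ <-]; split; last exact: hdim.
have [Ls [es [HT XE]]] := hL (fun j => `[< X j >]).
by move=> t Tt; rewrite /F XE; exact: spec HT Tt.
Qed.
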